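(* Let $A\in\{0,1\}^k$ and assume the linear marginal structural model $\int\mu_a(x)\,d\mathbb{P}(x)=\psi_0+\sum_{j=1}^k\psi_ja_j$ for all $a=(a_1,\dots,a_k)\in\{0,1\}^k$, with known intercept $\psi_0\in\mathbb{R}$ and $\psi\in\mathbb{R}^k$ satisfying $\|\psi\|_0\le s$. Let $\widehat\psi$ be either the Lasso estimator $\widehat\psi_{\text{lasso}}$ or the best subset selection estimator $\widehat\psi_{\text{subset}}$ (defined in the context). Assume that for all $a\in\{0,1\}^k$, almost surely, (i) $|\widehat\varpi_a/\widehat\pi_a(X)|\le B$; (ii) $v^T\mathbb{E}(AA^T)v\ge D\|v\|_2^2$ for all $v\ne0$; (iii) $\sup_{\|v\|_2=1,\ \|v\|_1\le2\sqrt{s}}\left|v^T\left(\mathbb{E}(AA^T)-\frac1n\mathbb{A}^T\mathbb{A}\right)v\right|\le\frac D2$ with probability at least $1-\alpha$ for some $\alpha\le C_\alpha\frac{\log k}{n}$, where $\mathbb{A}$ is the $n\times k$ matrix with rows $A_1^T,\dots,A_n^T$; (iv) $|Y|,\ |\widehat\mu|,\ |\psi_0|\le B$, for constants $B,C_\alpha,D>0$ independent of $k$ and $n$. Assume $\delta_n(a)\le\delta_n$ and $\epsilon_n(a)\le\epsilon_n$ for all $a\in\{0,1\}^k$. Then, for $s^4\log k\lesssim n$, $$\mathbb{E}\left(\{A^T(\widehat\psi-\psi)\}^2\right)\lesssim s\,\frac{\log k}{n}+s(\delta_n\epsilon_n)^2.$$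
   Context: $Z=(X,A,Y)\sim\mathbb{P}$ with $X\in\mathbb{R}^d$, $A\in\{0,1\}^k$, $Y\in\mathbb{R}$. $D_1$ and $D_2=(Z_1,\dots,Z_n)$ are two independent samples, each of $n$ i.i.d. copies of $Z$; $A_1,\dots,A_n$ are the treatments in $D_2$ and $\mathbb{P}_n^2$ is the sample average over $D_2$. $\mu_a(x)=\mathbb{E}(Y\mid X=x,A=a)$, $\pi_a(x)=\mathbb{P}(A=a\mid X=x)$, with $\pi_a(x)>0$ for all $a$. $\widehat\mu_a,\widehat\pi_a$ are (arbitrary) estimators of $\mu_a,\pi_a$ constructed from $D_1$ only, and $\widehat\varpi_a$ is the proportion of observations in $D_1$ with treatment $a$. With $\|f\|=(\int f(x)^2\,d\mathbb{P}(x))^{1/2}$ (with $D_1$ held fixed), $\delta_n(a)=\|\pi_a/\widehat\pi_a-1\|$, $\epsilon_n(a)=\|\mu_a-\widehat\mu_a\|$; $\delta_n,\epsilon_n$ are non-random. Empirical risk, for $\beta\in\mathbb{R}^k$: $$\widehat R(\beta)=\mathbb{P}_n^2\left\{-2\sum_{a\in\{0,1\}^k}\left[\frac{\mathbf 1(A=a)}{\widehat\pi_a(X)}\{Y-\widehat\mu_a(X)\}+\widehat\mu_a(X)-\psi_0\right]a^T\beta\,\widehat\varpi_a+(A^T\beta)^2\right\}.$$ Estimators: $\widehat\psi_{\text{lasso}}\in\arg\min_{\|\beta\|_1\le t}\widehat R(\beta)$ with constraint level chosen as the true value $t=\|\psi\|_1$, and $\widehat\psi_{\text{subset}}\in\arg\min_{\|\beta\|_0\le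 s}\widehat R(\beta)$, where $\|v\|_1=\sum_j|v_j|$, $\|v\|_0=\#\{j:v_j\ne0\}$. In the conclusion, $A$ is a fresh copy of the treatment, independent of $D_1,D_2$. $\lesssim$ means inequality up to a multiplicative constant not depending on $n,k,s,\delta_n,\epsilon_n$ (it may depend on the constants in the assumptions).
   Formalization: For best subset selection, a least-norm minimiser is used if the argmin is infinite and 0 if it is empty, and s^4 log k ≤ c n is required with c at most a constant depending on B, C_α, D (the claim fails otherwise); k ≥ 2 is assumed. *)

(* Defs.v *)
From HB Require Import structures.
From mathcomp Require Import all_boot all_order all_algebra.
From mathcomp Require Import all_classical all_reals all_analysis.

Set Implicit Arguments.
Unset Strict Implicit.
Unset Printing Implicit Defensive.

Import Order.TTheory GRing.Theory Num.Theory.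
Import numFieldNormedType.Exports.

Local Open Scope classical_set_scope.
Local Open Scope ring_scope.

Notation treatment k := (k.-tuple bool).

(* An observation is the nested pair ((X, A), Y), with the product
   sigma-algebra. *)
Notation obs R d k := (d.-tuple R * k.-tuple bool * R)%type.

Section Observations.
Variables (R : realType) (d k : nat).

Definition covX (z : obs R d k) : d.-tuple R := z.1.1.
Definition trtA (z : obs R d k) : k.-tuple bool := z.1.2.
Definition outY (z : obs R d k) : R := z.2.

Definition trt_vec (a : treatment k) : 'cV[R]_k := \col_j (tnth a j)%:R.

Definition trt_dot (a : treatment k) (b : 'cV[R]_k) : R :=
  \sum_(j < k) (tnth a j)%:R * b j 0.

End Observations.

Section Norms.
Variables (R : realType) (k : nat).

Definition norm0 (v : 'cV[R]_k) : nat := #|[set j : 'I_k | v j 0 != 0]%SET|.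
Definition norm1 (v : 'cV[R]_k) : R := \sum_(j < k) `|v j 0|.
Definition norm2 (v : 'cV[R]_k) : R := Num.sqrt (\sum_(j < k) v j 0 ^+ 2).

Definition quad_form (M : 'M[R]_k) (v : 'cV[R]_k) : R :=
  (v^T *m M *m v) 0 0.

End Norms.

Section Sampling.
Variables (R : realType) (d0 d1 : measure_display).
Variables (Omega : measurableType d0) (T : measurableType d1).
Variable Pr : probability Omega R.

(* Taking some of the E i to be the whole space yields the product rule over
   every subfamily. *)
Definition mutually_independent (I : finType) (F : I -> Omega -> T) : Prop :=
  forall E : I -> set T, (forall i, measurable (E i)) ->
    Pr (\bigcap_(i in [set: I]) (F i @^-1` E i)) =
    (\prod_(i : I) Pr (F i @^-1` E i))%E.

Definition has_law (F : Omega -> T) (P : probability T R) : Prop :=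
  measurable_fun [set: Omega] F /\
  forall E : set T, measurable E -> Pr (F @^-1` E) = P E.

Definition joint_family (n : nat) (D1 D2 : 'I_n -> Omega -> T)
    (Z0 : Omega -> T) (i : option ('I_n + 'I_n)) : Omega -> T :=
  match i with
  | None => Z0
  | Some (inl i) => D1 i
  | Some (inr i) => D2 i
  end.

(* The two samples and the fresh copy Z0 together form a single i.i.d. family,
   so D1, D2 and Z0 are in particular independent of one another. *)
Definition iid_samples (P : probability T R) (n : nat)
    (D1 D2 : 'I_n -> Omega -> T) (Z0 : Omega -> T) : Prop :=
  (forall i, has_law (joint_family D1 D2 Z0 i) P) /\
  mutually_independent (joint_family D1 D2 Z0).

Definition dataset (n : nat) (D : 'I_n -> Omega -> T) (w : Omega) :
  n.-tuple T := [tuple D i w | i < n].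

End Sampling.

Section Population.
Variables (R : realType) (d k : nat) (P : probability (obs R d k) R).

(* pi is a version of P(A = a | X = x). *)
Definition is_propensity (pi : treatment k -> d.-tuple R -> R) : Prop :=
  forall a : treatment k,
    measurable_fun [set: d.-tuple R] (pi a) /\
    forall E : set (d.-tuple R), measurable E ->
      P [set z : obs R d k | E (covX z) /\ trtA z = a] =
      (\int[P]_(z in [set z : obs R d k | E (covX z)]) (pi a (covX z))%:E)%E.

(* mu is a version of E(Y | X = x, A = a). *)
Definition is_regression (mu : treatment k -> d.-tuple R -> R) : Prop :=
  forall a : treatment k,
    [/\ measurable_fun [set: d.-tuple R] (mu a),
        P.-integrable [set z : obs R d k | trtA z = a]
          (fun z => (mu a (covX z))%:E) &
        forall E : set (d.-tuple R), measurable E ->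
          (\int[P]_(z in [set z : obs R d k | E (covX z) /\ trtA z = a])
             (outY z)%:E =
           \int[P]_(z in [set z : obs R d k | E (covX z) /\ trtA z = a])
             (mu a (covX z))%:E)%E].

(* E(A A^T) *)
Definition second_moment : 'M[R]_k :=
  \matrix_(i, j)
    fine ('E_P[fun z => (trt_vec R (trtA z) *m (trt_vec R (trtA z))^T) i j]).

End Population.

Section Estimation.
Variables (R : realType) (d k n : nat).

(* The matrix whose i-th row is A_i^T. *)
Definition design (D : n.-tuple (obs R d k)) : 'M[R]_(n, k) :=
  \matrix_(i, j) (tnth (trtA (tnth D i)) j)%:R.

Definition trt_freq (D : n.-tuple (obs R d k)) (a : treatment k) : R :=
  (#|[set i : 'I_n | trtA (tnth D i) == a]%SET|)%:R / n%:R.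

(* A nuisance estimator: the estimate of a family of functions of x indexed by
   the treatments, built from one sample. *)
Definition nuisance : Type :=
  n.-tuple (obs R d k) -> treatment k -> d.-tuple R -> R.

Definition nuisance_measurable (h : nuisance) : Prop :=
  forall a : treatment k,
    measurable_fun [set: n.-tuple (obs R d k) * d.-tuple R]
      (fun p : n.-tuple (obs R d k) * d.-tuple R => h p.1 a p.2).

(* D1 is the sample used for the nuisance estimators, D2 the one that is
   averaged over. *)
Definition emp_risk (psi0 : R) (muhat pihat : nuisance)
    (D1 D2 : n.-tuple (obs R d k)) (b : 'cV[R]_k) : R :=
  n%:R^-1 * \sum_(i < n)
    (let z := tnth D2 i in
     - 2 * (\sum_(a : treatment k)
         ((trtA z == a)%:R / pihat D1 a (covX z)
            * (outY z - muhat D1 a (covX z))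
          + muhat D1 a (covX z) - psi0) * trt_dot a b * trt_freq D1 a)
     + trt_dot (trtA z) b ^+ 2).

Definition psi_measurable
    (psihat : n.-tuple (obs R d k) -> n.-tuple (obs R d k) -> 'cV[R]_k) :
    Prop :=
  forall j : 'I_k,
    measurable_fun [set: n.-tuple (obs R d k) * n.-tuple (obs R d k)]
      (fun p : n.-tuple (obs R d k) * n.-tuple (obs R d k) =>
         psihat p.1 p.2 j 0).

End Estimation.

Section Selection.
Variables (R : realType) (k : nat).

Definition argmin (C : set 'cV[R]_k) (f : 'cV[R]_k -> R) : set 'cV[R]_k :=
  [set b | C b /\ forall b', C b' -> f b <= f b'].

Inductive method := Lasso | BestSubset.

(* The l1-ball is compact, so for the Lasso the argmin is never empty, and any
   of its elements may be selected.
   The l0-ball is unbounded.  For a degenerate sample Gram matrix (for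
   instance, all A_i in the second sample equal to 0) the minimisers of the
   quadratic risk over it can be non-existent, or can contain a whole line.
   Either can have positive probability, so the estimator needs a convention
   there: any minimiser if there are finitely
   many, one of least Euclidean norm if there are infinitely many, and 0 if
   there is none. *)
Definition selected (m : method) (psi : 'cV[R]_k) (s : nat)
    (Rhat : 'cV[R]_k -> R) (b : 'cV[R]_k) : Prop :=
  match m with
  | Lasso => argmin [set b' | norm1 b' <= norm1 psi] Rhat b
  | BestSubset =>
      let M := argmin [set b' | (norm0 b' <= s)%N] Rhat in
      (M b /\ (infinite_set M -> forall b', M b' -> norm2 b <= norm2 b')) \/
      (M = set0 /\ b = 0)
  end.

End Selection.

(* Main.v *)
From HB Require Import structures.
Require Import Defs.
From mathcomp Require Import all_boot all_order all_algebra.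
From mathcomp Require Import all_classical all_reals all_analysis.
From mathcomp Require Import measurable_realfun.
From mathcomp Require Import ring lra.

(** Write [v] for [psihat - psi], [G] for E(A A^T), [Gh] for the Gram matrix of
    the treatments in the second sample and [bh] for the average over that
    sample of the doubly robust score.  The fresh observation is independent of
    both samples, so the risk is the mean of [v^T G v] ([fresh_copy]); it is
    enough to dominate this variable almost surely by one of small mean
    ([risk_assembly]).

    The empirical risk of [b] is [b^T Gh b - 2 bh^T b].  Comparing its values at
    [psihat] and [psi] gives [v^T Gh v <= 2 eta |v|_1], where [eta] is the largest
    entry of [bh - Gh psi] ([basic_inequality]).  For both estimators [v] lies in
    the cone [|v|_1 <= 2 sqrt s |v|_2] ([lasso_cone], [sparse_cone]).  When [Gh]
    and [G] differ by at most [D / 2] on that cone, the lower bound on [G] turns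
    this into [v^T G v <= 64 s eta^2 / D] ([good_event_bound]).

    The noise [eta] is controlled conditionally on the first sample.  The entry
    [bh_j - (Gh psi)_j] is an average of bounded terms over the second sample,
    so it is its conditional mean plus a centered average.  By double robustness
    the conditional mean is, up to [delta * epsilon], the same average of
    [A_j A^T psi] over the first sample minus its expectation, because the
    treatments are weighted by their frequencies in the first sample
    ([aipw_bias], [score_bias]).  Both centered averages are sub-Gaussian, so
    the maximum over [j] of their squares has mean of order [log k / n]
    ([sample_mean_max_sqr], [score_deviation]).

    On the event where [Gh] is far from [G], the Lasso has [|v|_1 <= 2 |psi|_1],
    whose square is of order [s], and the event has probability of order
    [log k / n].  The best subset estimator is not bounded a priori, but the
    treatments are binary: a minimiser of minimal support solves a nonsingular
    linear system of size at most [s] with integer matrix, so its determinant is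
    at least 1 in absolute value and Cramer's rule bounds the solution by a
    constant times [(s n)^(s + 2)].  The choice of a minimiser of least norm
    transfers the bound to the estimator ([best_subset_norm_le]).  Hoeffding's
    inequality for the entries of [Gh] bounds the probability of the event by
    [2 k^2 exp (- c n / s^2)], and [s^4 log k <= c0 n] is what makes this beat
    the power of [s n] ([exponential_beats_cramer], [gram_near_excess]). *)

Set Implicit Arguments.
Unset Strict Implicit.
Unset Printing Implicit Defensive.

Import Order.TTheory GRing.Theory Num.Theory.
Import numFieldNormedType.Exports.

Local Open Scope classical_set_scope.
Local Open Scope ring_scope.

(** * Independence and integrating out one observation *)

Section IndependentFamilies.
Context (d0 d1 : measure_display) (Omega : measurableType d0)
  (T : measurableType d1) (R : realType) (Pr : probability Omega R).
Context (I : finType) (F : I -> Omega -> T).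
Hypothesis mF : forall i, measurable_fun [set: Omega] (F i).
Hypothesis indF : mutually_independent Pr F.

(** The boxes that leave coordinate [i0] free: a pi-system that generates the
    sigma-algebra of the other coordinates. *)
Definition boxes (i0 : I) : set (set Omega) :=
  [set A | exists E : I -> set T, [/\ forall i, measurable (E i), E i0 = setT &
     A = \bigcap_(i in [set: I]) (F i @^-1` E i)]].

(** [U] depends on the coordinates other than [i0] only, expressed by
    measurability for the sigma-algebra that they generate. *)
Definition avoids (i0 : I) d' (T' : measurableType d') (U : Omega -> T') :=
  measurable_fun [set: g_sigma_algebraType (boxes i0)] U.

Lemma measurable_preimF i E : measurable E -> measurable (F i @^-1` E).
Proof. by move=> mE; rewrite -[X in measurable X]setTI; exact: mF. Qed.

Lemma measurable_bigcapF (E : I -> set T) : (forall i, measurable (E i)) ->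
  measurable (\bigcap_(i in [set: I]) (F i @^-1` E i)).
Proof.
move=> mE; apply: fin_bigcap_measurable; first exact: finite_finset.
by move=> i _; exact: measurable_preimF.
Qed.

Lemma boxes_measurable i0 : <<s boxes i0 >> `<=` measurable.
Proof.
apply: smallest_sub; first exact: sigma_algebra_measurable.
by move=> _ [E [mE _ ->]]; exact: measurable_bigcapF.
Qed.

Lemma avoids_measurable_fun i0 d' (T' : measurableType d') (U : Omega -> T') :
  avoids i0 U -> measurable_fun [set: Omega] U.
Proof. by move=> aU _ A mA; apply: (@boxes_measurable i0); exact: aU. Qed.

Lemma boxes_setI i0 : setI_closed (boxes i0).
Proof.
move=> _ _ [E [mE E0 ->]] [E' [mE' E0' ->]].
exists (fun i => E i `&` E' i); split.
- by move=> i; exact: measurableI.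
- by rewrite E0 E0' setTI.
- by rewrite -bigcapI.
Qed.

Lemma avoids_coord i0 i : i != i0 -> avoids i0 (F i).
Proof.
move=> ii0 _ A mA; rewrite setTI; apply: sub_sigma_algebra.
exists (fun j => if j == i then A else setT); split.
- by move=> j; case: ifP.
- by rewrite eq_sym (negbTE ii0).
- apply/seteqP; split => [w /= Aw j _|w /(_ i Logic.I)]; last by rewrite eqxx.
  by rewrite /=; case: eqP => // ->.
Qed.

(** In [A], both sides are finite measures which agree on the boxes. *)
Lemma boxes_indep i0 (A : set Omega) (B : set T) : <<s boxes i0 >> A ->
  measurable B ->
  Pr (A `&` F i0 @^-1` B) = (Pr A * Pr (F i0 @^-1` B))%E.
Proof.
move=> sA mB; have mV : measurable (F i0 @^-1` B) by exact: measurable_preimF.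
have PVf : Pr (F i0 @^-1` B) \is a fin_num by exact: fin_num_measure.
pose c : {nonneg R} := NngNum (fine_ge0 (measure_ge0 Pr (F i0 @^-1` B))).
have cE : c%:num%:E = Pr (F i0 @^-1` B) by rewrite /= fineK.
have cE' X : mscale c Pr X = (Pr (F i0 @^-1` B) * Pr X)%E by rewrite -cE.
transitivity (mscale c Pr A); last by rewrite cE' muleC.
change (mrestr Pr mV A = mscale c Pr A).
have mT : boxes i0 setT.
  exists (fun=> setT); split => //.
  by apply/seteqP; split.
apply: (g_sigma_algebra_measure_unique (boxes i0) _ (fun=> setT)) sA => //.
- by move=> X bX; apply: (@boxes_measurable i0); exact: sub_sigma_algebra.
- by apply/seteqP; split => // w _; exists 0%N.
- exact: boxes_setI.
- move=> _ [E [mE E0 ->]]; rewrite [RHS]cE' /= /mrestr.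
  pose E' i := if i == i0 then B else E i.
  have -> : \bigcap_(i in [set: I]) (F i @^-1` E i) `&` F i0 @^-1` B =
            \bigcap_(i in [set: I]) (F i @^-1` E' i).
    apply/seteqP; split => [w [Ew Bw] i _|w Ew]; rewrite /E' /=.
      by case: eqP => [->//|_]; exact: Ew.
    split => [i _|]; have := Ew i0 Logic.I; rewrite /E' /= eqxx // => Bw.
    by have := Ew i Logic.I; rewrite /E' /=; case: eqP => [->|//]; rewrite E0.
  rewrite indF; last by move=> i; rewrite /E'; case: ifP.
  rewrite indF// (bigD1 i0)//= [in RHS](bigD1 i0)//= {1}/E' eqxx E0.
  rewrite preimage_setT probability_setT mul1e; congr (_ * _)%E.
  by apply: eq_bigr => i /negbTE ii0; rewrite /E' ii0.
- by move=> k; rewrite /= /mrestr /= setTI ltey_eq PVf.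
Qed.

(** The law of [(U, F i0)] is a product law, since it factorises on rectangles;
    Tonelli's theorem then integrates [F i0] out with [U] held fixed. *)
Lemma indep_tonelli i0 (P : probability T R) d' (T' : measurableType d')
    (U : Omega -> T') (h : T' * T -> \bar R) :
  has_law Pr (F i0) P -> avoids i0 U ->
  measurable_fun [set: (T' * T)%type] h -> (forall x, (0 <= h x)%E) ->
  (\int[Pr]_w h (U w, F i0 w) = \int[Pr]_w \int[P]_z h (U w, z))%E.
Proof.
move=> [_ lF] aU mh h0; have mU := avoids_measurable_fun aU.
pose Um : {mfun Omega >-> T'} := HB.pack U (isMeasurableFun.Build _ _ _ _ _ mU).
have mUF : measurable_fun setT (fun w => (U w, F i0 w)).
  exact: measurable_fun_pair.
pose UF : {mfun Omega >-> (T' * T)%type} :=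
  HB.pack (fun w => (U w, F i0 w)) (isMeasurableFun.Build _ _ _ _ _ mUF).
have prodE X : measurable X ->
    (distribution Pr Um \x P)%E X = distribution Pr UF X.
  apply: product_measure_unique => A B mA mB.
  transitivity (Pr (U @^-1` A `&` F i0 @^-1` B)); first by [].
  rewrite (@boxes_indep i0) //; last first.
    by rewrite -[X in <<s _ >> X]setTI; exact: aU.
  by congr (_ * _)%E; exact: lF.
transitivity (\int[distribution Pr UF]_x h x)%E.
  by rewrite /= (ge0_integral_pushforward mUF) // => y _; exact: h0.
rewrite -(@eq_measure_integral _ _ _ _ _ (distribution Pr Um \x P)%E); last first.
  by move=> A mA _; exact: prodE.
rewrite fubini_tonelli1 //.
rewrite (ge0_integral_pushforward mU) //.
  exact: measurable_fun_fubini_tonelli_F.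
by move=> y _; exact: integral_ge0.
Qed.

End IndependentFamilies.

(** * Exponential moments of sums of centered observations *)

Section SubGaussianSums.
Context (R : realType).

(** The linear term has mean zero for a centered variable, which leaves a
    Gaussian exponential moment. *)
Lemma expR_le_add_expR_sqr (x : R) : expR x <= x + expR (2 * x ^+ 2).
Proof.
have [x2|x2] := leP x (1 / 2); last first.
  apply: (@le_trans _ _ (expR (2 * x ^+ 2))); last by rewrite lerDr; lra.
  by rewrite ler_expR; nra.
have e2 : 1 + 2 * x ^+ 2 <= expR (2 * x ^+ 2) by exact: expR_ge1Dx.
suff : expR x <= 1 + x + 2 * x ^+ 2 by lra.
have p : 0 < 1 - x / 2 by lra.
have h : expR (x / 2) <= (1 - x / 2)^-1.
  rewrite -[X in expR X]opprK expRN lef_pV2 ?posrE ?expR_gt0 //.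
  exact: expR_ge1Dx.
have -> : expR x = expR (x / 2) ^+ 2 by rewrite -expRM_natl; congr expR; lra.
apply: (@le_trans _ _ ((1 - x / 2)^-1 ^+ 2)).
  by rewrite lerXn2r // nnegrE ?invr_ge0 ?expR_ge0 // ltW.
rewrite exprVn -div1r ler_pdivrMr ?exprn_gt0 //.
rewrite -subr_ge0.
have -> : (1 + x + 2 * x ^+ 2) * (1 - x / 2) ^+ 2 - 1 =
  x ^+ 2 * (5 / 4 - 7 / 4 * x + x ^+ 2 / 2) by field.
by rewrite mulr_ge0 ?sqr_ge0 //; nra.
Qed.

Context d1 (T : measurableType d1) (P : probability T R).

Lemma bounded_integrable (f : T -> R) (c : R) :
  measurable_fun [set: T] f -> (forall z, `|f z| <= c) ->
  P.-integrable [set: T] (EFin \o f).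
Proof.
move=> mf fc; apply: measurable_bounded_integrable => //=.
  by rewrite probability_setT ltry.
by exists c; split => [|x cx y _]; [rewrite num_real|exact: (le_trans (fc y) (ltW cx))].
Qed.

Lemma integral_expR_centered (g : T -> R) (c : R) :
  measurable_fun [set: T] g -> (forall z, `|g z| <= c) ->
  (\int[P]_z (g z)%:E = 0)%E ->
  (\int[P]_z (expR (g z))%:E <= (expR (2 * c ^+ 2))%:E)%E.
Proof.
move=> mg gc g0.
have ig := bounded_integrable mg gc.
apply: (@le_trans _ _ (\int[P]_z ((g z)%:E + (expR (2 * c ^+ 2))%:E))%E).
  apply: le_integral => //=.
  - apply: (bounded_integrable (c := expR c)) => [|z].
      exact: measurableT_comp.
    rewrite ger0_norm ?expR_ge0 // ler_expR.
    exact: le_trans (ler_norm _) (gc z).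
  - apply: integrableD => //; exact: finite_measure_integrable_cst.
  - move=> z _; rewrite -EFinD lee_fin.
    apply: (le_trans (expR_le_add_expR_sqr _)); rewrite lerD2l ler_expR.
    rewrite ler_wpM2l // -[X in X <= _]real_normK ?num_real //.
    by rewrite lerXn2r // nnegrE // (le_trans _ (gc z)).
rewrite integralD //; last exact: finite_measure_integrable_cst.
by rewrite g0 add0e integral_cst //= probability_setT mule1.
Qed.

Context d0 (Omega : measurableType d0) (Pr : probability Omega R).
Context (I : finType) (F : I -> Omega -> T).
Hypothesis mF : forall i, measurable_fun [set: Omega] (F i).
Hypothesis indF : mutually_independent Pr F.

(** Induction on [s]: the sum over the other indices avoids the first index [i],
    so [F i] can be integrated out with the rest held fixed, which costs one
    factor [expR (2 * c ^+ 2)]. *)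
Lemma integral_expR_sum d' (T' : measurableType d') (U : Omega -> T')
    (g : T' * T -> R) (c : R) (s : seq I) :
  measurable_fun [set: (T' * T)%type] g -> (forall x, `|g x| <= c) ->
  (forall u, \int[P]_z (g (u, z))%:E = 0)%E ->
  uniq s -> (forall i, i \in s -> has_law Pr (F i) P /\ avoids F i U) ->
  (\int[Pr]_w (expR (\sum_(i <- s) g (U w, F i w)))%:E <=
    ((expR (2 * c ^+ 2)) ^+ size s)%:E)%E.
Proof.
move=> mg gc g0; elim: s => [_ _|i s IH /= /andP[nis us] Hs].
  under eq_integral do rewrite big_nil expR0.
  by rewrite integral_cst //= probability_setT mule1.
have [lF aU] := Hs i (mem_head _ _).
have aV : avoids F i (fun w => (U w, \sum_(j <- s) g (U w, F j w))).
  apply: measurable_fun_pair => //.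
  rewrite (_ : (fun w => _) = fun w => \sum_(j <- s)
      if j == i then 0 else g (U w, F j w)); last first.
    apply/funext => w; apply: eq_big_seq => j js.
    by case: eqP => // ji; move: nis; rewrite -ji js.
  apply: measurable_sum => j; case: (eqVneq j i) => // ji.
  have H : measurable_fun [set: g_sigma_algebraType (boxes F i)] (fun w => (U w, F j w)).
    apply: measurable_fun_pair; [exact: aU|exact: avoids_coord].
  exact: (measurableT_comp mg H).
pose h (x : T' * R * T) := (expR x.1.2 * expR (g (x.1.1, x.2)))%:E.
have mh : measurable_fun [set: (T' * R * T)%type] h.
  apply/measurable_EFinP; apply: measurable_funM.
    apply: measurableT_comp => //.
    by apply: (measurableT_comp (f := snd)).
  apply: measurableT_comp => //; apply: measurableT_comp => //.
  apply: measurable_fun_pair => //.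
  by apply: (measurableT_comp (f := fst)).
under eq_integral.
  move=> w _; rewrite big_cons addrC expRD.
  over.
rewrite (indep_tonelli mF indF lF aV mh); last first.
  by move=> x; rewrite lee_fin mulr_ge0 ?expR_ge0.
have mS : measurable_fun [set: Omega]
    (fun w => (expR (\sum_(j <- s) g (U w, F j w)))%:E).
  apply/measurable_EFinP; apply: measurableT_comp => //.
  exact: (measurableT_comp measurable_snd (avoids_measurable_fun mF aV)).
apply: (@le_trans _ _ (\int[Pr]_w ((expR (\sum_(j <- s) g (U w, F j w)))%:E *
    (expR (2 * c ^+ 2))%:E))%E).
  apply: ge0_le_integral => //=.
  - by move=> w _; apply: integral_ge0 => z _; rewrite lee_fin mulr_ge0 ?expR_ge0.
  - apply: (measurableT_comp (measurable_fun_fubini_tonelli_F (m2 := P) h mh _)) => /=.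
      by move=> x; rewrite lee_fin mulr_ge0 ?expR_ge0.
    exact: avoids_measurable_fun aV.
  - by apply: emeasurable_funM.
  - move=> w _; under eq_integral do rewrite /h /= EFinM.
    have mgw : measurable_fun [set: T] (fun z => g (U w, z)).
      by apply: (measurableT_comp mg); exact: measurable_fun_pair.
    have mE : measurable_fun [set: T] (fun z => (expR (g (U w, z)))%:E).
      by apply/measurable_EFinP; apply: measurableT_comp.
    rewrite ge0_integralZl //.
    rewrite lee_wpmul2l ?lee_fin ?expR_ge0 //.
    exact: integral_expR_centered.
rewrite ge0_integralZr //.
rewrite [X in (_ <= X%:E)%E]exprSr EFinM lee_wpmul2r ?lee_fin ?expR_ge0 //.
by apply: IH => // j js; apply: Hs; rewrite inE js orbT.
Qed.

End SubGaussianSums.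

(** * Maximal and tail inequalities for averages *)

Lemma ge0_integral_affine (R : realType) d0 (Omega : measurableType d0)
    (Pr : probability Omega R) (f : Omega -> R) (a b : R) :
  measurable_fun [set: Omega] f -> (forall w, 0 <= f w) -> 0 <= a -> 0 <= b ->
  (\int[Pr]_w (a + b * f w)%:E = a%:E + b%:E * \int[Pr]_w (f w)%:E)%E.
Proof.
move=> mf f0 a0 b0; have mfE : measurable_fun [set: Omega] (fun w => (f w)%:E).
  exact/measurable_EFinP.
under eq_integral do rewrite EFinD EFinM.
rewrite ge0_integralD //=; first last.
- exact: measurable_funeM.
- by move=> w _; rewrite -EFinM lee_fin mulr_ge0.
by rewrite integral_cst //= probability_setT mule1 ge0_integralZl_EFin //= => w _; rewrite lee_fin.
Qed.

Lemma ln_ge_half (R : realType) (k : nat) : (1 < k)%N -> 1 / 2 <= ln k%:R :> R.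
Proof.
move=> k1; have k2 : 2 <= k%:R :> R by rewrite ler_nat.
rewrite -ler_expR lnK ?posrE ?ltr0n ?(ltn_trans _ k1) // (le_trans _ k2) //.
rewrite -[X in expR X]opprK expRN invf_ple ?posrE ?expR_gt0 //.
by apply: le_trans (expR_ge1Dx _); lra.
Qed.

Section MaximalInequality.
Context (R : realType) (d0 d1 : measure_display) (Omega : measurableType d0)
  (T : measurableType d1) (P : probability T R) (Pr : probability Omega R).
Context (I : finType) (F : I -> Omega -> T).
Hypothesis mF : forall i, measurable_fun [set: Omega] (F i).
Hypothesis indF : mutually_independent Pr F.
Context (d' : measure_display) (T' : measurableType d') (U : Omega -> T').
Context (J : finType) (g : J -> T' * T -> R) (c : R) (s : seq I).
Hypothesis mU : measurable_fun [set: Omega] U.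
Hypothesis mg : forall j, measurable_fun [set: (T' * T)%type] (g j).
Hypothesis c_gt0 : 0 < c.
Hypothesis gc : forall j x, `|g j x| <= c.
Hypothesis g0 : forall j u, (\int[P]_z (g j (u, z))%:E = 0)%E.
Hypothesis us : uniq s.
Hypothesis s_gt0 : (0 < size s)%N.
Hypothesis Fs : forall i, i \in s -> has_law Pr (F i) P /\ avoids F i U.

Local Notation n := ((size s)%:R : R).

Definition emp_mean (j : J) (w : Omega) : R :=
  n^-1 * \sum_(i <- s) g j (U w, F i w).

Definition expR_pair (lam : R) (w : Omega) : R :=
  \sum_j (expR (lam * emp_mean j w) + expR (- lam * emp_mean j w)).

Lemma measurable_emp_mean j : measurable_fun [set: Omega] (emp_mean j).
Proof.
apply: measurable_funM => //; apply: measurable_sum => i.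
by apply: (measurableT_comp (mg j)); exact: measurable_fun_pair.
Qed.

Lemma measurable_expR_pair lam : measurable_fun [set: Omega] (expR_pair lam).
Proof.
have m a j : measurable_fun [set: Omega] (fun w => expR (a * emp_mean j w)).
  apply: measurableT_comp => //; apply: measurable_funM => //.
  exact: measurable_emp_mean.
by apply: measurable_sum => j; exact: measurable_funD.
Qed.

Lemma expR_pair_ge0 lam w : 0 <= expR_pair lam w.
Proof. by apply: sumr_ge0 => j _; rewrite addr_ge0 ?expR_ge0. Qed.

Lemma integral_expR_emp_mean (lam : R) j :
  (\int[Pr]_w (expR (lam * emp_mean j w))%:E <=
    (expR (2 * lam ^+ 2 * c ^+ 2 / n))%:E)%E.
Proof.
have n0 : 0 < n by rewrite ltr0n.
under eq_integral do rewrite /emp_mean mulrA mulr_sumr.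
apply: (le_trans (integral_expR_sum (P := P) mF indF (U := U)
  (g := fun x => lam / n * g j x) (c := `|lam / n| * c) _ _ _ us Fs)).
- exact: measurable_funM.
- by move=> x; rewrite normrM ler_wpM2l.
- move=> u; under eq_integral do rewrite EFinM.
  rewrite integralZl ?g0 ?mule0 //; apply: (bounded_integrable P (c := c)) => //.
  by apply: (measurableT_comp (mg j)); exact: measurable_fun_pair.
- rewrite lee_fin -expRM_natl ler_expR exprMn real_normK ?num_real //.
  by rewrite le_eqVlt; apply/orP; left; apply/eqP; field; rewrite pnatr_eq0 -lt0n s_gt0.
Qed.

Lemma integral_expR_pair (lam : R) :
  (\int[Pr]_w (expR_pair lam w)%:E <=
    (2 * #|J|%:R * expR (2 * lam ^+ 2 * c ^+ 2 / n))%:E)%E.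
Proof.
have mE a j : measurable_fun [set: Omega] (fun w => (expR (a * emp_mean j w))%:E).
  apply/measurable_EFinP; apply: measurableT_comp => //.
  by apply: measurable_funM => //; exact: measurable_emp_mean.
under eq_integral do rewrite /expR_pair -sumEFin.
rewrite ge0_integral_sum //; first last.
- move=> j; apply/measurable_EFinP.
  by apply: measurable_funD; apply/measurable_EFinP; exact: mE.
apply: (@le_trans _ _ (\sum_(j : J) (2 * expR (2 * lam ^+ 2 * c ^+ 2 / n))%:E)%E).
  apply: lee_sum => j _; under eq_integral do rewrite EFinD.
  rewrite ge0_integralD //.
  rewrite mulr_natl mulr2n EFinD; apply: leeD; first exact: integral_expR_emp_mean.
  by rewrite -[X in 2 * X * _ / _]sqrrN; exact: integral_expR_emp_mean.
rewrite sumEFin lee_fin sumr_const -[leLHS]mulr_natr le_eqVlt; apply/orP; left.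
by apply/eqP; ring.
Qed.

(** [u ^ 2 * exp (- u)] decreases for [u >= 2], so above the level [tau] the square
    is dominated by an exponential.  This replaces the integration of tails: a
    maximum of squares is at most [tau ^ 2] plus a sum of exponentials. *)
Lemma sqr_le_expR (lam tau x : R) : 0 < tau -> 2 <= lam * tau ->
  x ^+ 2 <= tau ^+ 2 * (1 + expR (- (lam * tau)) *
    (expR (lam * x) + expR (- lam * x))).
Proof.
move=> t0 lt2.
have l0 : 0 < lam by rewrite -(pmulr_lgt0 _ t0) (lt_le_trans _ lt2).
wlog x0 : x / 0 <= x.
  move=> H; have [/H//|x0] := leP 0 x.
  have := H (- x); rewrite oppr_ge0 ltW // sqrrN !mulrN !mulNr opprK.
  by rewrite [expR (- _) + _]addrC; apply.
have e0 (y : R) : 0 <= expR y by exact: expR_ge0.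
have [xt|tx] := leP x tau.
  rewrite (@le_trans _ _ (tau ^+ 2)) // ?lerXn2r ?nnegrE ?(ltW t0) //.
  by rewrite ler_peMr ?sqr_ge0 // lerDl mulr_ge0 ?addr_ge0.
apply: (@le_trans _ _ (tau ^+ 2 * expR (lam * (x - tau)))); last first.
  rewrite ler_pM2l ?exprn_gt0 // [_ * (expR _ + _)]mulrDr -expRD.
  rewrite (_ : - (lam * tau) + lam * x = lam * (x - tau)); last by ring.
  by rewrite addrCA lerDl addr_ge0 ?mulr_ge0.
have -> : expR (lam * (x - tau)) = expR (lam * (x - tau) / 2) ^+ 2.
  by rewrite -expRM_natl; congr expR; field.
rewrite -exprMn lerXn2r ?nnegrE ?mulr_ge0 // ?(ltW t0) //.
apply: (@le_trans _ _ (tau * (1 + lam * (x - tau) / 2))); last first.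
  by rewrite ler_pM2l // expR_ge1Dx.
have -> : tau * (1 + lam * (x - tau) / 2) = tau + lam * tau / 2 * (x - tau) by field.
rewrite -lerBlDl ler_peMl ?subr_ge0 ?(ltW tx) //; lra.
Qed.

(** With [tau] of order [sqrt (ln k / n)] and [lam * tau = 4 * ln k], the weight
    [expR (- (lam * tau)) = k ^- 4] absorbs both the exponential moments, of
    size [k ^ 2], and the sum over the [k] indices. *)
Lemma expected_max_sqr (k : nat) : #|J| = k -> (1 < k)%N ->
  exists Q : Omega -> R, [/\ measurable_fun [set: Omega] Q,
    forall w, 0 <= Q w, forall j w, emp_mean j w ^+ 2 <= Q w &
    (\int[Pr]_w (Q w)%:E <= (32 * c ^+ 2 * (ln k%:R / n))%:E)%E].
Proof.
move=> cardJ k1; have n0 : 0 < n by rewrite ltr0n.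
have kR : 2 <= k%:R :> R by rewrite ler_nat.
have k0 : 0 < k%:R :> R by rewrite ltr0n (ltn_trans _ k1).
have ln2 := ln_ge_half R k1.
pose L : R := ln k%:R; pose q := Num.sqrt (L / n).
have L0 : 0 < L by rewrite /L; lra.
have q0 : 0 < q by rewrite sqrtr_gt0 divr_gt0.
have q2 : q ^+ 2 = L / n by rewrite sqr_sqrtr // divr_ge0 // ltW.
pose lam := n * q / c; pose tau := 4 * c * q.
have tau0 : 0 < tau by rewrite !mulr_gt0.
have lt4 : lam * tau = 4 * L.
  have -> : lam * tau = 4 * n * q ^+ 2 by rewrite /lam /tau; field; rewrite gt_eqF.
  by rewrite q2; field; rewrite gt_eqF.
exists (fun w => tau ^+ 2 * (1 + expR (- (lam * tau)) * expR_pair lam w)); split.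
- do ![apply: measurable_funM => //|apply: measurable_funD => //].
  exact: measurable_expR_pair.
- by move=> w; rewrite mulr_ge0 ?sqr_ge0 // addr_ge0 // mulr_ge0 ?expR_ge0 // expR_pair_ge0.
- move=> j w; apply: (le_trans (sqr_le_expR (lam := lam) _ tau0 _)).
    by rewrite lt4 /L; lra.
  rewrite ler_pM2l ?exprn_gt0 // lerD2l ler_pM2l ?expR_gt0 // /expR_pair (bigD1 j) //=.
  by rewrite lerDl sumr_ge0 // => i _; rewrite addr_ge0 ?expR_ge0.
- under eq_integral do rewrite mulrDr mulr1 mulrA.
  have t2 : 0 <= tau ^+ 2 by rewrite sqr_ge0.
  have te : 0 <= tau ^+ 2 * expR (- (lam * tau)) by rewrite mulr_ge0 // expR_ge0.
  rewrite (ge0_integral_affine _ (measurable_expR_pair lam) (expR_pair_ge0 lam)) //.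
  apply: (@le_trans _ _ ((tau ^+ 2)%:E + (tau ^+ 2 * expR (- (lam * tau)))%:E *
     (2 * #|J|%:R * expR (2 * lam ^+ 2 * c ^+ 2 / n))%:E)%E).
    apply: leeD2l; apply: lee_wpmul2l; first by rewrite lee_fin.
    exact: integral_expR_pair.
  rewrite -EFinM -EFinD lee_fin.
  have -> : 2 * lam ^+ 2 * c ^+ 2 / n = 2 * L.
    rewrite /lam expr_div_n exprMn q2; field.
    by rewrite !gt_eqF.
  rewrite lt4 cardJ.
  have -> : expR (2 * L) = k%:R ^+ 2 by rewrite expRM_natl /L lnK ?posrE.
  have -> : expR (- (4 * L)) = k%:R ^- 4 by rewrite expRN expRM_natl /L lnK ?posrE.
  have -> : 32 * c ^+ 2 * (L / n) = tau ^+ 2 + tau ^+ 2.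
    by rewrite /tau !exprMn q2; ring.
  have -> : tau ^+ 2 * k%:R ^- 4 * (2 * k%:R * k%:R ^+ 2) = tau ^+ 2 * (2 / k%:R).
    by field; rewrite gt_eqF.
  by rewrite lerD2l ler_piMr // ler_pdivrMr // mul1r.
Qed.

(** Chernoff's bound and a union bound, with the indicator of the event replaced
    by a variable that dominates it. *)
Lemma expected_excess (t : R) : 0 < t ->
  exists Q : Omega -> R, [/\ measurable_fun [set: Omega] Q,
    forall w, 0 <= Q w, forall j w, t < `|emp_mean j w| -> 1 <= Q w &
    (\int[Pr]_w (Q w)%:E <=
       (2 * #|J|%:R * expR (- (n * t ^+ 2 / (8 * c ^+ 2))))%:E)%E].
Proof.
move=> t0; have n0 : 0 < n by rewrite ltr0n.
pose lam := t * n / (4 * c ^+ 2).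
have lam0 : 0 < lam by rewrite divr_gt0 ?mulr_gt0 ?exprn_gt0.
exists (fun w => expR (- (lam * t)) * expR_pair lam w); split.
- by apply: measurable_funM => //; exact: measurable_expR_pair.
- by move=> w; rewrite mulr_ge0 ?expR_ge0 // expR_pair_ge0.
- move=> j w tj; rewrite expRN mulrC ler_pdivlMr ?expR_gt0 // mul1r.
  rewrite /expR_pair (bigD1 j) //=.
  apply: ler_wpDr; first by apply: sumr_ge0 => i _; rewrite addr_ge0 ?expR_ge0.
  have [x0|x0] := leP 0 (emp_mean j w).
    rewrite ler_wpDr ?expR_ge0 // ler_expR ler_pM2l //.
    by rewrite -(ger0_norm x0) ltW.
  rewrite ler_wpDl ?expR_ge0 // ler_expR mulNr -mulrN ler_pM2l //.
  by rewrite -(ltr0_norm x0) ltW.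
- under eq_integral do rewrite -[_ * _]add0r.
  rewrite (ge0_integral_affine _ (measurable_expR_pair lam) (expR_pair_ge0 lam)) //.
  rewrite add0e.
  apply: (@le_trans _ _ ((expR (- (lam * t)))%:E *
     (2 * #|J|%:R * expR (2 * lam ^+ 2 * c ^+ 2 / n))%:E)%E).
    apply: lee_wpmul2l; first by rewrite lee_fin expR_ge0.
    exact: integral_expR_pair.
  rewrite -EFinM lee_fin mulrCA -expRD ler_wpM2l ?mulr_ge0 // ler_expR.
  rewrite le_eqVlt; apply/orP; left; apply/eqP; rewrite /lam; field.
  by rewrite pnatr_eq0 -lt0n s_gt0 gt_eqF.
Qed.

End MaximalInequality.

(** * Centering and transfer of almost sure statements *)

Section Centering.
Context (R : realType) (d1 d' : measure_display) (T : measurableType d1)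
  (T' : measurableType d') (P : probability T R).
Context (h : T' * T -> R) (c : R).
Hypothesis mh : measurable_fun [set: (T' * T)%type] h.
Hypothesis h_range : forall x, 0 <= h x <= c.

(** The conditional mean of [h (U, Z)] at [U = u], for [Z] of law [P] independent
    of [U]. *)
Definition cond_mean (u : T') : R := fine (\int[P]_z (h (u, z))%:E).

Definition centered (x : T' * T) : R := h x - cond_mean x.1.

Let mhu u : measurable_fun [set: T] (fun z => h (u, z)).
Proof. by apply: (measurableT_comp mh); exact: measurable_fun_pair. Qed.

Let ihu u : P.-integrable [set: T] (fun z => (h (u, z))%:E).
Proof.
apply: (bounded_integrable P (c := c)) => // z.
by case/andP: (h_range (u, z)) => ? ?; rewrite ger0_norm.
Qed.

Lemma cond_meanE u : (\int[P]_z (h (u, z))%:E = (cond_mean u)%:E)%E.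
Proof. by rewrite fineK //; exact: integrable_fin_num. Qed.

Lemma cond_mean_range u : 0 <= cond_mean u <= c.
Proof.
rewrite -!lee_fin -cond_meanE; apply/andP; split.
  by apply: integral_ge0 => z _; rewrite lee_fin; case/andP: (h_range (u, z)).
apply: (@le_trans _ _ (\int[P]_z c%:E)%E).
  apply: le_integral => //; first exact: finite_measure_integrable_cst.
  by move=> z _; rewrite lee_fin; case/andP: (h_range (u, z)).
by rewrite integral_cst //= probability_setT mule1.
Qed.

Lemma measurable_centered : measurable_fun [set: (T' * T)%type] centered.
Proof.
apply: measurable_funB => //.
apply: (@measurableT_comp _ _ _ _ _ _ cond_mean); last exact: measurable_fst.
apply: (measurableT_comp (f := fine)) => //.
have mhE : measurable_fun [set: (T' * T)%type] (fun x => (h x)%:E) by exact/measurable_EFinP.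
apply: (measurable_fun_fubini_tonelli_F (m2 := P) _ mhE) => x.
by rewrite lee_fin; case/andP: (h_range x).
Qed.

Lemma centered_le x : `|centered x| <= c.
Proof.
have /andP[? ?] := h_range x; have /andP[? ?] := cond_mean_range x.1.
by rewrite /centered ler_norml; apply/andP; split; lra.
Qed.

Lemma integral_centered u : (\int[P]_z (centered (u, z))%:E = 0)%E.
Proof.
under eq_integral do rewrite /centered EFinB.
rewrite integralB //; last exact: (finite_measure_integrable_cst P (cond_mean u) measurableT).
by rewrite cond_meanE /= integral_cst //= probability_setT mule1 subee.
Qed.

End Centering.

Section AlmostEverywhereTransfer.
Context (R : realType) (d0 d1 : measure_display) (Omega : measurableType d0)
  (T : measurableType d1) (P : probability T R) (Pr : probability Omega R).
Context (I : finType) (F : I -> Omega -> T).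
Hypothesis mF : forall i, measurable_fun [set: Omega] (F i).
Hypothesis indF : mutually_independent Pr F.
Context (d' : measure_display) (T' : measurableType d') (U : Omega -> T')
  (K : set (T' * T)).
Hypothesis mK : measurable K.

Let h (x : T' * T) : \bar R := (\1_(~` K) x)%:E.

Let mh : measurable_fun [set: (T' * T)%type] h.
Proof. by apply/measurable_EFinP; apply: measurable_indic; exact: measurableC. Qed.

Let h0 x : (0 <= h x)%E. Proof. by rewrite lee_fin. Qed.

Let hE w i : (h (U w, F i w) = (\1_[set w | ~ K (U w, F i w)] w)%:E)%E.
Proof. by []. Qed.

Let mUF i : avoids F i U -> measurable [set w | ~ K (U w, F i w)].
Proof.
move=> aU; have m : measurable_fun [set: Omega] (fun w => (U w, F i w)).
  by apply: measurable_fun_pair => //; exact: (avoids_measurable_fun mF aU).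
have := m measurableT _ (measurableC mK); rewrite setTI; exact.
Qed.

(** Tonelli's theorem for the indicator of the complement of [K]. *)
Lemma ae_iterated i : has_law Pr (F i) P -> avoids F i U ->
  {ae Pr, forall w, K (U w, F i w)} ->
  (\int[Pr]_w \int[P]_z h (U w, z) = 0)%E.
Proof.
move=> lF aU aeK; rewrite -(indep_tonelli mF indF lF aU mh h0).
under eq_integral do rewrite hE.
by rewrite integral_indic ?setIT //; [exact: measure_negligible (mUF aU) aeK|exact: mUF].
Qed.

(** [(U, F i)] and [(U, F j)] have the same law; this carries assumptions on the
    fresh observation over to the observations of the second sample. *)
Lemma ae_transfer i j : has_law Pr (F i) P -> avoids F i U ->
  has_law Pr (F j) P -> avoids F j U ->
  {ae Pr, forall w, K (U w, F i w)} -> {ae Pr, forall w, K (U w, F j w)}.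
Proof.
move=> lFi aUi lFj aUj /(ae_iterated lFi aUi).
rewrite -(indep_tonelli mF indF lFj aUj mh h0).
under eq_integral do rewrite hE.
rewrite integral_indic ?setIT //; last exact: mUF.
by move=> e; apply/negligibleP => //; exact: mUF.
Qed.

Lemma ae_ae i : has_law Pr (F i) P -> avoids F i U ->
  {ae Pr, forall w, K (U w, F i w)} -> {ae Pr, forall w, {ae P, forall z, K (U w, z)}}.
Proof.
move=> lF aU /(ae_iterated lF aU).
have mG : measurable_fun [set: Omega] (fun w => \int[P]_z h (U w, z))%E.
  apply: (measurableT_comp (measurable_fun_fubini_tonelli_F (m2 := P) h mh h0)).
  exact: (avoids_measurable_fun mF aU).
have G0 w : (0 <= \int[P]_z h (U w, z))%E by apply: integral_ge0.
move=> e; have : (\int[Pr]_w `|\int[P]_z h (U w, z)| = 0)%E.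
  by under eq_integral do rewrite gee0_abs //.
move=> /(ae_eq_integral_abs _ measurableT mG); apply: filterS => w /(_ Logic.I) /= hw.
have mKw : measurable [set z | ~ K (U w, z)].
  have m : measurable_fun [set: T] (fun z => (U w, z)) by exact: measurable_fun_pair.
  have := m measurableT _ (measurableC mK); rewrite setTI; exact.
apply/negligibleP => //.
by move: hw; rewrite -[X in X = _ -> _]/(\int[P]_z (\1_[set z | ~ K (U w, z)] z)%:E)%E
  integral_indic // setIT.
Qed.

End AlmostEverywhereTransfer.

Section SampleConcentration.
Context (R : realType) (d0 d1 : measure_display) (Omega : measurableType d0)
  (T : measurableType d1) (P : probability T R) (Pr : probability Omega R).
Context (I : finType) (F : I -> Omega -> T).
Hypothesis mF : forall i, measurable_fun [set: Omega] (F i).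
Hypothesis lawF : forall i, has_law Pr (F i) P.
Hypothesis indF : mutually_independent Pr F.

Lemma tuple_avoids n (f : 'I_n -> I) i0 : (forall i, f i != i0) ->
  avoids F i0 (fun w => [tuple F (f i) w | i < n]).
Proof.
move=> fi; apply/measurable_fun_tnthP => i.
rewrite (_ : _ \o _ = F (f i)); first exact: avoids_coord.
by apply/funext => w; rewrite /= tnth_mktuple.
Qed.

Lemma cst_avoids d' (T' : measurableType d') (u : T') i0 : avoids F i0 (fun=> u).
Proof. exact: measurable_cst. Qed.

Context (d' : measure_display) (T' : measurableType d') (U : Omega -> T').
Context (n : nat) (f : 'I_n -> I).
Hypothesis n_gt0 : (0 < n)%N.
Hypothesis f_inj : injective f.
Hypothesis aU : forall i, avoids F (f i) U.
Context (J : finType) (h : J -> T' * T -> R) (c : R).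
Hypothesis mh : forall j, measurable_fun [set: (T' * T)%type] (h j).
Hypothesis c_gt0 : 0 < c.
Hypothesis h_range : forall j x, 0 <= h j x <= c.

Definition sample_mean (j : J) (w : Omega) : R :=
  n%:R^-1 * \sum_(i < n) centered P (h j) (U w, F (f i) w).

Let s := [seq f i | i <- enum 'I_n].

Let size_s : size s = n. Proof. by rewrite size_map size_enum_ord. Qed.

Let uniq_s : uniq s. Proof. by rewrite map_inj_uniq // enum_uniq. Qed.

Let sP i : i \in s -> has_law Pr (F i) P /\ avoids F i U.
Proof. by move=> /mapP[l _ ->]. Qed.

Let mU : measurable_fun [set: Omega] U.
Proof. exact: (avoids_measurable_fun mF (@aU (Ordinal n_gt0))). Qed.

Let emp_meanE j w : emp_mean F U (fun j => centered P (h j)) s j w = sample_mean j w.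
Proof. by rewrite /emp_mean size_s big_map big_enum. Qed.

Lemma sample_mean_max_sqr k : #|J| = k -> (1 < k)%N ->
  exists Q : Omega -> R, [/\ measurable_fun [set: Omega] Q, forall w, 0 <= Q w,
    forall j w, sample_mean j w ^+ 2 <= Q w &
    (\int[Pr]_w (Q w)%:E <= (32 * c ^+ 2 * (ln k%:R / n%:R))%:E)%E].
Proof.
move=> Jk k1; rewrite -size_s.
have [|Q [mQ Q0 Qm Qi]] := expected_max_sqr mF indF mU
  (fun j => measurable_centered P (mh j) (h_range j)) c_gt0
  (fun j => centered_le P (mh j) (h_range j)) (fun j => integral_centered P (mh j) (h_range j))
  uniq_s _ sP Jk k1; first by rewrite size_s.
by exists Q; split => // j w; rewrite -emp_meanE.
Qed.

Lemma sample_mean_excess t : 0 < t ->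
  exists Q : Omega -> R, [/\ measurable_fun [set: Omega] Q, forall w, 0 <= Q w,
    forall j w, t < `|sample_mean j w| -> 1 <= Q w &
    (\int[Pr]_w (Q w)%:E <=
      (2 * #|J|%:R * expR (- (n%:R * t ^+ 2 / (8 * c ^+ 2))))%:E)%E].
Proof.
move=> t0.
have [|Q [mQ Q0 Qm Qi]] := expected_excess mF indF mU
  (fun j => measurable_centered P (mh j) (h_range j)) c_gt0
  (fun j => centered_le P (mh j) (h_range j)) (fun j => integral_centered P (mh j) (h_range j))
  uniq_s _ sP t0; first by rewrite size_s.
exists Q; split => //; last by rewrite -size_s.
by move=> j w; rewrite -emp_meanE; exact: Qm.
Qed.

End SampleConcentration.

(** * Functions orthogonal to a sub-sigma-algebra *)

Section OrthogonalToSigmaAlgebra.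
Context (R : realType) (d1 d2 : measure_display) (T : measurableType d1)
  (X : measurableType d2) (P : probability T R) (c : T -> X).
Hypothesis mc : measurable_fun [set: T] c.

Lemma integrable_ae_bounded_mul (f e : T -> R) (M : R) :
  measurable_fun [set: T] f -> {ae P, forall z, `|f z| <= M} ->
  P.-integrable [set: T] (EFin \o e) ->
  P.-integrable [set: T] (fun z => (f z * e z)%:E).
Proof.
move=> mf fM ie; have me : measurable_fun [set: T] e.
  by apply/measurable_EFinP; exact: measurable_int ie.
have mfe : measurable_fun [set: T] (fun z => (f z * e z)%:E).
  by apply/measurable_EFinP; exact: measurable_funM.
apply/integrableP; split => //.
apply: (@le_lt_trans _ _ (\int[P]_z `|(`|M| * e z)%:E|)%E).
  apply: ae_ge0_le_integral => //.
  - exact: measurableT_comp.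
  - apply: measurableT_comp => //; apply/measurable_EFinP.
    exact: measurable_funM.
  - apply: filterS fM => z fz _; rewrite /= lee_fin !normrM normr_id ler_wpM2r //.
    by rewrite (le_trans fz) // ler_norm.
by have /integrableP[_] := integrableZl measurableT `|M| ie.
Qed.

Variable e : T -> R.
Hypothesis ie : P.-integrable [set: T] (EFin \o e).
Hypothesis e0 : forall E, measurable E -> (\int[P]_(z in c @^-1` E) (e z)%:E = 0)%E.

Let me : measurable_fun [set: T] e.
Proof. by apply/measurable_EFinP; exact: measurable_int ie. Qed.

Import HBNNSimple.

Let orth_nnsfun (g : {nnsfun X >-> R}) : (\int[P]_z (g (c z) * e z)%:E = 0)%E.
Proof.
have gE z : (g (c z) * e z)%:E = (\sum_(y <- finmap.enum_fset (fset_set (range g)))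
    (y%:E * ((\1_(g @^-1` [set y]) (c z)) * e z)%:E))%E.
  rewrite fimfunE fsbig_finite //= mulr_suml -sumEFin.
  by apply: eq_bigr => y _; rewrite -EFinM mulrA.
have mpre y : measurable (c @^-1` (g @^-1` [set y])).
  by rewrite -[X in measurable X]setTI; apply: mc => //; exact: measurable_sfunP.
have ind y z : \1_(g @^-1` [set y]) (c z) = \1_(c @^-1` (g @^-1` [set y])) z :> R.
  by [].
have iy y : P.-integrable [set: T] (fun z => (\1_(g @^-1` [set y]) (c z) * e z)%:E).
  apply: (integrable_ae_bounded_mul (M := 1)) => //.
  - by under eq_fun do rewrite ind; exact: measurable_indic.
  - by apply: aeW => z; rewrite indicE; case: (_ \in _); rewrite ?normr0 ?normr1.
under eq_integral do rewrite gE.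
rewrite integral_sum //; last by move=> y; apply: integrableZl.
rewrite big1 // => y _; rewrite integralZl //.
rewrite (_ : (\int[P]_x _)%E = 0%E) ?mule0 //.
rewrite -[RHS](e0 (measurable_sfunP g (measurable_set1 y))).
rewrite [RHS]integral_mkcond; apply: eq_integral => z _.
by rewrite patchE ind indicE; case: (_ \in _); rewrite ?mul1r ?mul0r.
Qed.

Let orth_ge0 (h : X -> R) (M : R) : measurable_fun [set: X] h ->
  (forall x, 0 <= h x <= M) -> (\int[P]_z (h (c z) * e z)%:E = 0)%E.
Proof.
move=> mh hM.
have mhE : measurable_fun [set: X] (EFin \o h) by exact/measurable_EFinP.
pose g := nnsfun_approx measurableT mhE.
have h0 x : [set: X] x -> (0 <= (EFin \o h) x)%E.
  by move=> _; rewrite lee_fin; case/andP: (hM x).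
have gh x : (fun m => (g m x)%:E) @ \oo --> (h x)%:E.
  exact: (cvg_nnsfun_approx measurableT mhE h0).
have gle m x : g m x <= h x.
  by rewrite -lee_fin /g nnsfun_approxE; exact: le_approx.
have mgc m : measurable_fun [set: T] (fun z => g m (c z)).
  by apply: (measurableT_comp (f := g m)).
have : (\int[P]_z (g m (c z) * e z)%:E)%E @[m --> \oo] --> (\int[P]_z (h (c z) * e z)%:E)%E.
  have [] := @dominated_convergence _ _ _ P setT measurableT
    (fun m z => (g m (c z) * e z)%:E) (fun z => (h (c z) * e z)%:E)
    (fun z => (M%:E * `|(e z)%:E|)%E).
  - by move=> m; apply/measurable_EFinP; apply: measurable_funM.
  - by apply/measurable_EFinP; apply: measurable_funM => //; exact: measurableT_comp.
  - apply: aeW => z _; under eq_fun do rewrite EFinM.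
    rewrite EFinM; apply: cvgeZr => //; exact: gh.
  - exact: integrableZl (integrable_abse ie).
  - apply: aeW => z m _; rewrite -EFinM lee_fin normrM ler_wpM2r //.
    have /andP[_] := hM (c z); apply: le_trans.
    by rewrite ger0_norm // (le_trans _ (gle _ _)).
  by [].
under eq_fun do rewrite orth_nnsfun.
by move=> /cvg_lim <- //; rewrite lim_cst.
Qed.

(** The indicators of the sub-sigma-algebra give simple functions by linearity, these
    give bounded nonnegative ones by dominated convergence; then clip and shift. *)
Lemma orthogonal_ae_bounded (h : X -> R) (M : R) : measurable_fun [set: X] h ->
  {ae P, forall z, `|h (c z)| <= M} -> (\int[P]_z (h (c z) * e z)%:E = 0)%E.
Proof.
move=> mh hM; pose N := `|M|.
(* clipping makes the bound hold everywhere, the shift by N makes it nonnegative *)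
pose g (x : X) := Num.max (- N) (Num.min N (h x)) + N.
have N0 : 0 <= N by exact: normr_ge0.
have mg : measurable_fun [set: X] g.
  apply: measurable_funD => //; apply: measurable_maxr => //.
  exact: measurable_minr.
have g2 x : 0 <= g x <= 2 * N.
  have l : - N <= Num.max (- N) (Num.min N (h x)) by rewrite le_max lexx.
  have u : Num.max (- N) (Num.min N (h x)) <= N.
    by rewrite ge_max ge_min lexx andbT; lra.
  by apply/andP; split; rewrite /g; lra.
have ge : (\int[P]_z (g (c z) * e z)%:E = 0)%E := orth_ge0 mg g2.
have Ne : (\int[P]_z (N * e z)%:E = 0)%E.
  under eq_integral do rewrite EFinM.
  rewrite integralZl // -[X in (_ * X)%E](_ : (\int[P]_(z in c @^-1` setT) (e z)%:E)%E = _).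
    by rewrite e0 ?mule0.
  by rewrite preimage_setT.
have mgc : measurable_fun [set: T] (g \o c) by exact: measurableT_comp.
have ige : P.-integrable [set: T] (fun z => (g (c z) * e z)%:E).
  apply: (integrable_ae_bounded_mul (M := 2 * N)) => //.
  by apply: aeW => z; case/andP: (g2 (c z)) => ? ?; rewrite ger0_norm.
have iNe : P.-integrable [set: T] (fun z => (N * e z)%:E).
  apply: (integrable_ae_bounded_mul (f := fun=> N) (M := N)) => //.
  by apply: aeW => z; rewrite ger0_norm.
transitivity (\int[P]_z ((g (c z) * e z)%:E - (N * e z)%:E))%E.
  apply: ae_eq_integral => //.
  - by apply/measurable_EFinP; apply: measurable_funM => //; exact: measurableT_comp.
  - by apply: emeasurable_funB; [exact: measurable_int ige|exact: measurable_int iNe].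
  - apply: filterS hM => z hz _; rewrite -EFinB -mulrBl; congr (_ * _)%:E.
    have : `|h (c z)| <= N by apply: le_trans hz (ler_norm _).
    rewrite ler_norml /g => /andP[h1 h2].
    by rewrite (min_idPr h2) (max_idPr h1) addrK.
by rewrite integralB // ge Ne sube0.
Qed.

End OrthogonalToSigmaAlgebra.

(** * Bias of the doubly robust score *)

Lemma measurable_inv (R : realType) : measurable_fun [set: R] (fun x : R => x^-1).
Proof.
(* the power function is measurable, and x^-1 = x * (x ^ 2) ^ (-1) also at 0 *)
rewrite (_ : (fun x : R => x^-1) = fun x : R => x * powR (x ^+ 2) (-1)).
  apply: measurable_funM => //.
  by apply: (measurableT_comp (measurable_powR (-1))); exact: measurable_funX.
apply/funext => x; have [->|x0] := eqVneq x 0; first by rewrite invr0 mul0r.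
by rewrite powR_inv1 ?sqr_ge0 // expr2 invfM mulrA mulfV // mul1r.
Qed.

Lemma measurable_tuple1 d (T : measurableType d) n :
  (forall x : T, measurable [set x]) -> forall t : n.-tuple T, measurable [set t].
Proof.
move=> m1 t.
rewrite (_ : [set t] =
    \bigcap_(i in [set: 'I_n]) ((fun u => tnth u i) @^-1` [set tnth t i])).
  apply: fin_bigcap_measurable; first exact: finite_finset.
  by move=> i _; rewrite -[X in measurable X]setTI; exact: measurable_tnth.
apply/seteqP; split => [_ -> i //|u ut]; apply: eq_from_tnth => i.
exact: ut.
Qed.

Section ObservationMeasurability.
Context (R : realType) (d k : nat).

Lemma measurable_trt_set (A : set (treatment k)) : measurable A.
Proof.
apply: countable_measurable; last exact: countableP.
exact: measurable_tuple1.
Qed.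

Lemma measurable_covX : measurable_fun [set: obs R d k] (@covX R d k).
Proof. exact: (measurableT_comp measurable_fst measurable_fst). Qed.

Lemma measurable_trtA : measurable_fun [set: obs R d k] (@trtA R d k).
Proof. exact: (measurableT_comp measurable_snd measurable_fst). Qed.

Lemma measurable_outY : measurable_fun [set: obs R d k] (@outY R d k).
Proof. exact: measurable_snd. Qed.

Lemma measurable_fun_trt d' (T : measurableType d') (f : treatment k -> T) :
  measurable_fun [set: treatment k] f.
Proof. by move=> _ A mA; exact: measurable_trt_set. Qed.

Lemma measurable_fun_trtA d' (T : measurableType d') (f : treatment k -> T) :
  measurable_fun [set: obs R d k] (fun z => f (trtA z)).
Proof. exact: (measurableT_comp (measurable_fun_trt f) measurable_trtA). Qed.

Lemma measurable_trtA_eq a : measurable [set z : obs R d k | trtA z = a].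
Proof.
rewrite (_ : [set z | _] = @trtA R d k @^-1` [set a]) //.
by rewrite -[X in measurable X]setTI; apply: measurable_trtA => //; exact: measurable_trt_set.
Qed.

Lemma measurable_covX_preimage (E : set (d.-tuple R)) : measurable E ->
  measurable [set z : obs R d k | E (covX z)].
Proof. by move=> mE; rewrite -[X in measurable X]setTI; exact: measurable_covX. Qed.

End ObservationMeasurability.

Lemma positive_integral_eq0 (R : realType) d (T : measurableType d)
    (P : probability T R) (D : set T) (f : T -> R) :
  measurable D -> measurable_fun D f -> {ae P, forall z, D z -> 0 < f z} ->
  (\int[P]_(z in D) (f z)%:E = 0)%E -> P D = 0%E.
Proof.
move=> mD mf fpos f0.
have mfE : measurable_fun D (fun z => (f z)%:E) by exact/measurable_EFinP.
have : (\int[P]_(z in D) `|(f z)%:E| = 0)%E.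
  rewrite -[RHS]f0; apply: ae_eq_integral => //; first exact: measurableT_comp.
  by apply: filterS fpos => z h Dz; rewrite /= gtr0_norm // h.
move=> /(ae_eq_integral_abs _ mD mfE) h0.
apply/negligibleP => //; have : {ae P, forall z, ~ D z}.
  apply: filterS2 fpos h0 => z pz zz Dz.
  have e : (f z)%:E = 0%E := zz Dz.
  by have := pz Dz; rewrite -lte_fin e ltxx.
by apply: negligibleS => z Dz /=; apply.
Qed.

Section NuisanceBias.
Context (R : realType) (d k : nat) (P : probability (obs R d k) R).
Context (pi mu : treatment k -> d.-tuple R -> R) (B : R).
Hypothesis propP : is_propensity P pi.
Hypothesis pi_gt0 : {ae P, forall z : obs R d k, forall a : treatment k, 0 < pi a (covX z)}.
Hypothesis regP : is_regression P mu.
Hypothesis Y_le : {ae P, forall z : obs R d k, `|outY z| <= B}.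
Implicit Types (a : treatment k) (z : obs R d k).

Let mX := @measurable_covX R d k.

Lemma ae_bounded_integrable (f : obs R d k -> R) (M : R) :
  measurable_fun [set: obs R d k] f -> {ae P, forall z, `|f z| <= M} ->
  P.-integrable [set: obs R d k] (EFin \o f).
Proof.
move=> mf fM; have := integrable_ae_bounded_mul (e := fun=> 1) mf fM
  (finite_measure_integrable_cst P 1 measurableT).
by apply: eq_integrable => // z _; rewrite /= mulr1.
Qed.

Lemma integrable_outY : P.-integrable [set: obs R d k] (EFin \o @outY R d k).
Proof. exact: ae_bounded_integrable (@measurable_outY R d k) Y_le. Qed.

(** This is where positivity enters: the probability assumed to vanish is the
    integral of [pi a] over [E]. *)
Lemma propensity_null a (E : set (d.-tuple R)) : measurable E ->
  P [set z | E (covX z) /\ trtA z = a] = 0%E -> P [set z : obs R d k | E (covX z)] = 0%E.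
Proof.
move=> mE; have [mpi ->//] := propP a; apply: positive_integral_eq0.
- exact: measurable_covX_preimage.
- apply: measurable_funTS; exact: measurableT_comp.
- by apply: filterS pi_gt0 => z h _; exact: h.
Qed.

(** Where [sg * mu a > B], the function [sg * (mu a - Y)] is positive; its integral
    over the units treated by [a] vanishes, so there are almost none of them. *)
Lemma regression_null a (E : set (d.-tuple R)) (sg : R) : measurable E -> `|sg| <= 1 ->
  (forall x, E x -> B < sg * mu a x) -> P [set z : obs R d k | E (covX z)] = 0%E.
Proof.
move=> mE sg1 EB; apply: (propensity_null (a := a)) => //.
have [mmu imu eqmu] := regP a.
set D := [set z | _ /\ _].
have mD : measurable D.
  by apply: measurableI; [exact: measurable_covX_preimage|exact: measurable_trtA_eq].
apply: (positive_integral_eq0 (f := fun z => sg * (mu a (covX z) - outY z))) => //.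
- apply: measurable_funTS; apply: measurable_funM => //; apply: measurable_funB.
    exact: measurableT_comp.
  exact: measurable_outY.
- apply: filterS Y_le => z Yz [/EB Bmu _].
  rewrite mulrBr subr_gt0; apply: le_lt_trans Bmu.
  apply: (le_trans (ler_norm _)); rewrite normrM; apply: le_trans Yz.
  by rewrite ler_piMl.
- have iY : P.-integrable D (EFin \o @outY R d k).
    by apply: integrableS integrable_outY.
  have imuD : P.-integrable D (fun z => (mu a (covX z))%:E).
    by apply: integrableS imu; [exact: measurable_trtA_eq|by []|move=> z []].
  under eq_integral do rewrite EFinM.
  rewrite integralZl //; last exact: (integrableB mD imuD iY).
  rewrite (_ : (\int[P]_(z in D) _)%E = 0%E) ?mule0 //.
  under eq_integral do rewrite EFinB.
  rewrite integralB // -eqmu // subee //.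
  exact: integrable_fin_num.
Qed.

Lemma regression_le : {ae P, forall z : obs R d k, forall a, `|mu a (covX z)| <= B}.
Proof.
apply: filter_forall => a; have [mmu _ _] := regP a.
have h (sg : R) : `|sg| <= 1 ->
    P.-negligible [set z : obs R d k | B < sg * mu a (covX z)].
  move=> sg1; have mE : measurable [set x | B < sg * mu a x].
    rewrite (_ : mkset _ = (fun x => sg * mu a x) @^-1` `]B, +oo[).
      by rewrite -[X in measurable X]setTI; apply: measurable_funM.
    by apply/seteqP; split => x /=; rewrite in_itv /= andbT.
  apply/negligibleP; first exact: (measurable_covX_preimage mE).
  exact: (regression_null mE sg1 (fun x h => h)).
apply: negligibleS (negligibleU (h 1 _) (h (-1) _)); rewrite ?normrN1 ?normr1 //.
move=> z /= /negP; rewrite -ltNge ltr_normr => /orP[h'|h'].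
  by left; rewrite mul1r.
by right; rewrite mulN1r.
Qed.

Lemma integrable_propensity a : P.-integrable [set: obs R d k] (fun z => (pi a (covX z))%:E).
Proof.
have [mpi eqpi] := propP a.
have mp : measurable_fun [set: obs R d k] (fun z => (pi a (covX z))%:E).
  by apply/measurable_EFinP; exact: measurableT_comp.
apply/integrableP; split => //.
rewrite (ae_eq_integral (fun z : obs R d k => (pi a (covX z))%:E)) //.
- have := eqpi setT measurableT.
  have -> : [set z : obs R d k | [set: d.-tuple R] (covX z)] = setT by apply/seteqP; split.
  move=> <-; apply: (@le_lt_trans _ _ 1%E); last exact: ltry.
  apply: probability_le1.
  rewrite (_ : [set z | _] = [set z : obs R d k | trtA z = a]).
    exact: measurable_trtA_eq.
  by apply/seteqP; split => [z []//|z].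
- exact: measurableT_comp.
- by apply: filterS pi_gt0 => z h _; rewrite /= gtr0_norm.
Qed.

Definition treated a z : R := (trtA z == a)%:R.

Lemma measurable_treated a : measurable_fun [set: obs R d k] (treated a).
Proof. exact: (measurable_fun_trtA (fun u => (u == a)%:R : R)). Qed.

Lemma treated_le1 a z : `|treated a z| <= 1.
Proof. by rewrite normr_nat lern1 leq_b1. Qed.

Lemma integral_treated a (f : obs R d k -> R) (D : set (obs R d k)) :
  (\int[P]_(z in D) (treated a z * f z)%:E =
   \int[P]_(z in [set z | D z /\ trtA z = a]) (f z)%:E)%E.
Proof.
rewrite [LHS]integral_mkcond [RHS]integral_mkcond; apply: eq_integral => z _.
rewrite !patchE /treated; case: (boolP (z \in D)) => zD; last first.
  rewrite ifF //; apply/negbTE/negP; rewrite inE => -[Dz _].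
  by move: zD; rewrite mem_set.
have Dz : D z by rewrite inE in zD.
case: eqP => za; first by rewrite mul1r mem_set.
by rewrite mul0r ifF //; apply/negbTE/negP; rewrite inE => -[].
Qed.

(** [mu a] is a conditional mean of [Y] given the covariates and [A = a]. *)
Lemma outcome_residual a (h : d.-tuple R -> R) (M : R) :
  measurable_fun [set: d.-tuple R] h ->
  {ae P, forall z : obs R d k, `|h (covX z)| <= M} ->
  P.-integrable [set: obs R d k]
    (fun z => (h (covX z) * (treated a z * (outY z - mu a (covX z))))%:E) /\
  (\int[P]_z (h (covX z) * (treated a z * (outY z - mu a (covX z))))%:E = 0)%E.
Proof.
move=> mh hM; have [mmu imu eqmu] := regP a.
have mmuX : measurable_fun [set: obs R d k] (fun z => mu a (covX z)).
  exact: measurableT_comp.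
have iY := integrable_outY.
have imuT : P.-integrable [set: obs R d k] (fun z => (mu a (covX z))%:E).
  apply: (ae_bounded_integrable (M := B)) => //.
  by apply: filterS regression_le => z; apply.
have ie : P.-integrable [set: obs R d k]
    (EFin \o (fun z => treated a z * (outY z - mu a (covX z)))).
  apply: (integrable_ae_bounded_mul (M := 1)).
  - exact: measurable_treated.
  - by apply: aeW => z; exact: treated_le1.
  - exact: (integrableB measurableT iY imuT).
split.
  apply: integrable_ae_bounded_mul hM ie.
  exact: measurableT_comp.
apply: (orthogonal_ae_bounded mX ie _ mh hM) => E mE /=.
rewrite integral_treated.
have mD : measurable [set z | (covX (R:=R) (d:=d) (k:=k) @^-1` E) z /\ trtA z = a].
  by apply: measurableI; [exact: measurable_covX_preimage|exact: measurable_trtA_eq].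
under eq_integral do rewrite EFinB.
have iYD := integrableS measurableT mD (@subsetT _ _) iY.
rewrite integralB //; last exact: integrableS imuT.
rewrite -(eqmu E mE) subee //.
exact: integrable_fin_num iYD.
Qed.

(** [pi a] is a conditional mean of the indicator of [A = a] given the covariates. *)
Lemma treatment_residual a (h : d.-tuple R -> R) (M : R) :
  measurable_fun [set: d.-tuple R] h ->
  {ae P, forall z : obs R d k, `|h (covX z)| <= M} ->
  P.-integrable [set: obs R d k]
    (fun z => (h (covX z) * (treated a z - pi a (covX z)))%:E) /\
  (\int[P]_z (h (covX z) * (treated a z - pi a (covX z)))%:E = 0)%E.
Proof.
move=> mh hM; have [mpi eqpi] := propP a.
have ipi := integrable_propensity a.
have it : P.-integrable [set: obs R d k] (EFin \o treated a).
  apply: (bounded_integrable P (c := 1)); first exact: measurable_treated.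
  exact: treated_le1.
have ie : P.-integrable [set: obs R d k] (EFin \o (fun z => treated a z - pi a (covX z))).
  exact: (integrableB measurableT it ipi).
split.
  apply: integrable_ae_bounded_mul hM ie.
  exact: measurableT_comp.
apply: (orthogonal_ae_bounded mX ie _ mh hM) => E mE.
have mD : measurable (covX (R:=R) (d:=d) (k:=k) @^-1` E) by exact: measurable_covX_preimage.
under eq_integral do rewrite EFinB.
rewrite integralB //; [|exact: integrableS it|exact: integrableS ipi].
have -> : (\int[P]_(z in covX (R:=R) (d:=d) (k:=k) @^-1` E) (treated a z)%:E)%E =
    P [set z : obs R d k | E (covX z) /\ trtA z = a].
  under eq_integral do rewrite -[treated _ _]mulr1.
  rewrite integral_treated integral_cst ?mul1e //.
  by apply: measurableI => //; exact: measurable_trtA_eq.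
rewrite eqpi // subee //.
by apply: integrable_fin_num => //; exact: integrableS ipi.
Qed.

(** The augmented inverse probability weighted score, centered at [psi0]. *)
Definition aipw a (pih mh : d.-tuple R -> R) (psi0 : R) z : R :=
  treated a z / pih (covX z) * (outY z - mh (covX z)) + mh (covX z) - psi0.

(** With [S = w / pih], the integrand is the outcome residual times [S], plus the
    treatment residual times [S * (mu - mh)], plus
    [w * ((pi / pih - 1) * (mu - mh))].  The first two have mean zero, and
    Cauchy-Schwarz bounds the third by the product of the two errors. *)
Lemma aipw_bias a (pih mh : d.-tuple R -> R) (psi0 w delta eps : R) :
  measurable_fun [set: d.-tuple R] pih -> measurable_fun [set: d.-tuple R] mh ->
  0 <= w ->
  {ae P, forall z : obs R d k, `|w / pih (covX z)| <= B} ->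
  {ae P, forall z : obs R d k, `|mh (covX z)| <= B} ->
  (Lnorm P 2%:E (fun z : obs R d k => (pi a (covX z) / pih (covX z) - 1)%:E)
     <= delta%:E)%E ->
  (Lnorm P 2%:E (fun z : obs R d k => (mu a (covX z) - mh (covX z))%:E)
     <= eps%:E)%E ->
  P.-integrable [set: obs R d k]
    (fun z => (w * (aipw a pih mh psi0 z - (mu a (covX z) - psi0)))%:E) /\
  (`|\int[P]_z (w * (aipw a pih mh psi0 z - (mu a (covX z) - psi0)))%:E|
     <= (w * (delta * eps))%:E)%E.
Proof.
move=> mpih mmh w0 SB mhB hd he.
have [mmu _ _] := regP a; have [mpi _] := propP a.
pose S x := w / pih x.
have mS : measurable_fun [set: d.-tuple R] S.
  by apply: measurable_funM => //; exact: (measurableT_comp (@measurable_inv R)).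
have mdiff : measurable_fun [set: d.-tuple R] (fun x => mu a x - mh x).
  exact: measurable_funB.
have [i1 e1] := outcome_residual a mS SB.
have SdB : {ae P, forall z : obs R d k,
    `|S (covX z) * (mu a (covX z) - mh (covX z))| <= `|B| * (B + B)}.
  apply: filterS3 SB mhB regression_le => z h1 h2 /(_ a) h3.
  rewrite normrM ler_pM //; first exact: le_trans h1 (ler_norm _).
  by apply: (le_trans (ler_normB _ _)); exact: lerD.
have [i2 e2] := treatment_residual a (measurable_funM mS mdiff) SdB.
pose f z := pi a (covX z) / pih (covX z) - 1.
pose g z := mu a (covX z) - mh (covX z).
have mf : measurable_fun [set: obs R d k] f.
  apply: measurable_funB => //; apply: measurable_funM; first exact: measurableT_comp.
  exact: (measurableT_comp (@measurable_inv R) (measurableT_comp mpih mX)).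
have mg : measurable_fun [set: obs R d k] g by exact: (measurableT_comp mdiff mX).
have fg : (\int[P]_z `|(f z * g z)%:E| <= (delta * eps)%:E)%E.
  have := @hoelder _ _ _ P f g 2 2 mf mg.
  rewrite Lnorm1 => /(_ _ _ _)/le_trans; apply => //; first lra.
  by rewrite EFinM lee_pmul // Lnorm_ge0.
have mfg : measurable_fun [set: obs R d k] (fun z => (f z * g z)%:E).
  by apply/measurable_EFinP; exact: measurable_funM.
have ifg : P.-integrable [set: obs R d k] (fun z => (f z * g z)%:E).
  by apply/integrableP; split => //; apply: le_lt_trans fg _; rewrite ltry.
have -> : (fun z => (w * (aipw a pih mh psi0 z - (mu a (covX z) - psi0)))%:E) =
    (fun z => (S (covX z) * (treated a z * (outY z - mu a (covX z))))%:E +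
      (S (covX z) * (mu a (covX z) - mh (covX z)) * (treated a z - pi a (covX z)))%:E +
      w%:E * (f z * g z)%:E)%E.
  apply/funext => z; rewrite -!EFinM -!EFinD; congr EFin.
  by rewrite /aipw /S /f /g; ring.
have iwfg := integrableZl measurableT w ifg.
have i12 := integrableD measurableT i1 i2.
split; first exact: (integrableD measurableT i12 iwfg).
rewrite integralD //.
rewrite integralD // e1 e2 adde0 add0e integralZl // abseM gee0_abs ?lee_fin //.
rewrite EFinM lee_wpmul2l ?lee_fin //.
exact: le_trans (le_abse_integral _ _ mfg) fg.
Qed.

End NuisanceBias.

(** * Vector norms, cones and determinants *)

Section VectorNorms.
Context (R : realType) (k : nat).
Implicit Types (v w : 'cV[R]_k) (S : {set 'I_k}).

Lemma norm1_ge0 v : 0 <= norm1 v.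
Proof. exact: sumr_ge0. Qed.

Lemma norm2_ge0 v : 0 <= norm2 v.
Proof. exact: sqrtr_ge0. Qed.

Lemma sqr_norm2 v : norm2 v ^+ 2 = \sum_j v j 0 ^+ 2.
Proof. by rewrite sqr_sqrtr // sumr_ge0 // => j _; rewrite sqr_ge0. Qed.

Lemma norm2_eq0 v : norm2 v = 0 -> v = 0.
Proof.
move=> v0; have /eqP : \sum_j v j 0 ^+ 2 = 0 by rewrite -sqr_norm2 v0 expr0n.
rewrite psumr_eq0 => [/allP h|j _]; last exact: sqr_ge0.
apply/matrixP => i j; rewrite ord1 mxE; apply/eqP.
by rewrite -[_ == _](sqrf_eq0 (v i 0)); apply: (h i); rewrite mem_index_enum.
Qed.

Lemma norm1D v w : norm1 (v + w) <= norm1 v + norm1 w.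
Proof.
rewrite /norm1 -big_split; apply: ler_sum => j _ /=.
by rewrite mxE ler_normD.
Qed.

Lemma norm1N v : norm1 (- v) = norm1 v.
Proof. by apply: eq_bigr => j _; rewrite mxE normrN. Qed.

(** Cauchy-Schwarz, as nonnegativity of the sum of all squared differences. *)
Lemma sqr_sum_le (I : finType) (S : {set I}) (f : I -> R) :
  (\sum_(j in S) f j) ^+ 2 <= #|S|%:R * \sum_(j in S) f j ^+ 2.
Proof.
have h : 0 <= \sum_(i in S) \sum_(j in S) (f i - f j) ^+ 2.
  by do 2!(apply: sumr_ge0 => ? _); exact: sqr_ge0.
have e : \sum_(i in S) \sum_(j in S) (f i - f j) ^+ 2 =
    2 * (#|S|%:R * \sum_(j in S) f j ^+ 2) - 2 * (\sum_(j in S) f j) ^+ 2.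
  have inner i : \sum_(j in S) (f i - f j) ^+ 2 =
      #|S|%:R * f i ^+ 2 + \sum_(j in S) f j ^+ 2 - 2 * f i * \sum_(j in S) f j.
    rewrite (eq_bigr (fun j => f i ^+ 2 + f j ^+ 2 - 2 * f i * f j)) => [|j _].
      by rewrite sumrB big_split /= sumr_const -mulr_sumr [#|S|%:R * _]mulr_natl.
    by ring.
  rewrite (eq_bigr _ (fun i _ => inner i)) sumrB big_split /= sumr_const.
  by rewrite -mulr_suml -!mulr_sumr -[_ *+ #|S|]mulr_natl; ring.
by move: h; rewrite e; lra.
Qed.

Lemma sum_norm_le v S s : (#|S| <= s)%N ->
  \sum_(j in S) `|v j 0| <= Num.sqrt s%:R * norm2 v.
Proof.
move=> Ss.
rewrite -ler_sqr ?nnegrE ?mulr_ge0 ?sqrtr_ge0 ?norm2_ge0 ?sumr_ge0 //.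
apply: (le_trans (sqr_sum_le _ _)).
rewrite exprMn sqr_sqrtr ?ler0n // sqr_norm2; apply: ler_pM => //.
- by apply: sumr_ge0 => j _; exact: sqr_ge0.
- by rewrite ler_nat.
- rewrite big_mkcond; apply: ler_sum => j _.
  by case: ifP => _; rewrite ?sqr_ge0 // real_normK ?num_real.
Qed.

Lemma norm1_le_norm2 v s : (norm0 v <= s)%N -> norm1 v <= Num.sqrt s%:R * norm2 v.
Proof.
move=> vs; pose S := [set j | v j 0 != 0]%SET.
have -> : norm1 v = \sum_(j in S) `|v j 0|.
  rewrite /norm1 [RHS]big_mkcond; apply: eq_bigr => j _; rewrite inE.
  by case: eqVneq => // ->; rewrite normr0.
exact: sum_norm_le.
Qed.

(** [|v|_1 <= |psi|_1] forces the mass of [v - psi] off the support of [psi] to be at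
    most its mass on that support. *)
Lemma lasso_cone psi v s : (norm0 psi <= s)%N -> norm1 v <= norm1 psi ->
  norm1 (v - psi) <= 2 * Num.sqrt s%:R * norm2 (v - psi).
Proof.
move=> ps vp; pose S := [set j | psi j 0 != 0]%SET; set D := v - psi.
have h1 : norm1 D <= 2 * \sum_(j in S) `|D j 0|.
  have e (f : 'I_k -> R) : \sum_j f j = \sum_(j in S) f j + \sum_(j in ~: S) f j.
    rewrite (bigID (mem S)) /=; congr (_ + _).
    by apply: eq_bigl => j; rewrite finset.in_setC.
  have : \sum_(j in ~: S) `|v j 0| <= \sum_(j in S) (`|psi j 0| - `|v j 0|).
    rewrite sumrB; move: vp; rewrite /norm1 !e.
    rewrite [\sum_(j in ~: S) `|psi j 0|]big1 ?addr0 => [|j]; first by lra.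
    by rewrite !inE negbK => /eqP->; rewrite normr0.
  have -> : \sum_(j in ~: S) `|v j 0| = \sum_(j in ~: S) `|D j 0|.
    apply: eq_bigr => j; rewrite !inE negbK => /eqP p0.
    by rewrite /D !mxE p0 subr0.
  have : \sum_(j in S) (`|psi j 0| - `|v j 0|) <= \sum_(j in S) `|D j 0|.
    by apply: ler_sum => j _; rewrite /D !mxE distrC lerB_dist.
  by rewrite /norm1 e; lra.
apply: (le_trans h1); rewrite -mulrA ler_wpM2l //.
exact: sum_norm_le.
Qed.

Lemma norm0D v w : (norm0 (v + w) <= norm0 v + norm0 w)%N.
Proof.
apply: leq_trans (leq_card_setU _ _); apply: subset_leq_card.
apply/fintype.subsetP => j; rewrite !inE mxE.
by case: (eqVneq (v j 0) 0) => //= ->; rewrite add0r.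
Qed.

Lemma norm0N v : norm0 (- v) = norm0 v.
Proof. by apply: eq_card => j; rewrite !inE mxE oppr_eq0. Qed.

Lemma sparse_cone psi v s : (norm0 psi <= s)%N -> (norm0 v <= s)%N ->
  norm1 (v - psi) <= 2 * Num.sqrt s%:R * norm2 (v - psi).
Proof.
move=> ps vs; apply: (@le_trans _ _ (Num.sqrt (s + s)%:R * norm2 (v - psi))).
  apply: norm1_le_norm2; apply: (leq_trans (norm0D _ _)).
  by rewrite norm0N leq_add.
rewrite ler_wpM2r ?norm2_ge0 // -ler_sqr ?nnegrE ?mulr_ge0 ?sqrtr_ge0 //.
rewrite exprMn !sqr_sqrtr ?ler0n // natrD -[2]/(2%:R) -natrX.
by have := ler0n R s; lra.
Qed.

Lemma norm2_le_norm1 v : norm2 v <= norm1 v.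
Proof.
rewrite -ler_sqr ?nnegrE ?norm2_ge0 ?norm1_ge0 // sqr_norm2.
rewrite expr2 /norm1 mulr_suml; apply: ler_sum => j _.
rewrite -[v j 0 ^+ 2]real_normK ?num_real // expr2 ler_wpM2l //.
by rewrite (bigD1 j) //= lerDl sumr_ge0.
Qed.

End VectorNorms.

Section Determinants.
Context (R : realType).

(** A crude form of Hadamard's inequality, for which the rows of an identity block
    cost nothing. *)
Lemma norm_det_le n (A : 'M[R]_n) : `|\det A| <= \prod_i \sum_j `|A i j|.
Proof.
elim: n A => [|n IH] A; first by rewrite det_mx00 big_ord0 normr1.
rewrite (expand_det_row A ord0) [leRHS]big_ord_recl mulr_suml.
apply: (le_trans (ler_norm_sum _ _ _)); apply: ler_sum => j _.
rewrite normrM ler_wpM2l // /cofactor normrM normrX normrN1 expr1n mul1r.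
apply: (le_trans (IH _)); apply: ler_prod => i _.
rewrite sumr_ge0 //= (bigD1_ord j) //=.
under eq_bigr do rewrite !mxE.
by rewrite lerDr.
Qed.

Lemma norm_det_int_ge1 n (A : 'M[int]_n) :
  \det (map_mx intr A) != 0 :> R -> 1 <= `|\det (map_mx intr A) : R|.
Proof.
rewrite det_map_mx intr_eq0 => d0.
by rewrite -intr_norm -[1]/(1%:~R) ler_int -gtz0_ge1 normr_gt0.
Qed.

End Determinants.

(** * The quadratic empirical risk *)

Section QuadraticRisk.
Context (R : realType) (n k : nat) (x : 'I_n -> treatment k) (bh : 'I_k -> R).
Implicit Types (v w b : 'cV[R]_k) (S : {set 'I_k}).

Lemma trt_dotD (a : treatment k) v w : trt_dot a (v + w) = trt_dot a v + trt_dot a w.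
Proof. by rewrite /trt_dot -big_split; apply: eq_bigr => j _; rewrite /= mxE mulrDr. Qed.

Lemma trt_dotZ (a : treatment k) t v : trt_dot a (t *: v) = t * trt_dot a v.
Proof. by rewrite /trt_dot mulr_sumr; apply: eq_bigr => j _; rewrite mxE mulrCA. Qed.

Lemma trt_dot_le_norm1 (a : treatment k) v : `|trt_dot a v| <= norm1 v.
Proof.
apply: (le_trans (ler_norm_sum _ _ _)); apply: ler_sum => j _.
by rewrite normrM normr_nat ler_piMl // lern1 leq_b1.
Qed.

(** Divided by [n], the squared length of the vector of fitted values. *)
Definition gram v : R := n%:R^-1 * \sum_i trt_dot (x i) v ^+ 2.

Definition gram_vec v (j : 'I_k) : R :=
  n%:R^-1 * \sum_i (tnth (x i) j)%:R * trt_dot (x i) v.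

Definition lin v : R := \sum_j bh j * v j 0.

Definition risk v : R := gram v - 2 * lin v.

Lemma gram_ge0 v : 0 <= gram v.
Proof. by rewrite mulr_ge0 ?invr_ge0 // sumr_ge0 // => i _; rewrite sqr_ge0. Qed.

Lemma gramD v w : gram (v + w) = gram v + gram w + 2 * \sum_j gram_vec v j * w j 0.
Proof.
have -> : \sum_j gram_vec v j * w j 0 =
    n%:R^-1 * \sum_i trt_dot (x i) v * trt_dot (x i) w.
  under eq_bigr do rewrite /gram_vec -mulrA mulr_suml.
  rewrite -mulr_sumr exchange_big /=; congr (_ * _); apply: eq_bigr => i _.
  by rewrite {3}/trt_dot mulr_sumr; apply: eq_bigr => j _; ring.
rewrite /gram (eq_bigr (fun i => trt_dot (x i) v ^+ 2 + trt_dot (x i) w ^+ 2 +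
  2 * (trt_dot (x i) v * trt_dot (x i) w))) => [|i _]; last first.
  by rewrite trt_dotD; ring.
by rewrite !big_split /= -mulr_sumr; ring.
Qed.

Lemma linD v w : lin (v + w) = lin v + lin w.
Proof. by rewrite /lin -big_split; apply: eq_bigr => j _; rewrite /= mxE mulrDr. Qed.

Lemma riskD v w :
  risk (v + w) = risk v + gram w + 2 * \sum_j (gram_vec v j - bh j) * w j 0.
Proof.
rewrite /risk gramD linD.
have -> : \sum_j (gram_vec v j - bh j) * w j 0 = \sum_j gram_vec v j * w j 0 - lin w.
  by rewrite /lin -sumrB; apply: eq_bigr => j _; rewrite mulrBl.
by ring.
Qed.

(** The risk is quadratic with second order term [gram], so a risk not above that
    at [psi] bounds [gram (b - psi)] by the linear term. *)
Lemma basic_inequality psi b eta : risk b <= risk psi ->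
  (forall j, `|bh j - gram_vec psi j| <= eta) ->
  gram (b - psi) <= 2 * eta * norm1 (b - psi).
Proof.
move=> rb h; have := riskD psi (b - psi); rewrite addrC subrK => e.
have : gram (b - psi) <= 2 * \sum_j (bh j - gram_vec psi j) * (b - psi) j 0.
  have -> : \sum_j (bh j - gram_vec psi j) * (b - psi) j 0 =
      - \sum_j (gram_vec psi j - bh j) * (b - psi) j 0.
    by rewrite -sumrN; apply: eq_bigr => j _; ring.
  by move: rb; rewrite e; lra.
move=> /le_trans; apply; rewrite -mulrA ler_wpM2l // /norm1 mulr_sumr.
apply: ler_sum => j _; apply: (le_trans (ler_norm _)).
by rewrite normrM ler_wpM2r.
Qed.

Lemma gramZ t v : gram (t *: v) = t ^+ 2 * gram v.
Proof.
rewrite /gram mulrCA; congr (_ * _); rewrite mulr_sumr; apply: eq_bigr => i _.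
by rewrite trt_dotZ exprMn.
Qed.

Lemma gram_eq0 v : (0 < n)%N -> gram v = 0 -> forall i, trt_dot (x i) v = 0.
Proof.
move=> n0 /eqP; rewrite mulf_eq0 invr_eq0 pnatr_eq0 -[n == 0%N]negbK -lt0n n0 /=.
rewrite psumr_eq0 => [/allP h i|i _]; last exact: sqr_ge0.
by apply/eqP; rewrite -sqrf_eq0; apply: (h i); rewrite mem_index_enum.
Qed.

Definition supp v : {set 'I_k} := [set j | v j 0 != 0]%SET.

Definition definite_on S :=
  forall v, supp v \subset S -> gram v = 0 -> v = 0.

(** [n] times the Gram matrix on [S], completed by an identity block.  It stays of
    size [k] and has integer entries. *)
Definition gram_block S : 'M[int]_k :=
  \matrix_(i, j) (if (i \in S) && (j \in S)
    then (\sum_l (tnth (x l) i * tnth (x l) j)%N)%:Z else (i == j)%:Z).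

Definition block_rhs S : 'cV[R]_k := \col_j (if j \in S then n%:R * bh j else 0).

Local Notation GB S := (map_mx intr (gram_block S) : 'M[R]_k).

Lemma supp_notin v S j : supp v \subset S -> j \notin S -> v j 0 = 0.
Proof. by move=> /fintype.subsetP vS; apply: contraNeq => vj; apply: vS; rewrite inE. Qed.

Lemma gram_block_mul S v : (0 < n)%N -> supp v \subset S ->
  forall i, (GB S *m v) i 0 = if i \in S then n%:R * gram_vec v i else 0.
Proof.
move=> n0 vS i; rewrite mxE; case: ifPn => iS; last first.
  rewrite (bigD1 i) //= big1 => [|j ji]; rewrite !mxE (negbTE iS) /=.
    by rewrite eqxx mul1r addr0 (supp_notin vS).
  by rewrite eq_sym (negbTE ji) mul0r.
rewrite /gram_vec mulrA mulfV ?pnatr_eq0 -?lt0n // mul1r.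
transitivity (\sum_j \sum_l (tnth (x l) i)%:R * ((tnth (x l) j)%:R * v j 0)).
  apply: eq_bigr => j _; rewrite !mxE iS /=; case: ifPn => jS; last first.
    by rewrite (supp_notin vS jS) mulr0 big1 // => l _; rewrite !mulr0.
  rewrite -pmulrn natr_sum mulr_suml; apply: eq_bigr => l _.
  by rewrite natrM mulrA.
rewrite exchange_big /=; apply: eq_bigr => l _.
by rewrite -mulr_sumr.
Qed.

Lemma gram_sum v : gram v = \sum_j gram_vec v j * v j 0.
Proof.
have := gramD v v; rewrite -[v + v]/(v *+ 2) -scaler_nat gramZ => h.
have -> : gram v = (2%:R ^+ 2 * gram v - 2 * gram v) / 2 by field.
by rewrite h; field.
Qed.

Lemma gram_block_mul_notin S v i : i \notin S -> (GB S *m v) i 0 = v i 0.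
Proof.
move=> iS; rewrite mxE (bigD1 i) //= big1 => [|j ji]; rewrite !mxE (negbTE iS) /=.
  by rewrite eqxx mul1r addr0.
by rewrite eq_sym (negbTE ji) mul0r.
Qed.

(** A kernel vector vanishes off [S] by the identity block, and has zero Gram form. *)
Lemma gram_block_det_neq0 S : (0 < n)%N -> definite_on S -> \det (GB S) != 0.
Proof.
move=> n0 dS; apply/negP => /det0P[u u0 uG].
have sym : (GB S)^T = GB S.
  apply/matrixP => i j; rewrite !mxE [(j \in S) && _]andbC eq_sym.
  by congr (if _ then _ else _)%:~R; congr Posz; apply: eq_bigr => l _; rewrite mulnC.
have vG : GB S *m u^T = 0 by rewrite -sym -trmx_mul uG trmx0.
have vS : supp u^T \subset S.
  apply/fintype.subsetP => i; rewrite inE; apply: contraNT => iS.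
  by rewrite -(gram_block_mul_notin _ iS) vG mxE.
have g0 : gram u^T = 0.
  rewrite gram_sum big1 // => j _; have [jS|jS] := boolP (j \in S); last first.
    by rewrite (supp_notin vS jS) mulr0.
  have := gram_block_mul n0 vS j; rewrite vG mxE jS => /esym/eqP.
  by rewrite mulf_eq0 pnatr_eq0 -[n == 0%N]negbK -lt0n n0 /= => /eqP->; rewrite mul0r.
by have := dS _ vS g0; apply/eqP; rewrite trmx_eq0.
Qed.

(** The normal equations of the risk restricted to vectors supported on [S]. *)
Definition stationary_on S b :=
  supp b \subset S /\ forall j, j \in S -> gram_vec b j = bh j.

Lemma stationary_exists S : (0 < n)%N -> definite_on S -> {b | stationary_on S b}.
Proof.
move=> n0 dS; exists (invmx (GB S) *m block_rhs S).
have e : GB S *m (invmx (GB S) *m block_rhs S) = block_rhs S.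
  by rewrite mulKVmx // unitmxE unitfE gram_block_det_neq0.
set b := _ *m block_rhs S in e *.
have bS : supp b \subset S.
  apply/fintype.subsetP => i; rewrite inE; apply: contraNT => iS.
  by rewrite -(gram_block_mul_notin _ iS) e mxE (negbTE iS).
split=> // j jS; have := gram_block_mul n0 bS j; rewrite e mxE jS.
by move/mulfI => -> //; rewrite pnatr_eq0 -lt0n.
Qed.

Lemma stationary_min S b : stationary_on S b ->
  forall w, supp w \subset S -> risk b <= risk w.
Proof.
move=> [bS e] w wS; rewrite -[w](subrK b) addrC riskD -addrA lerDl.
rewrite big1 ?mulr0 ?addr0 ?gram_ge0 // => j _.
have [jS|jS] := boolP (j \in S); first by rewrite e // subrr mul0r.
by rewrite !mxE (supp_notin bS jS) (supp_notin wS jS) subrr mulr0.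
Qed.

Lemma min_stationary S b : supp b \subset S ->
  (forall w, supp w \subset S -> risk b <= risk w) -> stationary_on S b.
Proof.
move=> bS bmin; split=> // j jS; apply/eqP; rewrite -subr_eq0; apply/eqP.
set c := gram_vec b j - bh j.
pose e : 'cV[R]_k := delta_mx j 0.
have q t : 0 <= t ^+ 2 * gram e + 2 * t * c.
  have sub : supp (b + t *: e) \subset S.
    apply/fintype.subsetP => i; rewrite inE; apply: contraNT => iS.
    rewrite !mxE (supp_notin bS iS) eqxx andbT add0r; apply/eqP.
    by case: eqVneq => [ij|]; rewrite ?mulr0 //; rewrite ij jS in iS.
  have := bmin _ sub; rewrite riskD gramZ -addrA lerDl.
  rewrite (bigD1 j) //= big1 => [|i ij].
    rewrite !mxE !eqxx /= mulr1 addr0 -/c.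
    by have -> : 2 * (c * t) = 2 * t * c by ring.
  by rewrite !mxE (negbTE ij) !mulr0.
have g0 := gram_ge0 e; have [//|c0] := eqVneq c 0; exfalso.
have := q (- c / (gram e + 1)); clear q; move: (gram e) g0 => g g0.
have g1 : 0 < g + 1 by lra.
have -> : (- c / (g + 1)) ^+ 2 * g + 2 * (- c / (g + 1)) * c =
    - (c ^+ 2 * (g + 2) / (g + 1) ^+ 2) by field; rewrite gt_eqF.
rewrite oppr_ge0 leNgt => /negP; apply.
have c2 : 0 < c ^+ 2 by rewrite exprn_even_gt0.
have g2 : 0 < g + 2 by lra.
by apply: divr_gt0; [exact: mulr_gt0|exact: exprn_gt0].
Qed.

End QuadraticRisk.

(** * Size of the best subset minimisers *)

Section CofactorBound.
Context (R : realType).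

(** Deleting row [i] removes the factor [c i], which is at least 1. *)
Lemma norm_cofactor_le m (A : 'M[R]_m) (c : 'I_m -> R) i j :
  (forall l, 1 <= c l) -> (forall l, \sum_p `|A l p| <= c l) ->
  `|cofactor A i j| <= \prod_l c l.
Proof.
case: m A c i j => [|m] A c i j c1 Ac; first by case: i.
rewrite /cofactor normrM normrX normrN1 expr1n mul1r.
apply: (le_trans (norm_det_le _)); rewrite (bigD1_ord i) //=.
apply: (@le_trans _ _ (\prod_l c (lift i l))); last first.
  by rewrite ler_peMl // prodr_ge0 // => l _; rewrite (le_trans _ (c1 _)).
apply: ler_prod => l _; rewrite sumr_ge0 //=.
apply: le_trans (Ac _); rewrite (bigD1_ord j) //=.
by under eq_bigr do rewrite !mxE; rewrite lerDr.
Qed.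

End CofactorBound.

Section BestSubset.
Context (R : realType) (n k : nat) (x : 'I_n -> treatment k) (bh : 'I_k -> R).
Context (s : nat).
Hypothesis n_gt0 : (0 < n)%N.
Hypothesis s_gt0 : (0 < s)%N.
Implicit Types (v w b : 'cV[R]_k) (S : {set 'I_k}).

Local Notation GB S := (map_mx intr (gram_block x S) : 'M[R]_k).
Local Notation sn := ((s * n)%:R : R).

Lemma gram_block_row_sum S l : (#|S| <= s)%N ->
  \sum_p `|GB S l p| <= if l \in S then sn else 1.
Proof.
move=> Ss; case: ifPn => lS; last first.
  rewrite (bigD1 l) //= big1 => [|j jl]; rewrite !mxE (negbTE lS) /=.
    by rewrite eqxx normr1 addr0.
  by rewrite eq_sym (negbTE jl) normr0.
apply: (@le_trans _ _ (\sum_(p in S) n%:R)).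
  rewrite [leRHS]big_mkcond; apply: ler_sum => p _; rewrite !mxE lS /=.
  case: ifPn => pS; last by case: eqVneq pS => [<-|_]; rewrite ?lS ?normr0.
  rewrite -pmulrn normr_nat ler_nat.
  apply: (@leq_trans (\sum_(l < n) 1)%N); last by rewrite sum1_card card_ord.
  by apply: leq_sum => i _; case: (tnth _ _); case: (tnth _ _).
by rewrite sumr_const -[_ *+ _]mulr_natl -natrM ler_nat leq_mul2r Ss orbT.
Qed.

Lemma sn_ge1 : 1 <= sn.
Proof. by rewrite ler1n muln_gt0 s_gt0. Qed.

(** Cramer's rule for an integer matrix: its determinant is at least 1 in absolute
    value, and the cofactors are products of row sums, which are at most [s * n] on
    [S] and 1 elsewhere. *)
Lemma stationary_norm_le S b (M : R) : 0 <= M -> (#|S| <= s)%N -> definite_on R x S ->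
  (forall j, `|bh j| <= M) -> stationary_on x bh S b ->
  norm2 b <= sn ^+ (s + 2) * M.
Proof.
move=> M0 Ss dS bM [bS bst].
have sn1 := sn_ge1; have sn0 : 0 <= sn by apply: le_trans sn1.
have d1 : 1 <= `|\det (GB S)| by apply: norm_det_int_ge1; exact: gram_block_det_neq0.
have cof i j : `|\adj (GB S) i j| <= sn ^+ s.
  rewrite mxE;
  apply: (le_trans (norm_cofactor_le (c := fun l => if l \in S then sn else 1) _ _ _ _)).
  - by move=> l; case: ifP.
  - by move=> l; exact: gram_block_row_sum.
  - rewrite -big_mkcond /= prodr_const; exact: ler_weXn2l.
have adjE i : \det (GB S) * b i 0 = \sum_(j in S) \adj (GB S) i j * (n%:R * bh j).
  transitivity ((\adj (GB S) *m (GB S *m b)) i 0).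
    by rewrite mulmxA mul_adj_mx mul_scalar_mx mxE.
  rewrite mxE [RHS]big_mkcond; apply: eq_bigr => j _.
  by rewrite gram_block_mul //; case: ifPn => jS; rewrite ?mulr0 // bst.
have bi i : `|b i 0| <= s%:R * (sn ^+ s * (n%:R * M)).
  apply: (@le_trans _ _ `|\det (GB S) * b i 0|); first by rewrite normrM ler_peMl.
  rewrite adjE; apply: (le_trans (ler_norm_sum _ _ _)).
  apply: (@le_trans _ _ (\sum_(j in S) sn ^+ s * (n%:R * M))).
    apply: ler_sum => j _; rewrite !normrM normr_nat.
    by apply: ler_pM => //; apply: ler_wpM2l.
  rewrite sumr_const -[_ *+ _]mulr_natl ler_wpM2r ?ler_nat //.
  by rewrite !mulr_ge0 ?exprn_ge0.
apply: (le_trans (norm2_le_norm1 _)).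
have -> : norm1 b = \sum_(j in S) `|b j 0|.
  rewrite /norm1 [RHS]big_mkcond; apply: eq_bigr => j _; case: ifPn => // jS.
  by rewrite (supp_notin bS jS) normr0.
apply: (@le_trans _ _ (\sum_(j in S) s%:R * (sn ^+ s * (n%:R * M)))).
  exact: ler_sum.
rewrite sumr_const -[_ *+ _]mulr_natl.
apply: (@le_trans _ _ (s%:R * (s%:R * (sn ^+ s * (n%:R * M))))).
  by rewrite ler_wpM2r ?ler_nat // !mulr_ge0 ?exprn_ge0.
have -> : s%:R * (s%:R * (sn ^+ s * (n%:R * M))) = (s%:R ^+ 2 * n%:R) * (sn ^+ s * M) by ring.
have -> : sn ^+ (s + 2) * M = sn ^+ 2 * (sn ^+ s * M) by rewrite exprD; ring.
rewrite ler_wpM2r ?mulr_ge0 ?exprn_ge0 //.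
by rewrite natrM exprMn ler_wpM2l ?exprn_ge0 // expr2 ler_peMr // ler1n.
Qed.

Definition sparse : set 'cV[R]_k := [set b | (norm0 b <= s)%N].
Local Notation minimisers := (argmin sparse (risk x bh)).

Lemma norm0_sub v S : supp v \subset S -> (norm0 v <= #|S|)%N.
Proof. exact: subset_leq_card. Qed.

(** Along a kernel vector [v] of the Gram form supported by [b] the risk is affine,
    hence constant since it is bounded below there.  The whole line consists of
    minimisers, and one of its points loses a coordinate of the support. *)
Lemma minimiser_shrink b : minimisers b -> ~ definite_on R x (supp b) ->
  infinite_set minimisers /\ exists b', minimisers b' /\ (norm0 b' < norm0 b)%N.
Proof.
move=> [bs bmin] /existsNP[v] /not_implyP[vb] /not_implyP[gv0 v0].
have tv0 := gram_eq0 n_gt0 gv0.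
have gramv w : \sum_j (gram_vec x w j) * v j 0 = 0.
  have := gramD x w v; rewrite gv0 addr0 => h.
  suff e : gram x (w + v) = gram x w by lra.
  by congr (_ * _); apply: eq_bigr => i _; rewrite trt_dotD tv0 addr0.
have sub t : supp (b + t *: v) \subset supp b.
  apply/fintype.subsetP => i; rewrite inE; apply: contraNT => ib.
  by rewrite !mxE (supp_notin vb ib) (supp_notin (fintype.subxx _) ib) mulr0 addr0.
have riskE t : risk x bh (b + t *: v) = risk x bh b - 2 * t * lin bh v.
  rewrite riskD gramZ gv0 mulr0 addr0; congr (_ + _).
  rewrite (eq_bigr (fun j => t * (gram_vec x b j * v j 0) - t * (bh j * v j 0))) => [|j _].
    by rewrite sumrB -!mulr_sumr gramv /lin; ring.
  by rewrite !mxE; ring.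
have sp t : sparse (b + t *: v) by exact: leq_trans (subset_leq_card (sub t)) bs.
have l0 : lin bh v = 0.
  have := bmin _ (sp (lin bh v)); rewrite riskE => h.
  by apply/eqP; rewrite -sqrf_eq0; apply/eqP/le_anti; rewrite sqr_ge0 andbT; lra.
have Mt t : minimisers (b + t *: v).
  by split => // b' sb'; rewrite riskE l0 mulr0 subr0; exact: bmin.
have [j vj] : exists j, v j 0 != 0.
  apply: contrapT => h; apply: v0; apply/matrixP => i j; rewrite ord1 mxE.
  by apply/eqP/negPn/negP => vi; apply: h; exists i.
split.
  move=> fM; apply: infinite_nat.
  pose f (m : nat) := b + m%:R *: v.
  apply: (sub_finite_set _ (finite_preimage (f := f) _ fM)).
    by move=> m _; exact: Mt.
  move=> m m' _ _ /addrI/matrixP/(_ j 0); rewrite !mxE => /(mulIf vj)/eqP.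
  by rewrite eqr_nat => /eqP.
exists (b + (- (b j 0 / v j 0)) *: v); split; first exact: Mt.
apply: proper_card; rewrite finset.properEneq sub andbT.
apply/negP => /eqP/setP/(_ j); rewrite !inE !mxE mulNr divfK // subrr eqxx => /esym.
have /fintype.subsetP/(_ j) := vb; rewrite !inE => /(_ vj) ->.
by [].
Qed.

(** Repeated shrinking of the support; it starts only if there are infinitely many
    minimisers. *)
Lemma minimiser_definite b : minimisers b ->
  exists w, [/\ minimisers w, definite_on R x (supp w) &
    w = b \/ infinite_set minimisers].
Proof.
have [m] := ubnP (norm0 b); elim: m b => // m IH b bm Mb.
have [db|db] := EM (definite_on R x (supp b)); first by exists b; split => //; left.
have [inf [b' [Mb' lt]]] := minimiser_shrink Mb db.
have [//|w [Mw dw _]] := IH b' _ Mb'; first exact: leq_trans lt bm.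
by exists w; split => //; right.
Qed.

(** Either [b] itself has a support on which the Gram form is definite, or there
    are infinitely many minimisers and [b] has least norm, so it is not longer than
    one with such a support. *)
Lemma best_subset_norm_le b (M : R) : 0 <= M -> minimisers b ->
  (infinite_set minimisers -> forall b', minimisers b' -> norm2 b <= norm2 b') ->
  (forall j, `|bh j| <= M) -> norm2 b <= sn ^+ (s + 2) * M.
Proof.
move=> M0 Mb binf bM; have [w [[ws wmin] dw wb]] := minimiser_definite Mb.
apply: (@le_trans _ _ (norm2 w)).
  by case: wb => [->//|/binf]; apply.
apply: (stationary_norm_le (S := supp w)) => //.
apply: min_stationary => // w' w'S; apply: wmin.
exact: leq_trans (norm0_sub w'S) ws.
Qed.

(** On each of the finitely many supports the normal equations have a solution, and
    the best of these is a minimiser. *)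
Lemma best_subset_exists :
  (forall v, (norm0 v <= s)%N -> gram x v = 0 -> v = 0) -> minimisers !=set0.
Proof.
move=> def.
have dS S : (#|S| <= s)%N -> definite_on R x S.
  by move=> Ss v vS; apply: def; exact: leq_trans (norm0_sub vS) Ss.
have ex S : exists b, (#|S| <= s)%N -> stationary_on x bh S b.
  have [Ss|_] := leqP #|S| s; last by exists 0.
  by have [b bP] := stationary_exists bh n_gt0 (dS S Ss); exists b.
have [f fP] := choice ex.
have s0 : (#|(finset.set0 : {set 'I_k})| <= s)%N by rewrite cards0.
case: (Order.TotalTheory.arg_minP
  (P := [pred S : {set 'I_k} | #|S| <= s]%N) (fun S => risk x bh (f S)) s0) => S Ss Smin.
exists (f S); split; first exact: leq_trans (norm0_sub (fP S Ss).1) Ss.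
move=> b bs; apply: (le_trans (Smin (supp b) bs)).
exact: stationary_min (fP _ bs) _ (fintype.subxx _).
Qed.

End BestSubset.

(** * Quadratic forms of Gram matrices *)

Section QuadraticForms.
Context (R : realType) (d k : nat).
Implicit Types (v : 'cV[R]_k) (M : 'M[R]_k).

Lemma quad_formE M v : quad_form M v = \sum_i \sum_j v i 0 * M i j * v j 0.
Proof.
rewrite /quad_form mxE exchange_big /=; apply: eq_bigr => j _.
by rewrite mxE mulr_suml; apply: eq_bigr => i _; rewrite mxE.
Qed.

Lemma quad_formB M N v : quad_form (M - N) v = quad_form M v - quad_form N v.
Proof. by rewrite /quad_form mulmxBr mulmxBl [LHS]mxE [X in _ + X = _]mxE. Qed.

Lemma quad_form_le (M : 'M[R]_k) v (t : R) : (forall i j, `|M i j| <= t) ->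
  `|quad_form M v| <= t * norm1 v ^+ 2.
Proof.
move=> Mt; rewrite quad_formE; apply: (le_trans (ler_norm_sum _ _ _)).
rewrite expr2 mulrA [t * norm1 v]mulrC /norm1 !mulr_suml; apply: ler_sum => i _.
apply: (le_trans (ler_norm_sum _ _ _)); rewrite mulr_sumr; apply: ler_sum => j _.
by rewrite !normrM ler_wpM2r // ler_wpM2l.
Qed.

Lemma trt_dot_sqr (a : treatment k) v : trt_dot a v ^+ 2 =
  \sum_i \sum_j v i 0 * ((tnth a i)%:R * (tnth a j)%:R) * v j 0.
Proof.
rewrite expr2 {1}/trt_dot mulr_suml; apply: eq_bigr => i _.
by rewrite /trt_dot mulr_sumr; apply: eq_bigr => j _; ring.
Qed.

Definition sample_trt n (D : n.-tuple (obs R d k)) (i : 'I_n) : treatment k :=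
  trtA (tnth D i).

Lemma design_gramE n (D : n.-tuple (obs R d k)) i j :
  (n%:R^-1 *: ((design D)^T *m design D)) i j =
  n%:R^-1 * \sum_l (tnth (sample_trt D l) i)%:R * (tnth (sample_trt D l) j)%:R.
Proof.
rewrite mxE mxE; congr (_ * _); apply: eq_bigr => l _.
by rewrite !mxE /sample_trt.
Qed.

Lemma quad_form_design n (D : n.-tuple (obs R d k)) v :
  quad_form (n%:R^-1 *: ((design D)^T *m design D)) v = gram (sample_trt D) v.
Proof.
rewrite quad_formE /gram mulr_sumr.
rewrite (eq_bigr (fun l => \sum_i \sum_j v i 0 *
    (n%:R^-1 * ((tnth (sample_trt D l) i)%:R * (tnth (sample_trt D l) j)%:R)) * v j 0)).
  rewrite [RHS]exchange_big /=; apply: eq_bigr => i _.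
  rewrite [RHS]exchange_big /=; apply: eq_bigr => j _.
  by rewrite design_gramE mulr_sumr mulr_sumr mulr_suml.
move=> l _; rewrite trt_dot_sqr mulr_sumr; apply: eq_bigr => i _.
by rewrite mulr_sumr; apply: eq_bigr => j _; ring.
Qed.

Context (P : probability (obs R d k) R).

Lemma integrable_trtA (f : treatment k -> R) :
  P.-integrable [set: obs R d k] (fun z => (f (trtA z))%:E).
Proof.
apply: (bounded_integrable P (c := \sum_a `|f a|)); first exact: measurable_fun_trtA.
by move=> z; rewrite (bigD1 (trtA z)) //= lerDl sumr_ge0.
Qed.

Lemma second_momentE i j : (\int[P]_z ((tnth (trtA z) i)%:R * (tnth (trtA z) j)%:R)%:E =
  (second_moment P i j)%:E)%E.
Proof.
rewrite mxE fineK unlock.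
  by apply: eq_integral => z _; rewrite mxE big_ord1 !mxE.
apply: integrable_fin_num => //.
have h := integrable_trtA (fun a => (tnth a i)%:R * (tnth a j)%:R).
apply: eq_integrable h => // z _.
by rewrite /= mxE big_ord1 !mxE.
Qed.

Lemma integral_trt_dot_sqr v :
  (\int[P]_z (trt_dot (trtA z) v ^+ 2)%:E = (quad_form (second_moment P) v)%:E)%E.
Proof.
rewrite quad_formE -sumEFin; under eq_integral do rewrite trt_dot_sqr -sumEFin.
rewrite integral_sum //; last first.
  move=> i;
  exact: (integrable_trtA
    (fun a => \sum_j v i 0 * ((tnth a i)%:R * (tnth a j)%:R) * v j 0)).
apply: eq_bigr => i _; rewrite -sumEFin; under eq_integral do rewrite -sumEFin.
rewrite integral_sum //; last first.
  move=> j; exact: (integrable_trtA (fun a => v i 0 * ((tnth a i)%:R * (tnth a j)%:R) * v j 0)).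
apply: eq_bigr => j _; rewrite mulrAC EFinM -second_momentE.
under eq_integral do rewrite mulrAC EFinM.
by rewrite integralZl //; exact: (integrable_trtA (fun a => (tnth a i)%:R * (tnth a j)%:R)).
Qed.

End QuadraticForms.

(** * The score of the estimating equation *)

Section Score.
Context (R : realType) (d k n : nat) (psi0 B : R) (muhat pihat : nuisance R d k n)
  (psi : 'cV[R]_k).
Hypothesis n_gt0 : (0 < n)%N.
Implicit Types (D : n.-tuple (obs R d k)) (z : obs R d k) (a : treatment k).

Lemma trt_freqE D a : trt_freq D a = n%:R^-1 * \sum_i (sample_trt D i == a)%:R :> R.
Proof.
rewrite /trt_freq -sum1_card natr_sum mulrC big_mkcond; congr (_ * _).
by apply: eq_bigr => i _; rewrite inE; case: eqP.
Qed.

Lemma sum_trt_freq D (phi : treatment k -> R) :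
  \sum_a phi a * trt_freq D a = n%:R^-1 * \sum_i phi (sample_trt D i).
Proof.
under eq_bigr do rewrite trt_freqE mulrCA mulr_sumr.
rewrite -mulr_sumr exchange_big /=; congr (_ * _); apply: eq_bigr => i _.
rewrite (bigD1 (sample_trt D i)) //= eqxx mulr1 big1 ?addr0 // => a ai.
by rewrite eq_sym (negbTE ai) mulr0.
Qed.

Lemma trt_freq_ge0 D a : 0 <= trt_freq D a.
Proof. by rewrite divr_ge0. Qed.

Lemma sum_trt_freq1 D : \sum_a trt_freq D a = 1.
Proof.
have := sum_trt_freq D (fun=> 1); under eq_bigr do rewrite mul1r.
by move=> ->; rewrite sumr_const card_ord mulVf // pnatr_eq0 -lt0n.
Qed.

(** The score enters the risk weighted by the frequencies of the treatments in the
    sample [D] that also yields the nuisance estimates. *)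
Definition aipw_score D z (j : 'I_k) : R :=
  \sum_a aipw a (pihat D a) (muhat D a) psi0 z * (tnth a j)%:R * trt_freq D a.

Definition aipw_mean D1 D2 (j : 'I_k) : R :=
  n%:R^-1 * \sum_i aipw_score D1 (tnth D2 i) j.

Lemma emp_riskE D1 D2 b :
  emp_risk psi0 muhat pihat D1 D2 b = risk (sample_trt D2) (aipw_mean D1 D2) b.
Proof.
have -> : risk (sample_trt D2) (aipw_mean D1 D2) b =
    n%:R^-1 * \sum_i (- 2 * (\sum_j aipw_score D1 (tnth D2 i) j * b j 0) +
      trt_dot (sample_trt D2 i) b ^+ 2).
  rewrite big_split /= -mulr_sumr /risk /gram /lin.
  have -> : \sum_j aipw_mean D1 D2 j * b j 0 =
      n%:R^-1 * \sum_i \sum_j aipw_score D1 (tnth D2 i) j * b j 0.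
    rewrite exchange_big mulr_sumr; apply: eq_bigr => j _.
    by rewrite /aipw_mean -mulrA mulr_suml.
  by ring.
rewrite /emp_risk; congr (_ * _); apply: eq_bigr => i _; congr (_ * _ + _).
under [RHS]eq_bigr do rewrite /aipw_score mulr_suml.
rewrite exchange_big /=; apply: eq_bigr => a _.
rewrite /trt_dot mulr_sumr mulr_suml; apply: eq_bigr => j _.
by rewrite /aipw /treated; ring.
Qed.

(** Its average over the second sample is the noise of the normal equations at
    [psi]. *)
Definition score D z (j : 'I_k) : R :=
  aipw_score D z j - (tnth (trtA z) j)%:R * trt_dot (trtA z) psi.

Lemma score_mean D1 D2 j : n%:R^-1 * (\sum_i score D1 (tnth D2 i) j) =
  aipw_mean D1 D2 j - gram_vec (sample_trt D2) psi j.
Proof. by rewrite /score sumrB mulrBr. Qed.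

Hypothesis B_gt0 : 0 < B.
Hypothesis psi0_le : `|psi0| <= B.
Hypothesis psi_le : forall a, `|trt_dot a psi| <= 2 * B.

(** The almost sure bounds of the assumptions, at a first sample [D] and an
    observation [z]. *)
Definition regular D z : Prop :=
  [/\ `|outY z| <= B,
    forall a, `|trt_freq D a / pihat D a (covX z)| <= B &
    forall a, `|muhat D a (covX z)| <= B].

Lemma score_le D z j : regular D z -> `|score D z j| <= 2 * B ^+ 2 + 4 * B.
Proof.
move=> [Y_le w_le mu_le].
have tj (a : treatment k) : `|(tnth a j)%:R : R| <= 1 by rewrite normr_nat lern1 leq_b1.
have -> : 2 * B ^+ 2 + 4 * B = B * (B + B) + (B + B) + 2 * B by ring.
apply: (le_trans (ler_normB _ _)); apply: lerD; last first.
  by rewrite normrM -[leRHS]mul1r; apply: ler_pM.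
rewrite /aipw_score (eq_bigr (fun a =>
    treated a z * (trt_freq D a / pihat D a (covX z)) *
      (outY z - muhat D a (covX z)) * (tnth a j)%:R +
    (muhat D a (covX z) - psi0) * (tnth a j)%:R * trt_freq D a)) => [|a _]; last first.
  by rewrite /aipw; ring.
rewrite big_split; apply: (le_trans (ler_normD _ _)); apply: lerD.
  rewrite (bigD1 (trtA z)) //= big1 => [|a az]; last first.
    by rewrite /treated eq_sym (negbTE az) !mul0r.
  rewrite addr0 /treated eqxx mul1r -[leRHS]mulr1 normrM.
  apply: ler_pM => //; rewrite normrM; apply: ler_pM => //.
  by apply: (le_trans (ler_normB _ _)); exact: lerD.
apply: (le_trans (ler_norm_sum _ _ _)).
apply: (@le_trans _ _ (\sum_a (B + B) * trt_freq D a)); last first.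
  by rewrite -mulr_sumr sum_trt_freq1 mulr1.
apply: ler_sum => a _; rewrite normrM (ger0_norm (trt_freq_ge0 D a)).
rewrite ler_wpM2r ?trt_freq_ge0 // normrM -[leRHS]mulr1; apply: ler_pM => //.
by apply: (le_trans (ler_normB _ _)); exact: lerD.
Qed.

Hypothesis mpihat : nuisance_measurable pihat.
Hypothesis mmuhat : nuisance_measurable muhat.

Lemma measurable_trt_freq a : measurable_fun [set: n.-tuple (obs R d k)] (fun D => trt_freq D a).
Proof.
under eq_fun do rewrite trt_freqE.
apply: measurable_funM => //; apply: measurable_sum => i.
exact: (measurableT_comp (measurable_fun_trtA (fun u => (u == a)%:R : R)) (measurable_tnth i)).
Qed.

Let obs2 := (n.-tuple (obs R d k) * obs R d k)%type.

Let mnuis (h : nuisance R d k n) : nuisance_measurable h -> forall a,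
  measurable_fun [set: obs2] (fun x => h x.1 a (covX x.2)).
Proof.
move=> mh a; apply: (measurableT_comp (mh a)
  (g := fun x : obs2 => (x.1, covX x.2))).
apply: measurable_fun_pair => //.
exact: (measurableT_comp (@measurable_covX R d k)).
Qed.

Lemma measurable_score j : measurable_fun [set: obs2] (fun x => score x.1 x.2 j).
Proof.
have mt (f : treatment k -> R) : measurable_fun [set: obs2] (fun x => f (trtA x.2)).
  exact: (measurableT_comp (measurable_fun_trtA f)).
have mY : measurable_fun [set: obs2] (fun x => outY x.2).
  exact: (measurableT_comp (@measurable_outY R d k)).
apply: measurable_funB; last first.
  exact: (mt (fun a => (tnth a j)%:R * trt_dot a psi)).
apply: measurable_sum => a; apply: measurable_funM; last first.
  exact: (measurableT_comp (measurable_trt_freq a) measurable_fst).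
apply: measurable_funM => //.
apply: measurable_funB => //; apply: measurable_funD; last exact: mnuis.
apply: measurable_funM; last by apply: measurable_funB => //; exact: mnuis.
apply: measurable_funM; first exact: (mt (fun u => (u == a)%:R)).
by apply: (measurableT_comp (@measurable_inv R)); exact: mnuis.
Qed.

Lemma measurable_regular : measurable [set x : obs2 | regular x.1 x.2].
Proof.
have mle (f : obs2 -> R) : measurable_fun [set: obs2] f -> measurable [set x | `|f x| <= B].
  move=> mf; rewrite (_ : mkset _ = (fun x => `|f x|) @^-1` `]-oo, B]).
    have m : measurable_fun [set: obs2] (fun x => `|f x|) by exact: measurableT_comp.
    by have := m measurableT _ (measurable_itv `]-oo, B]); rewrite setTI.
  by apply/seteqP; split => x /=; rewrite in_itv.
rewrite (_ : mkset _ = [set x | `|outY x.2| <= B] `&`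
   (\bigcap_(a in [set: treatment k]) [set x | `|trt_freq x.1 a / pihat x.1 a (covX x.2)| <= B] `&`
    \bigcap_(a in [set: treatment k]) [set x | `|muhat x.1 a (covX x.2)| <= B])); last first.
  apply/seteqP; split => [x [h1 h2 h3]|x [h1 [h2 h3]]].
    by split => //; split => a _; [exact: h2|exact: h3].
  by split => // a; [exact: (h2 a Logic.I)|exact: (h3 a Logic.I)].
apply: measurableI; first by apply: mle; exact: (measurableT_comp (@measurable_outY R d k)).
apply: measurableI; apply: fin_bigcap_measurable; try exact: finite_finset.
  move=> a _; apply: mle; apply: measurable_funM.
    exact: (measurableT_comp (measurable_trt_freq a) measurable_fst).
  by apply: (measurableT_comp (@measurable_inv R)); exact: mnuis.
by move=> a _; apply: mle; exact: mnuis.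
Qed.

End Score.

(** * Conditional mean of the score *)

Section ScoreBias.
Context (R : realType) (d k n : nat) (P : probability (obs R d k) R).
Context (pi mu : treatment k -> d.-tuple R -> R) (psi0 B : R) (muhat pihat : nuisance R d k n)
  (psi : 'cV[R]_k) (delta eps : R).
Hypothesis n_gt0 : (0 < n)%N.
Hypothesis B_gt0 : 0 < B.
Hypothesis psi0_le : `|psi0| <= B.
Hypothesis propP : is_propensity P pi.
Hypothesis pi_gt0 : {ae P, forall z : obs R d k, forall a : treatment k, 0 < pi a (covX z)}.
Hypothesis regP : is_regression P mu.
Hypothesis Y_le : {ae P, forall z : obs R d k, `|outY z| <= B}.
Hypothesis mpihat : nuisance_measurable pihat.
Hypothesis mmuhat : nuisance_measurable muhat.
Hypothesis msm : forall a : treatment k,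
  (\int[P]_z (mu a (covX z))%:E)%E = (psi0 + \sum_(j < k) psi j 0 * (tnth a j)%:R)%:E.
Implicit Types (D : n.-tuple (obs R d k)) (z : obs R d k) (a : treatment k).

Let integrable_mu a : P.-integrable [set: obs R d k] (fun z => (mu a (covX z))%:E).
Proof.
have [mmu _ _] := regP a; apply: (ae_bounded_integrable (M := B)).
  exact: (measurableT_comp mmu (@measurable_covX R d k)).
by apply: filterS (regression_le propP pi_gt0 regP Y_le) => z; apply.
Qed.

Lemma msm_dot a : (\int[P]_z (mu a (covX z) - psi0)%:E = (trt_dot a psi)%:E)%E.
Proof.
under eq_integral do rewrite EFinB.
rewrite integralB //; last exact: (finite_measure_integrable_cst P psi0 measurableT).
rewrite msm integral_cst //= probability_setT mule1 -EFinB; congr EFin.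
by rewrite addrC addKr /trt_dot; apply: eq_bigr => j _; rewrite mulrC.
Qed.

(** By the structural model, [a^T psi] is a mean of [mu a - psi0]. *)
Lemma trt_dot_psi_le a : `|trt_dot a psi| <= 2 * B.
Proof.
rewrite -lee_fin -abse_EFin -msm_dot.
have mm : measurable_fun [set: obs R d k] (fun z => (mu a (covX z) - psi0)%:E).
  apply/measurable_EFinP; apply: measurable_funB => //.
  by have [mmu _ _] := regP a; exact: (measurableT_comp mmu (@measurable_covX R d k)).
apply: (le_trans (le_abse_integral P measurableT mm)).
rewrite -[leRHS]mule1 -(probability_setT P); apply: integral_le_bound => //.
  by rewrite lee_fin mulr_ge0 // ltW.
apply: filterS (regression_le propP pi_gt0 regP Y_le) => z /(_ a) mz _.
rewrite /= lee_fin mulr_natl mulr2n; apply: (le_trans (ler_normB _ _)).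
exact: lerD.
Qed.

Let M : R := 2 * B ^+ 2 + 4 * B.

Let M_ge0 : 0 <= M.
Proof. by rewrite /M addr_ge0 ?mulr_ge0 ?sqr_ge0 // ltW. Qed.

(** Clipping makes the score bounded everywhere while changing it on a null set only;
    the shifts make the functions nonnegative, so that the conditional means are
    measurable by Tonelli's theorem. *)
Definition clip (c x : R) : R := Num.max (- c) (Num.min c x).

Lemma clip_range c x : 0 <= c -> - c <= clip c x <= c.
Proof.
move=> c0; rewrite /clip le_max lexx /= ge_max ge_min lexx andbT.
by rewrite -subr_ge0 opprK addr_ge0.
Qed.

Lemma clip_id c x : `|x| <= c -> clip c x = x.
Proof. by rewrite ler_norml => /andP[h1 h2]; rewrite /clip (min_idPr h2) (max_idPr h1). Qed.

Definition shifted_score j (x : n.-tuple (obs R d k) * obs R d k) : R :=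
  clip M (score psi0 muhat pihat psi x.1 x.2 j) + M.

Definition shifted_cross j (x : unit * obs R d k) : R :=
  (tnth (trtA x.2) j)%:R * trt_dot (trtA x.2) psi + 2 * B.

Lemma shifted_score_range j x : 0 <= shifted_score j x <= 2 * M.
Proof.
have := clip_range (score psi0 muhat pihat psi x.1 x.2 j) M_ge0.
by rewrite /shifted_score => /andP[? ?]; apply/andP; split; lra.
Qed.

Lemma shifted_cross_range j x : 0 <= shifted_cross j x <= 4 * B.
Proof.
have : `|(tnth (trtA x.2) j)%:R * trt_dot (trtA x.2) psi| <= 2 * B.
  rewrite normrM -[leRHS]mul1r; apply: ler_pM => //; last exact: trt_dot_psi_le.
  by rewrite normr_nat lern1 leq_b1.
by rewrite ler_norml /shifted_cross => /andP[? ?]; apply/andP; split; lra.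
Qed.

Lemma measurable_shifted_score j :
  measurable_fun [set: (n.-tuple (obs R d k) * obs R d k)%type] (shifted_score j).
Proof.
apply: measurable_funD => //; apply: measurable_maxr => //; apply: measurable_minr => //.
exact: measurable_score.
Qed.

Lemma measurable_shifted_cross j :
  measurable_fun [set: (unit * obs R d k)%type] (shifted_cross j).
Proof.
apply: measurable_funD => //.
exact: (measurableT_comp (measurable_fun_trtA
  (fun a => (tnth a j)%:R * trt_dot a psi : R)) measurable_snd).
Qed.

Variable D : n.-tuple (obs R d k).
Hypothesis D_regular : {ae P, forall z, regular B muhat pihat D z}.
Hypothesis pi_close : forall a, (Lnorm P 2%:E (fun z : obs R d k =>
  (pi a (covX z) / pihat D a (covX z) - 1)%:E) <= delta%:E)%E.
Hypothesis mu_close : forall a, (Lnorm P 2%:E (fun z : obs R d k =>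
  (mu a (covX z) - muhat D a (covX z))%:E) <= eps%:E)%E.

(** Given the first sample [D], the score has mean [(G_D - G) psi] up to the bias of
    the nuisance estimates, where [G_D] is the Gram matrix of [D]: the sum over
    treatments weighted by their frequencies in [D] is an average over [D]. *)
Lemma score_bias j :
  `|cond_mean P (shifted_score j) D - M -
    (gram_vec (sample_trt D) psi j + 2 * B - cond_mean P (shifted_cross j) tt)|
  <= delta * eps.
Proof.
have mcov := @measurable_covX R d k.
have msec (h : nuisance R d k n) a : nuisance_measurable h ->
    measurable_fun [set: d.-tuple R] (h D a).
  move=> mh.
  rewrite (_ : h D a = (fun p : n.-tuple (obs R d k) * d.-tuple R => h p.1 a p.2) \o
    (fun x => (D, x))) //.
  by apply: measurableT_comp; [exact: mh|exact: measurable_fun_pair].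
pose f a z := trt_freq D a * (aipw a (pihat D a) (muhat D a) psi0 z - (mu a (covX z) - psi0)).
have fP a : P.-integrable [set: obs R d k] (fun z => (f a z)%:E) /\
    (`|\int[P]_z (f a z)%:E| <= (trt_freq D a * (delta * eps))%:E)%E.
  apply: (aipw_bias propP pi_gt0 regP Y_le) => //.
  - exact: msec.
  - exact: msec.
  - exact: trt_freq_ge0.
  - by apply: filterS D_regular => z [_ + _]; apply.
  - by apply: filterS D_regular => z [_ _]; apply.
pose b a : R := fine (\int[P]_z (f a z)%:E).
have bE a : (\int[P]_z (f a z)%:E = (b a)%:E)%E.
  by rewrite fineK //; apply: integrable_fin_num => //; exact: (fP a).1.
have b_le a : `|b a| <= trt_freq D a * (delta * eps).
  by rewrite -lee_fin -abse_EFin -bE; exact: (fP a).2.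
pose w a : R := (tnth a j)%:R * trt_freq D a.
pose q a : R := (tnth a j)%:R * trt_dot a psi + 2 * B.
have qE : (\int[P]_z (q (trtA z))%:E = (cond_mean P (shifted_cross j) tt)%:E)%E.
  by rewrite -(cond_meanE (h := shifted_cross j) P (measurable_shifted_cross j)
    (shifted_cross_range j)).
have img a : P.-integrable [set: obs R d k] (fun z => (mu a (covX z) - psi0)%:E).
  exact: (integrableB measurableT (integrable_mu a)
    (finite_measure_integrable_cst P psi0 measurableT)).
pose t a z : R := (tnth a j)%:R * f a z + w a * (mu a (covX z) - psi0).
have ita a : P.-integrable [set: obs R d k] (fun z => ((tnth a j)%:R%:E * (f a z)%:E)%E).
  by apply: integrableZl => //; exact: (fP a).1.
have itb a : P.-integrable [set: obs R d k]
    (fun z => ((w a)%:E * (mu a (covX z) - psi0)%:E)%E).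
  by apply: integrableZl.
have it a : P.-integrable [set: obs R d k] (fun z => (t a z)%:E).
  exact: (integrableD measurableT (ita a) (itb a)).
have tE a : (\int[P]_z (t a z)%:E = ((tnth a j)%:R * b a + w a * trt_dot a psi)%:E)%E.
  rewrite /t; under eq_integral do rewrite EFinD !(EFinM (_%:R)) (EFinM (w a)).
  rewrite integralD // integralZl ?(fP a).1 // integralZl //.
  by rewrite bE msm_dot -!EFinM -EFinD.
have iq : P.-integrable [set: obs R d k] (fun z => (q (trtA z))%:E).
  exact: (integrable_trtA P q).
have isum : P.-integrable [set: obs R d k] (fun z => (\sum_(a : treatment k) (t a z)%:E)%E).
  exact: integrable_sum.
have icst := finite_measure_integrable_cst P (2 * B + M) measurableT.
have isq := integrableB measurableT isum iq.
have meanE : (\int[P]_z (shifted_score j (D, z))%:E =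
   ((\sum_(a : treatment k) ((tnth a j)%:R * b a + w a * trt_dot a psi)) -
     cond_mean P (shifted_cross j) tt + (2 * B + M))%:E)%E.
  transitivity (\int[P]_z ((\sum_(a : treatment k) (t a z)%:E) -
      (q (trtA z))%:E + (2 * B + M)%:E))%E.
    apply: ae_eq_integral => //.
    - apply/measurable_EFinP; apply: (measurableT_comp (measurable_shifted_score j)).
      exact: measurable_fun_pair.
    - exact: measurable_int (integrableD measurableT isq icst).
    - apply: filterS D_regular => z Dz _.
      rewrite sumEFin -EFinB -EFinD; congr EFin.
      rewrite /shifted_score clip_id; last first.
        by apply: score_le => //; exact: trt_dot_psi_le.
      have -> : \sum_(a : treatment k) t a z = aipw_score psi0 muhat pihat D z j.
        by apply: eq_bigr => a _; rewrite /t /f /w; ring.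
      by rewrite /score /q /=; ring.
  rewrite integralD // integralB // qE integral_sum //.
  rewrite integral_cst //= probability_setT mule1.
  under eq_bigr do rewrite tE.
  by rewrite sumEFin -EFinB -EFinD.
move: meanE; rewrite (cond_meanE (h := shifted_score j) P (measurable_shifted_score j)
  (shifted_score_range j)).
move=> [->].
rewrite big_split /=.
have -> : \sum_a w a * trt_dot a psi = gram_vec (sample_trt D) psi j.
  rewrite /gram_vec -(sum_trt_freq D (fun a => (tnth a j)%:R * trt_dot a psi)).
  by apply: eq_bigr => a _; rewrite /w mulrAC.
have -> : forall x g c : R, x + g - c + (2 * B + M) - M - (g + 2 * B - c) = x by move=> *; ring.
apply: (le_trans (ler_norm_sum _ _ _)).
apply: (@le_trans _ _ (\sum_a trt_freq D a * (delta * eps))).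
  apply: ler_sum => a _; rewrite normrM; apply: le_trans (b_le a).
  by rewrite ler_piMl // normr_nat lern1 leq_b1.
by rewrite -mulr_suml sum_trt_freq1 // mul1r.
Qed.

End ScoreBias.

(** * The deterministic bound and the arithmetic of the bad event *)

Section GoodEvent.
Context (R : realType) (k n : nat) (G : 'M[R]_k) (x : 'I_n -> treatment k)
  (bh : 'I_k -> R) (psi b : 'cV[R]_k) (s : nat) (D eta2 : R).

Lemma quad_formZ (M : 'M[R]_k) c v : quad_form M (c *: v) = c ^+ 2 * quad_form M v.
Proof.
rewrite !quad_formE mulr_sumr; apply: eq_bigr => i _; rewrite mulr_sumr.
by apply: eq_bigr => j _; rewrite !mxE; ring.
Qed.

Lemma norm2Z c (v : 'cV[R]_k) : norm2 (c *: v) = `|c| * norm2 v.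
Proof.
rewrite /norm2 (_ : \sum_j _ = c ^+ 2 * \sum_j v j 0 ^+ 2).
  by rewrite sqrtrM ?sqr_ge0 // sqrtr_sqr.
by rewrite mulr_sumr; apply: eq_bigr => j _; rewrite mxE exprMn.
Qed.

Lemma norm1Z c (v : 'cV[R]_k) : norm1 (c *: v) = `|c| * norm1 v.
Proof. by rewrite /norm1 mulr_sumr; apply: eq_bigr => j _; rewrite mxE normrM. Qed.

(** Both sides are homogeneous of degree 2. *)
Lemma unit_cone_scale (M : 'M[R]_k) (e : R) :
  (ereal_sup [set (Num.norm (quad_form M v))%:E | v in
     [set v : 'cV[R]_k | norm2 v = 1 /\ norm1 v <= 2 * Num.sqrt s%:R]]%R <= e%:E)%E ->
  forall v, norm1 v <= 2 * Num.sqrt s%:R * norm2 v -> `|quad_form M v| <= e * norm2 v ^+ 2.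
Proof.
move=> hs v cone.
have [v0|v0] := eqVneq (norm2 v) 0.
  by rewrite v0 (norm2_eq0 v0) -[0 : 'cV_k](scale0r 0) quad_formZ !expr0n !mul0r mulr0 normr0.
have vp : 0 < norm2 v by rewrite lt_def v0 norm2_ge0.
pose c := (norm2 v)^-1; have c0 : 0 < c by rewrite invr_gt0.
have vE : v = norm2 v *: (c *: v) by rewrite scalerA divff // scale1r.
have : `|quad_form M (c *: v)| <= e.
  rewrite -lee_fin; apply: le_trans hs; apply: ereal_sup_ubound.
  exists (c *: v) => //; split.
    by rewrite norm2Z gtr0_norm // mulVf.
  by rewrite norm1Z gtr0_norm // mulrC ler_pdivrMr.
rewrite quad_formZ normrM ger0_norm ?sqr_ge0 // /c exprVn ler_pdivrMl ?exprn_gt0 //.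
by rewrite mulrC.
Qed.

Hypothesis D_gt0 : 0 < D.
Hypothesis G_ge : forall v : 'cV[R]_k, v != 0 -> D * norm2 v ^+ 2 <= quad_form G v.
Hypothesis near : forall v, norm1 v <= 2 * Num.sqrt s%:R * norm2 v ->
  `|quad_form G v - gram x v| <= D / 2 * norm2 v ^+ 2.

Lemma gram_ge v : norm1 v <= 2 * Num.sqrt s%:R * norm2 v ->
  D / 2 * norm2 v ^+ 2 <= gram x v.
Proof.
move=> /near; have [->|v0] := eqVneq v 0.
  move=> _; rewrite (_ : norm2 _ = 0) ?expr0n ?mulr0 ?gram_ge0 //.
  by rewrite -[0 : 'cV_k](scale0r 0) norm2Z normr0 mul0r.
by have := G_ge v0; rewrite ler_norml => ? /andP[? ?]; lra.
Qed.

(** On the cone, [D / 2 * |v|_2 ^ 2 <= gram v <= 4 * eta * sqrt s * |v|_2] for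
    [v = b - psi], which bounds [|v|_2], and [quad_form G v <= 2 * gram v]. *)
Lemma good_event_bound :
  norm1 (b - psi) <= 2 * Num.sqrt s%:R * norm2 (b - psi) ->
  risk x bh b <= risk x bh psi ->
  (forall j, (bh j - gram_vec x psi j) ^+ 2 <= eta2) -> 0 <= eta2 ->
  quad_form G (b - psi) <= 64 / D * s%:R * eta2.
Proof.
move=> cone rb eta_le eta0; pose eta := Num.sqrt eta2.
have eta_ge0 : 0 <= eta by exact: sqrtr_ge0.
have etaE : eta ^+ 2 = eta2 by rewrite sqr_sqrtr.
have bi : gram x (b - psi) <= 2 * eta * norm1 (b - psi).
  apply: basic_inequality rb _ => j.
  by rewrite -ler_sqr ?nnegrE // real_normK ?num_real // etaE.
have g := gram_ge cone; move: (near cone); rewrite ler_norml => /andP[_ up].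
pose r := Num.sqrt s%:R : R; have r2 : r ^+ 2 = s%:R by rewrite sqr_sqrtr.
have r0 : 0 <= r by exact: sqrtr_ge0.
set N := norm2 (b - psi) in cone g up *; have N0 : 0 <= N by exact: norm2_ge0.
have q : gram x (b - psi) <= 4 * eta * r * N.
  apply: (le_trans bi); rewrite -/r in cone.
  have -> : 4 * eta * r * N = 2 * eta * (2 * r * N) by ring.
  by rewrite ler_wpM2l // mulr_ge0.
have N_le : D * N <= 8 * eta * r.
  have [->|Nn0] := eqVneq N 0; first by rewrite mulr0 !mulr_ge0.
  have Np : 0 < N by rewrite lt_def Nn0.
  rewrite -(ler_pM2r Np); move: (le_trans g q); rewrite expr2; lra.
have -> : 64 / D * s%:R * eta2 = 8 * eta * r * (8 * eta * r) / D.
  by rewrite -etaE -r2; field; rewrite gt_eqF.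
rewrite ler_pdivlMr //.
have : quad_form G (b - psi) <= 8 * eta * r * N by move: up; rewrite lerBlDr => up; lra.
move=> /(ler_wpM2r (ltW D_gt0)) h; apply: (le_trans h).
have -> : 8 * eta * r * N * D = 8 * eta * r * (D * N) by ring.
by rewrite ler_wpM2l // !mulr_ge0.
Qed.

End GoodEvent.

Section LogBounds.
Context (R : realType).

Lemma ln_le_id (y : R) : 0 < y -> ln y <= y.
Proof.
move=> y0; have := expR_ge1Dx (ln y); rewrite lnK ?posrE //; lra.
Qed.

(** With [q = n ^ (1/4)] the assumption gives [s <= kap * q], so the logarithm of the
    left-hand factors, of order [s * ln n + ln k], is at most a small multiple of
    [q ^ 2], while the exponent is of order [n / s ^ 2 >= q ^ 2 / kap ^ 2]. *)
Lemma exponential_beats_cramer (D kap : R) (n k s : nat) :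
  0 < D -> 0 < kap -> kap <= 1 -> 32 * 32 * 32 * kap <= D ^+ 2 ->
  (0 < n)%N -> (1 < k)%N -> (0 < s)%N ->
  s%:R ^+ 4 * ln k%:R <= ln 2 * kap ^+ 4 * n%:R ->
  (s * n)%:R ^+ (2 * (s + 2)) * k%:R ^+ 2 *
    expR (- (n%:R * (D / (8 * s%:R)) ^+ 2 / (8 * 1 ^+ 2))) <= n%:R^-1.
Proof.
move=> D0 kap0 kap1 kapD n0 k1 s0 hs.
have nR : 1 <= n%:R :> R by rewrite ler1n.
have sR : 1 <= s%:R :> R by rewrite ler1n.
have kR : 2 <= k%:R :> R by rewrite ler_nat.
have lnk : ln 2 <= ln k%:R :> R by rewrite ler_ln ?posrE //; lra.
have ln2 : 1 / 2 <= ln 2 :> R by exact: (@ln_ge_half R 2).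
have ln2' : ln 2 <= 1 :> R by have := @expR_ge1Dx R 1; rewrite -ler_expR lnK ?posrE //; lra.
pose q : R := Num.sqrt (Num.sqrt n%:R).
have q0 : 0 <= q by exact: sqrtr_ge0.
have q2 : q ^+ 2 = Num.sqrt n%:R by rewrite sqr_sqrtr // sqrtr_ge0.
have q4 : q ^+ 4 = n%:R by rewrite (exprM q 2 2) q2 sqr_sqrtr.
have q1 : 1 <= q by rewrite -(@ler_pXn2r _ 4) ?nnegrE // expr1n q4.
have s4 : s%:R ^+ 4 <= (kap * q) ^+ 4.
  rewrite exprMn q4 -(ler_pM2r (x := ln 2)); last lra.
  have -> : kap ^+ 4 * n%:R * ln 2 = ln 2 * kap ^+ 4 * n%:R by ring.
  by apply: le_trans hs; rewrite ler_wpM2l // exprn_ge0.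
have sq : s%:R <= kap * q.
  by rewrite -(@ler_pXn2r _ 4) ?nnegrE // mulr_ge0 // ltW.
pose v : R := n%:R / s%:R ^+ 2.
have s2 : 0 < s%:R ^+ 2 :> R by rewrite exprn_gt0 // (lt_le_trans _ sR).
have qv : q ^+ 2 <= v.
  rewrite /v ler_pdivlMr // -q4 (exprD q 2 2) ler_wpM2l ?sqr_ge0 //.
  rewrite lerXn2r ?nnegrE // (le_trans sq) // ler_piMl //.
have ss : 1 <= s%:R ^+ 2 :> R by rewrite exprn_ege1.
have lnkv : ln k%:R <= kap * v.
  rewrite /v mulrA ler_pdivlMr //; apply: (@le_trans _ _ (s%:R ^+ 4 * ln k%:R)).
    rewrite mulrC ler_wpM2r //; first lra.
    by rewrite (exprD _ 2 2) ler_peMr // ltW.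
  apply: (le_trans hs); rewrite ler_wpM2r // (exprS kap 3) mulrCA.
  rewrite ler_piMr ?(ltW kap0) // -[leRHS]mulr1 ler_pM ?exprn_ge0 ?(ltW kap0) //; first lra.
  by rewrite exprn_ile1 // ltW.
have sn : s%:R <= n%:R :> R.
  apply: (le_trans sq); apply: (@le_trans _ _ q); first by rewrite ler_piMl.
  by rewrite -q4 exprS ler_peMr // exprn_ege1.
have lnn : ln n%:R <= 4 * q.
  rewrite -q4 lnXn; last lra.
  by rewrite -[ln q *+ 4]mulr_natl ler_wpM2l // ln_le_id //; lra.
pose X : R := (s * n)%:R ^+ (2 * (s + 2)) * k%:R ^+ 2 * n%:R.
have X0 : 0 < X.
  by rewrite /X !mulr_gt0 ?exprn_gt0 ?ltr0n ?muln_gt0 ?s0 ?n0 ?(ltn_trans _ k1).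
suff lnX : ln X <= n%:R * (D / (8 * s%:R)) ^+ 2 / (8 * 1 ^+ 2).
  rewrite -[leRHS]mul1r ler_pdivlMr; last lra.
  rewrite mulrAC -/X -ler_pdivlMr ?expR_gt0 // mul1r -expRN opprK.
  by rewrite -[leLHS]lnK ?posrE // ler_expR.
have -> : n%:R * (D / (8 * s%:R)) ^+ 2 / (8 * 1 ^+ 2) = D ^+ 2 / (8 * 64) * v.
  by rewrite /v; field; lra.
have lnn0 : 0 <= ln n%:R :> R by rewrite ln_ge0.
have -> : ln X = (2 * (s + 2))%:R * (ln s%:R + ln n%:R) + 2 * ln k%:R + ln n%:R.
  have sp : 0 < s%:R :> R by lra.
  have np : 0 < n%:R :> R by lra.
  have kp : 0 < k%:R :> R by lra.
  have snp : 0 < (s * n)%:R :> R by rewrite natrM mulr_gt0.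
  rewrite /X lnM ?posrE ?mulr_gt0 ?exprn_gt0 // lnM ?posrE ?exprn_gt0 //.
  have lsn : ln (s * n)%:R = ln s%:R + ln n%:R :> R by rewrite natrM lnM ?posrE.
  rewrite !lnXn // lsn -[(_ + _) *+ (2 * _)]mulr_natl -[ln k%:R *+ 2]mulr_natl.
  by [].
have lns : ln s%:R <= ln n%:R :> R by rewrite ler_ln ?posrE //; lra.
have h1 : (2 * (s + 2))%:R * (ln s%:R + ln n%:R) <= 6 * s%:R * (2 * ln n%:R) :> R.
  apply: ler_pM => //; [by rewrite addr_ge0 // ln_ge0| |lra].
  by rewrite natrM natrD; lra.
have h2 : ln n%:R <= s%:R * ln n%:R :> R by rewrite ler_peMl.
have h3 : s%:R * ln n%:R <= kap * q * (4 * q) by apply: ler_pM.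
have h4 : kap * q * (4 * q) = 4 * (kap * q ^+ 2) by ring.
have h5 : kap * q ^+ 2 <= kap * v by rewrite ler_pM2l.
have v0 : 0 <= v by apply: le_trans qv; exact: sqr_ge0.
have h6 : 54 * (kap * v) <= D ^+ 2 / (8 * 64) * v.
  by rewrite mulrA ler_wpM2r //; lra.
have h7 : 6 * s%:R * (2 * ln n%:R) = 12 * (s%:R * ln n%:R) :> R by ring.
lra.
Qed.

End LogBounds.

(** * The two estimators under sample splitting *)

Section SampleSplitting.
Context (R : realType) (B D : R) (n k s d : nat) (d0 : measure_display)
  (Omega : measurableType d0) (Pr : probability Omega R) (P : probability (obs R d k) R)
  (D1 D2 : 'I_n -> Omega -> obs R d k) (Z0 : Omega -> obs R d k)
  (pi mu : treatment k -> d.-tuple R -> R) (pihat muhat : nuisance R d k n)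
  (psi0 : R) (psi : 'cV[R]_k) (delta eps : R).
Hypothesis B_gt0 : 0 < B.
Hypothesis D_gt0 : 0 < D.
Hypothesis n_gt0 : (0 < n)%N.
Hypothesis k_gt1 : (1 < k)%N.
Hypothesis iid : iid_samples Pr P D1 D2 Z0.
Hypothesis propP : is_propensity P pi.
Hypothesis pi_gt0 : {ae P, forall z : obs R d k, forall a : treatment k, 0 < pi a (covX z)}.
Hypothesis regP : is_regression P mu.
Hypothesis mpihat : nuisance_measurable pihat.
Hypothesis mmuhat : nuisance_measurable muhat.
Hypothesis msm : forall a : treatment k,
  (\int[P]_z (mu a (covX z))%:E)%E = (psi0 + \sum_(j < k) psi j 0 * (tnth a j)%:R)%:E.
Hypothesis psi_sparse : (norm0 psi <= s)%N.
Hypothesis G_ge : forall v : 'cV[R]_k, v != 0 ->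
  D * norm2 v ^+ 2 <= quad_form (second_moment P) v.
Hypothesis psi0_le : `|psi0| <= B.
Hypothesis ae_regular : {ae Pr, forall w, regular B muhat pihat (dataset D1 w) (Z0 w)}.
Hypothesis ae_close : {ae Pr, forall w : Omega, forall a : treatment k,
  (Lnorm P 2%:E (fun z : obs R d k =>
         (pi a (covX z) / pihat (dataset D1 w) a (covX z) - 1)%:E) <= delta%:E)%E /\
  (Lnorm P 2%:E (fun z : obs R d k =>
         (mu a (covX z) - muhat (dataset D1 w) a (covX z))%:E) <= eps%:E)%E}.

Local Notation F := (joint_family D1 D2 Z0).
Local Notation G := (second_moment P).

Let lawF i : has_law Pr (F i) P. Proof. exact: iid.1. Qed.
Let mF i : measurable_fun [set: Omega] (F i). Proof. by have [] := lawF i. Qed.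
Let indF : mutually_independent Pr F. Proof. exact: iid.2. Qed.

Let D1_avoids i0 : (forall i, Some (inl i) != i0) -> avoids F i0 (dataset D1).
Proof. move=> h; exact: (tuple_avoids (f := fun i => Some (inl i)) h). Qed.

Let D2_avoids i0 : (forall i, Some (inr i) != i0) -> avoids F i0 (dataset D2).
Proof. move=> h; exact: (tuple_avoids (f := fun i => Some (inr i)) h). Qed.

Let D1_avoids_Z0 : avoids F None (dataset D1). Proof. exact: D1_avoids. Qed.

Let D1_avoids_D2 i : avoids F (Some (inr i)) (dataset D1). Proof. exact: D1_avoids. Qed.

Let D1_regular : {ae Pr, forall w, {ae P, forall z, regular B muhat pihat (dataset D1 w) z}}.
Proof.
exact: (ae_ae (@mF) indF (measurable_regular B mpihat mmuhat) (lawF None) (@D1_avoids_Z0) _).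
Qed.

Let D2_regular : {ae Pr, forall w, forall i, regular B muhat pihat (dataset D1 w) (D2 i w)}.
Proof.
apply: filter_forall => i.
exact: (ae_transfer (@mF) indF (measurable_regular B mpihat mmuhat) (lawF None) (@D1_avoids_Z0)
  (lawF (Some (inr i))) (@D1_avoids_D2 i) _).
Qed.

Let Y_le : {ae P, forall z : obs R d k, `|outY z| <= B}.
Proof.
have FF : ProperFilter (almost_everywhere Pr).
  by apply: ae_properfilter_algebraOfSetsType; rewrite /= probability_setT.
have [w h] := @filter_ex _ _ FF _ D1_regular.
by apply: filterS h => z [].
Qed.

Let psi_le a : `|trt_dot a psi| <= 2 * B.
Proof. exact: (trt_dot_psi_le B_gt0 psi0_le propP pi_gt0 regP Y_le msm). Qed.

(** The fresh observation is independent of the two samples and can be integrated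
    out first. *)
Lemma fresh_copy (psihat : n.-tuple (obs R d k) -> n.-tuple (obs R d k) -> 'cV[R]_k) :
  psi_measurable psihat ->
  ('E_Pr[fun w => (trt_dot (trtA (Z0 w))
      (psihat (dataset D1 w) (dataset D2 w) - psi) ^+ 2)%R] =
   \int[Pr]_w (quad_form G (psihat (dataset D1 w) (dataset D2 w) - psi))%:E)%E.
Proof.
move=> mpsi; rewrite unlock.
pose U w := (dataset D1 w, dataset D2 w).
pose h (x : n.-tuple (obs R d k) * n.-tuple (obs R d k) * obs R d k) :=
  (trt_dot (trtA x.2) (psihat x.1.1 x.1.2 - psi) ^+ 2)%:E.
have aU : avoids F None U.
  by apply: measurable_fun_pair; [exact: D1_avoids|exact: D2_avoids].
have mh : measurable_fun [set: (n.-tuple (obs R d k) * n.-tuple (obs R d k) * obs R d k)%type] h.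
  apply/measurable_EFinP; apply: measurable_funX; apply: measurable_sum => j.
  apply: measurable_funM.
    exact: (measurableT_comp (measurable_fun_trtA (fun a => (tnth a j)%:R : R)) measurable_snd).
  under eq_fun do rewrite !mxE.
  by apply: measurable_funB => //; exact: (measurableT_comp (mpsi j) measurable_fst).
have h0 x : (0 <= h x)%E by rewrite lee_fin sqr_ge0.
transitivity (\int[Pr]_w h (U w, F None w))%E; first by [].
rewrite (indep_tonelli (@mF) indF (lawF None) aU mh h0).
by apply: eq_integral => w _; rewrite -integral_trt_dot_sqr.
Qed.

Let M : R := 2 * B ^+ 2 + 4 * B.

Let M_gt0 : 0 < M.
Proof. by rewrite /M addr_gt0 ?mulr_gt0 ?exprn_gt0. Qed.

Let average_cst (c : R) : n%:R^-1 * \sum_(i < n) c = c.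
Proof.
by rewrite sumr_const card_ord -[c *+ n]mulr_natl mulrA mulVf ?mul1r // pnatr_eq0 -lt0n.
Qed.

Let average_le (a : 'I_n -> R) (c : R) : (forall i, `|a i| <= c) ->
  `|n%:R^-1 * \sum_(i < n) a i| <= c.
Proof.
move=> ac; rewrite normrM ger0_norm ?invr_ge0 // -[leRHS]average_cst ler_wpM2l ?invr_ge0 //.
by apply: (le_trans (ler_norm_sum _ _ _)); exact: ler_sum.
Qed.

(** The deviation is the sum of a centered average over each sample and of the
    bias; [Q1] and [Q2] dominate the squares of the averages. *)
Lemma score_deviation : exists Q1 Q2 : Omega -> R, [/\
    measurable_fun [set: Omega] Q1 /\ measurable_fun [set: Omega] Q2,
    (forall w, 0 <= Q1 w) /\ (forall w, 0 <= Q2 w),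
    (\int[Pr]_w (Q1 w)%:E <= (32 * (4 * B) ^+ 2 * (ln k%:R / n%:R))%:E)%E,
    (\int[Pr]_w (Q2 w)%:E <= (32 * (2 * M) ^+ 2 * (ln k%:R / n%:R))%:E)%E &
    {ae Pr, forall w, forall j,
      (aipw_mean psi0 muhat pihat (dataset D1 w) (dataset D2 w) j -
        gram_vec (sample_trt (dataset D2 w)) psi j) ^+ 2 <=
      3 * (delta * eps) ^+ 2 + 3 * Q1 w + 3 * Q2 w}].
Proof.
have ck : #|'I_k| = k by exact: card_ord.
have inl_inj : injective (fun i : 'I_n => Some (inl i) : option ('I_n + 'I_n)).
  by move=> i j [].
have inr_inj : injective (fun i : 'I_n => Some (inr i) : option ('I_n + 'I_n)).
  by move=> i j [].
have B4 : 0 < 4 * B by rewrite mulr_gt0.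
have M2 : 0 < 2 * M by rewrite mulr_gt0.
have [Q1 [mQ1 Q10 Q1m Q1i]] := sample_mean_max_sqr (@mF) lawF indF n_gt0 inl_inj
  (fun i => @cst_avoids _ _ _ _ _ F _ _ tt (Some (inl i)))
  (fun j => measurable_shifted_cross B psi j) B4
  (shifted_cross_range B_gt0 psi0_le propP pi_gt0 regP Y_le msm) ck k_gt1.
have [Q2 [mQ2 Q20 Q2m Q2i]] := sample_mean_max_sqr (@mF) lawF indF n_gt0 inr_inj
  (@D1_avoids_D2) (fun j => measurable_shifted_score psi0 B psi mpihat mmuhat j) M2
  (shifted_score_range psi0 muhat pihat psi B_gt0) ck k_gt1.
exists Q1, Q2; split => //.
apply: filterS3 D1_regular D2_regular ae_close => w r1 r2 cl j.
have cl1 a := (cl a).1; have cl2 a := (cl a).2.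
have bias := score_bias n_gt0 B_gt0 psi0_le propP pi_gt0 regP Y_le mpihat mmuhat msm r1 cl1 cl2 j.
have sd i : tnth (dataset D1 w) i = D1 i w by rewrite tnth_mktuple.
have sd2 i : tnth (dataset D2 w) i = D2 i w by rewrite tnth_mktuple.
set X := aipw_mean _ _ _ _ _ _ - _.
set cm2 := cond_mean P (shifted_score psi0 B muhat pihat psi j) (dataset D1 w) in bias.
set cm1 := cond_mean P (shifted_cross B psi j) tt in bias.
have e2 : n%:R^-1 * \sum_i centered P (shifted_score psi0 B muhat pihat psi j)
    (dataset D1 w, D2 i w) = X + M - cm2.
  rewrite /X -score_mean -[in RHS](average_cst cm2) -[in RHS](average_cst M) -mulrDr -mulrBr.
  congr (_ * _); rewrite -big_split -sumrB; apply: eq_bigr => i _ /=.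
  rewrite sd2 /centered /shifted_score clip_id //=.
  exact: (score_le n_gt0 psi0_le psi_le _ (r2 i)).
have e1 : n%:R^-1 * \sum_i centered P (shifted_cross B psi j) (tt, D1 i w) =
    gram_vec (sample_trt (dataset D1 w)) psi j + 2 * B - cm1.
  rewrite /gram_vec -[in RHS](average_cst cm1) -[in RHS](average_cst (2 * B)) -mulrDr -mulrBr.
  congr (_ * _); rewrite -big_split -sumrB; apply: eq_bigr => i _ /=.
  by rewrite /sample_trt sd.
have q1 : (gram_vec (sample_trt (dataset D1 w)) psi j + 2 * B - cm1) ^+ 2 <= Q1 w.
  by rewrite -e1; exact: Q1m.
have q2 : (X + M - cm2) ^+ 2 <= Q2 w by rewrite -e2; exact: Q2m.
set S1 := gram_vec _ _ _ + 2 * B - cm1 in bias q1.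
set S2 := X + M - cm2 in q2.
set b := cm2 - _ - S1 in bias.
have b2 : b ^+ 2 <= (delta * eps) ^+ 2.
  by rewrite -[b ^+ 2]real_normK ?num_real // lerXn2r // nnegrE // (le_trans _ bias).
have -> : X = b + S1 + S2 by rewrite /b /S2 /M; ring.
have sq : (b + S1 + S2) ^+ 2 <= 3 * b ^+ 2 + 3 * S1 ^+ 2 + 3 * S2 ^+ 2.
  rewrite -subr_ge0.
  have -> : 3 * b ^+ 2 + 3 * S1 ^+ 2 + 3 * S2 ^+ 2 - (b + S1 + S2) ^+ 2 =
    (b - S1) ^+ 2 + (b - S2) ^+ 2 + (S1 - S2) ^+ 2 by ring.
  by rewrite !addr_ge0 ?sqr_ge0.
by apply: (le_trans sq); rewrite !lerD // ler_wpM2l.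
Qed.

Lemma aipw_mean_le : {ae Pr, forall w, forall j,
  `|aipw_mean psi0 muhat pihat (dataset D1 w) (dataset D2 w) j| <= M + 2 * B}.
Proof.
apply: filterS D2_regular => w r j.
have := score_mean psi0 muhat pihat psi (dataset D1 w) (dataset D2 w) j.
move/eqP; rewrite eq_sym subr_eq => /eqP ->; apply: (le_trans (ler_normD _ _)); apply: lerD.
  apply: average_le => i; rewrite tnth_mktuple.
  exact: (score_le n_gt0 psi0_le psi_le _ (r i)).
apply: average_le => i; rewrite normrM -[leRHS]mul1r; apply: ler_pM => //.
by rewrite normr_nat lern1 leq_b1.
Qed.

Lemma sqr_norm1_psi : norm1 psi ^+ 2 <= s%:R * (4 * B ^+ 2 / D).
Proof.
have q : quad_form G psi <= 4 * B ^+ 2.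
  rewrite -lee_fin -integral_trt_dot_sqr.
  apply: (@le_trans _ _ (\int[P]_z (4 * B ^+ 2)%:E)%E).
    apply: ge0_le_integral => //.
    - by move=> z _; rewrite lee_fin sqr_ge0.
    - apply/measurable_EFinP.
      exact: (measurable_fun_trtA (fun a => trt_dot a psi ^+ 2 : R)).
    - move=> z _; rewrite lee_fin -real_normK ?num_real //.
      have -> : 4 * B ^+ 2 = (2 * B) ^+ 2 by ring.
      by rewrite lerXn2r // nnegrE mulr_ge0 // ltW.
  by rewrite integral_cst //= probability_setT mule1.
have n2 : norm2 psi ^+ 2 <= 4 * B ^+ 2 / D.
  rewrite ler_pdivlMr // mulrC; have [->|p0] := eqVneq psi 0.
    rewrite -[0 : 'cV_k](scale0r 0) norm2Z normr0 mul0r expr0n mulr0.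
    by rewrite mulr_ge0 ?sqr_ge0.
  exact: le_trans (G_ge p0) q.
apply: (@le_trans _ _ (s%:R * norm2 psi ^+ 2)); last by rewrite ler_wpM2l.
have := norm1_le_norm2 psi_sparse => h.
have -> : s%:R * norm2 psi ^+ 2 = (Num.sqrt s%:R * norm2 psi) ^+ 2.
  by rewrite exprMn [Num.sqrt s%:R ^+ 2]sqr_sqrtr ?ler0n.
by rewrite lerXn2r // nnegrE ?norm1_ge0 ?mulr_ge0 ?sqrtr_ge0 ?norm2_ge0.
Qed.

Lemma quad_form_le_norm1 (v : 'cV[R]_k) : quad_form G v <= norm1 v ^+ 2.
Proof.
rewrite -lee_fin -integral_trt_dot_sqr.
apply: (@le_trans _ _ (\int[P]_z (norm1 v ^+ 2)%:E)%E).
  apply: ge0_le_integral => //.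
  - by move=> z _; rewrite lee_fin sqr_ge0.
  - apply/measurable_EFinP.
    exact: (measurable_fun_trtA (fun a => trt_dot a v ^+ 2 : R)).
  - move=> z _; rewrite lee_fin -real_normK ?num_real //.
    by rewrite lerXn2r ?nnegrE ?norm1_ge0 // trt_dot_le_norm1.
by rewrite integral_cst //= probability_setT mule1.
Qed.

(** The event of the restricted isometry assumption, in homogeneous form. *)
Definition gram_near (w : Omega) : Prop := forall v : 'cV[R]_k,
  norm1 v <= 2 * Num.sqrt s%:R * norm2 v ->
  `|quad_form G v - gram (sample_trt (dataset D2 w)) v| <= D / 2 * norm2 v ^+ 2.

Lemma lasso_risk_le w b eta2 :
  selected Lasso psi s (emp_risk psi0 muhat pihat (dataset D1 w) (dataset D2 w)) b ->
  (forall j, (aipw_mean psi0 muhat pihat (dataset D1 w) (dataset D2 w) j -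
        gram_vec (sample_trt (dataset D2 w)) psi j) ^+ 2 <= eta2) -> 0 <= eta2 ->
  gram_near w -> quad_form G (b - psi) <= 64 / D * s%:R * eta2.
Proof.
move=> [/= b1 bmin] e e0 near; apply: (good_event_bound D_gt0 G_ge near) e e0.
  exact: lasso_cone.
by rewrite -!emp_riskE; apply: bmin.
Qed.

(** The constraint gives [|b - psi|_1 <= 2 * |psi|_1], and [|psi|_2 ^ 2] is at most
    [4 * B ^ 2 / D] because [|a^T psi| <= 2 * B] for all [a]. *)
Lemma lasso_crude_bound w b :
  selected Lasso psi s (emp_risk psi0 muhat pihat (dataset D1 w) (dataset D2 w)) b ->
  quad_form G (b - psi) <= s%:R * (16 * B ^+ 2 / D).
Proof.
move=> [/= b1 bmin]; apply: (le_trans (quad_form_le_norm1 _)).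
have h : norm1 (b - psi) <= 2 * norm1 psi.
  by apply: (le_trans (norm1D _ _)); rewrite norm1N mulr_natl mulr2n lerD2r.
apply: (@le_trans _ _ ((2 * norm1 psi) ^+ 2)).
  by rewrite lerXn2r // nnegrE ?mulr_ge0 ?norm1_ge0.
have -> : (2 * norm1 psi) ^+ 2 = 4 * norm1 psi ^+ 2 by ring.
have -> : s%:R * (16 * B ^+ 2 / D) = 4 * (s%:R * (4 * B ^+ 2 / D)) by ring.
by have h1 := sqr_norm1_psi; rewrite ler_wpM2l.
Qed.

(** On this event the Gram form is definite on sparse vectors, so minimisers exist
    and the estimator is one of them. *)
Lemma subset_risk_le w b eta2 :
  selected BestSubset psi s (emp_risk psi0 muhat pihat (dataset D1 w) (dataset D2 w)) b ->
  (forall j, (aipw_mean psi0 muhat pihat (dataset D1 w) (dataset D2 w) j -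
        gram_vec (sample_trt (dataset D2 w)) psi j) ^+ 2 <= eta2) -> 0 <= eta2 ->
  gram_near w -> quad_form G (b - psi) <= 64 / D * s%:R * eta2.
Proof.
move=> sel e e0 near.
have riskE := funext (fun b' => emp_riskE psi0 muhat pihat (dataset D1 w) (dataset D2 w) b').
have [bs rb] : (norm0 b <= s)%N /\ risk (sample_trt (dataset D2 w))
    (aipw_mean psi0 muhat pihat (dataset D1 w) (dataset D2 w)) b <=
    risk (sample_trt (dataset D2 w))
    (aipw_mean psi0 muhat pihat (dataset D1 w) (dataset D2 w)) psi.
  case: sel => [[[/= bs bmin] _]|[/= M0 _]].
    by split => //; rewrite -!emp_riskE; exact: bmin.
  exfalso; have [] := best_subset_exists (x := sample_trt (dataset D2 w))
    (aipw_mean psi0 muhat pihat (dataset D1 w) (dataset D2 w)) (s := s) n_gt0.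
    move=> v vs gv; apply/norm2_eq0/eqP.
    have : D / 2 * norm2 v ^+ 2 <= 0.
      rewrite -gv; apply: (gram_ge G_ge near).
      apply: (le_trans (norm1_le_norm2 vs)).
      by rewrite -mulrA ler_peMl // ?mulr_ge0 ?sqrtr_ge0 ?norm2_ge0 // ler1n.
    rewrite pmulr_rle0 ?divr_gt0 // => h.
    by rewrite -sqrf_eq0 eq_le h sqr_ge0.
  by move=> b'; rewrite -riskE /sparse M0.
apply: (good_event_bound D_gt0 G_ge near) rb e e0.
exact: sparse_cone.
Qed.

(** Cramer's bound for the estimator, whatever the Gram matrix of the second sample. *)
Lemma subset_crude_bound w b :
  selected BestSubset psi s (emp_risk psi0 muhat pihat (dataset D1 w) (dataset D2 w)) b ->
  (forall j, `|aipw_mean psi0 muhat pihat (dataset D1 w) (dataset D2 w) j| <= M + 2 * B) ->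
  quad_form G (b - psi) <=
    s%:R * ((s * n)%:R ^+ (2 * (s + 2)) * (8 * B ^+ 2 / D + 2 * (M + 2 * B) ^+ 2)).
Proof.
move=> sel bh_le.
have MB : 0 <= M + 2 * B by rewrite addr_ge0 ?mulr_ge0 // ltW.
have riskE : emp_risk psi0 muhat pihat (dataset D1 w) (dataset D2 w) =
    risk (sample_trt (dataset D2 w)) (aipw_mean psi0 muhat pihat (dataset D1 w) (dataset D2 w)).
  by apply/funext => b'; exact: emp_riskE.
have n0 : norm2 (0 : 'cV[R]_k) = 0.
  by rewrite -[0 : 'cV_k](scale0r 0) norm2Z normr0 mul0r.
have [bs bn] : (norm0 b <= s)%N /\
    ((0 < s)%N -> norm2 b <= (s * n)%:R ^+ (s + 2) * (M + 2 * B)).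
  case: sel => [[Mb inf]|[_ ->]].
    split=> [|s0]; first by case: Mb.
    rewrite riskE in Mb inf.
    exact: (best_subset_norm_le n_gt0 s0 MB Mb inf bh_le).
  split; last by rewrite n0 mulr_ge0 // exprn_ge0.
  by rewrite /norm0 eq_card0 // => j; rewrite !inE mxE eqxx.
have nb : norm1 b ^+ 2 <= s%:R * norm2 b ^+ 2.
  have -> : s%:R * norm2 b ^+ 2 = (Num.sqrt s%:R * norm2 b) ^+ 2.
    by rewrite exprMn [Num.sqrt s%:R ^+ 2]sqr_sqrtr ?ler0n.
  rewrite lerXn2r ?nnegrE ?norm1_ge0 ?mulr_ge0 ?sqrtr_ge0 ?norm2_ge0 //.
  exact: norm1_le_norm2.
have sq : quad_form G (b - psi) <= 2 * norm1 b ^+ 2 + 2 * norm1 psi ^+ 2.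
  apply: (le_trans (quad_form_le_norm1 _)).
  apply: (@le_trans _ _ ((norm1 b + norm1 psi) ^+ 2)).
    rewrite lerXn2r ?nnegrE ?addr_ge0 ?norm1_ge0 //.
    by apply: (le_trans (norm1D _ _)); rewrite norm1N.
  rewrite -subr_ge0.
  have -> : 2 * norm1 b ^+ 2 + 2 * norm1 psi ^+ 2 - (norm1 b + norm1 psi) ^+ 2 =
    (norm1 b - norm1 psi) ^+ 2 by ring.
  exact: sqr_ge0.
apply: (le_trans sq); have np := sqr_norm1_psi.
have [s0|s0] := posnP s.
  by move: nb np; rewrite s0 !mul0r => nb np; lra.
have sn1 : 1 <= (s * n)%:R :> R by rewrite ler1n muln_gt0 s0.
pose e := (s * n)%:R ^+ (s + 2) : R.
have eE : (s * n)%:R ^+ (2 * (s + 2)) = e ^+ 2 :> R by rewrite /e -exprM [((s + 2) * 2)%N]mulnC.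
have e1 : 1 <= e ^+ 2 by rewrite -eE exprn_ege1.
have b2 : norm2 b ^+ 2 <= e ^+ 2 * (M + 2 * B) ^+ 2.
  rewrite -exprMn lerXn2r ?nnegrE ?norm2_ge0 ?mulr_ge0 ?exprn_ge0 //.
  exact: bn.
rewrite eE.
have -> : s%:R * (e ^+ 2 * (8 * B ^+ 2 / D + 2 * (M + 2 * B) ^+ 2)) =
    s%:R * (e ^+ 2 * (2 * (M + 2 * B) ^+ 2)) + s%:R * (e ^+ 2 * (8 * B ^+ 2 / D)) by ring.
apply: lerD; last first.
  apply: (@le_trans _ _ (s%:R * (8 * B ^+ 2 / D))).
    have -> : s%:R * (8 * B ^+ 2 / D) = 2 * (s%:R * (4 * B ^+ 2 / D)) by ring.
    by rewrite ler_wpM2l.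
  by rewrite ler_wpM2l // ler_peMl // divr_ge0 ?(ltW D_gt0) // mulr_ge0 // sqr_ge0.
apply: (@le_trans _ _ (2 * (s%:R * norm2 b ^+ 2))); first by rewrite ler_wpM2l.
have -> : s%:R * (e ^+ 2 * (2 * (M + 2 * B) ^+ 2)) =
  2 * (s%:R * (e ^+ 2 * (M + 2 * B) ^+ 2)) by ring.
by rewrite ler_wpM2l // ler_wpM2l.
Qed.

Definition gram_event : set Omega := [set w : Omega |
       ereal_sup
         [set (Num.norm (quad_form (second_moment P
                     - n%:R^-1 *: ((design (dataset D2 w))^T
                                    *m design (dataset D2 w))) v))%:E
          | v in [set v : 'cV[R]_k |
                    norm2 v = 1 /\ norm1 v <= 2 * Num.sqrt s%:R]]%R
       <= (D / 2)%:E]%E.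

Lemma gram_event_near w : gram_event w -> gram_near w.
Proof.
move=> h v cone; rewrite -quad_form_design -quad_formB.
exact: unit_cone_scale h v cone.
Qed.

(** The event depends only on the treatments in the second sample, which take finitely
    many values. *)
Lemma measurable_gram_event : measurable gram_event.
Proof.
pose tr w : n.-tuple (treatment k) := [tuple trtA (D2 i w) | i < n].
have mD2 i : measurable_fun [set: Omega] (D2 i) by exact: (mF (Some (inr i))).
have mtr : measurable_fun [set: Omega] tr.
  apply/measurable_fun_tnthP => i.
  rewrite (_ : _ \o _ = @trtA R d k \o D2 i); last first.
    by apply/funext => w; rewrite /= tnth_mktuple.
  exact: (measurableT_comp (@measurable_trtA R d k)).
pose dm (t : n.-tuple (treatment k)) : 'M[R]_(n, k) :=
  \matrix_(i, j) (tnth (tnth t i) j)%:R.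
have dE w : design (dataset D2 w) = dm (tr w).
  by apply/matrixP => i j; rewrite !mxE /tr /dataset !tnth_mktuple.
have -> : gram_event = tr @^-1` [set t |
  (ereal_sup [set (Num.norm (quad_form (second_moment P - n%:R^-1 *: ((dm t)^T *m dm t)) v))%:E
          | v in [set v : 'cV[R]_k | norm2 v = 1 /\ norm1 v <= 2 * Num.sqrt s%:R]]%R
       <= (D / 2)%:E)%E].
  by apply/seteqP; split => w; rewrite /gram_event /= dE.
rewrite -[X in measurable X]setTI; apply: mtr => //.
apply: countable_measurable; last exact: countableP.
by apply: measurable_tuple1 => t; exact: measurable_trt_set.
Qed.

(** If each entry of the empirical Gram matrix is within [D / (8 * s)] of its mean
    then the two forms differ by at most [D / (8 * s) * |v|_1 ^ 2] at [v], which is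
    at most [D / 2 * |v|_2 ^ 2] on the cone. *)
Lemma gram_near_excess (kap : R) : 0 < kap -> kap <= 1 -> 32 * 32 * 32 * kap <= D ^+ 2 ->
  s%:R ^+ 4 * ln k%:R <= ln 2 * kap ^+ 4 * n%:R ->
  exists (I : Omega -> R) (p : R), [/\ measurable_fun [set: Omega] I, forall w, 0 <= I w,
    forall w, ~ gram_near w -> 1 <= I w, (\int[Pr]_w (I w)%:E <= p%:E)%E &
    (s * n)%:R ^+ (2 * (s + 2)) * p <= 4 * (ln k%:R / n%:R)].
Proof.
move=> kap0 kap1 kapD hs.
have lnk := @ln_ge_half R k k_gt1.
have lnn : 0 <= ln k%:R / n%:R :> R by rewrite divr_ge0 //; lra.
have [s0|s0] := posnP s.
  exists (fun=> 0), 0; split => //; last by rewrite mulr0 mulr_ge0.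
  - move=> w []; move=> v; rewrite s0 sqrtr0 mulr0 mul0r => v1.
    have -> : v = 0.
      by apply: norm2_eq0; apply/le_anti; rewrite norm2_ge0 andbT (le_trans (norm2_le_norm1 v)).
    rewrite -[0 : 'cV_k](scale0r 0) quad_formZ gramZ norm2Z normr0 mul0r !expr0n /= !mul0r.
    by rewrite subrr normr0 mulr0.
  - by under eq_integral do rewrite /=; rewrite integral0.
pose h (ij : 'I_k * 'I_k) (x : unit * obs R d k) : R :=
  (tnth (trtA x.2) ij.1)%:R * (tnth (trtA x.2) ij.2)%:R.
have mh ij : measurable_fun [set: (unit * obs R d k)%type] (h ij).
  exact: (measurableT_comp (measurable_fun_trtA
    (fun a => (tnth a ij.1)%:R * (tnth a ij.2)%:R : R)) measurable_snd).
have h_range ij x : 0 <= h ij x <= 1.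
  by rewrite /h; case: (tnth _ _); case: (tnth _ _); rewrite ?mulr1 ?mulr0 ?ler01 ?lexx.
have inr_inj : injective (fun i : 'I_n => Some (inr i) : option ('I_n + 'I_n)).
  by move=> i j [].
have t0 : 0 < D / (8 * s%:R) by rewrite divr_gt0 // mulr_gt0 // ltr0n.
have [I [mI I0 I1 Ii]] := sample_mean_excess (@mF) lawF indF n_gt0 inr_inj
  (fun i => @cst_avoids _ _ _ _ _ F _ _ tt (Some (inr i))) mh ltr01 h_range t0.
eexists I, _; split; [exact: mI|exact: I0| |exact: Ii|].
  move=> w /existsNP[v] /not_implyP[cone far].
  have [[ij far_ij]|close] := EM (exists ij, D / (8 * s%:R) <
      `|sample_mean P F (fun=> tt) (fun i => Some (inr i)) h ij w|).
    exact: I1 far_ij.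
  exfalso; apply: far.
  rewrite -quad_form_design -quad_formB.
  apply: (le_trans (quad_form_le (t := D / (8 * s%:R)) _ _)).
    move=> i j; rewrite leNgt; apply/negP => lt; apply: close; exists (i, j).
    apply: (lt_le_trans lt); rewrite le_eqVlt; apply/orP; left; apply/eqP.
    rewrite -normrN; congr Num.norm.
    have Gij : cond_mean P (h (i, j)) tt = G i j.
      by rewrite /cond_mean (second_momentE P i j).
    have -> : (G - n%:R^-1 *: ((design (dataset D2 w))^T *m design (dataset D2 w))) i j =
        G i j - (n%:R^-1 *: ((design (dataset D2 w))^T *m design (dataset D2 w))) i j.
      by rewrite [LHS]mxE; congr (_ + _); rewrite [LHS]mxE.
    rewrite design_gramE /sample_mean /centered sumrB /= Gij.
    rewrite mulrBr average_cst opprB; congr (_ - _); congr (_ * _).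
    by apply: eq_bigr => l _; rewrite /h /= /sample_trt tnth_mktuple.
  have n12 : norm1 v ^+ 2 <= 4 * s%:R * norm2 v ^+ 2.
    have -> : 4 * s%:R * norm2 v ^+ 2 = (2 * Num.sqrt s%:R * norm2 v) ^+ 2.
      rewrite !exprMn [Num.sqrt s%:R ^+ 2]sqr_sqrtr ?ler0n //.
      by have -> : (2 : R) ^+ 2 = 4 by ring.
    by rewrite lerXn2r // nnegrE ?norm1_ge0 // !mulr_ge0 ?sqrtr_ge0 ?norm2_ge0.
  have sR : s%:R != 0 :> R by rewrite pnatr_eq0 -lt0n.
  have -> : D / 2 * norm2 v ^+ 2 = D / (8 * s%:R) * (4 * s%:R * norm2 v ^+ 2) by field.
  by rewrite ler_wpM2l // ltW.
have eb := exponential_beats_cramer D_gt0 kap0 kap1 kapD n_gt0 k_gt1 s0 hs.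
rewrite card_prod card_ord [(k * k)%:R]natrM.
apply: (@le_trans _ _ (2 * n%:R^-1)).
  rewrite -(ler_pM2l (x := 2)) in eb; last by [].
  apply: le_trans eb; rewrite le_eqVlt; apply/orP; left; apply/eqP.
  by rewrite (expr2 k%:R); ring.
by rewrite mulrA ler_wpM2r ?invr_ge0 //; lra.
Qed.

(** Either the Gram matrices are close and the first bound applies, or [I] is at
    least 1 and the crude bound is paid with its mean [p]. *)
Lemma risk_assembly (psihat : n.-tuple (obs R d k) -> n.-tuple (obs R d k) -> 'cV[R]_k)
    (I : Omega -> R) (L p : R) :
  psi_measurable psihat ->
  measurable_fun [set: Omega] I -> (forall w, 0 <= I w) ->
  (forall w, ~ gram_near w -> 1 <= I w) -> (\int[Pr]_w (I w)%:E <= p%:E)%E -> 0 <= L ->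
  {ae Pr, forall w, forall eta2,
    (forall j, (aipw_mean psi0 muhat pihat (dataset D1 w) (dataset D2 w) j -
        gram_vec (sample_trt (dataset D2 w)) psi j) ^+ 2 <= eta2) -> 0 <= eta2 ->
    gram_near w ->
    quad_form G (psihat (dataset D1 w) (dataset D2 w) - psi) <= 64 / D * s%:R * eta2} ->
  {ae Pr, forall w, quad_form G (psihat (dataset D1 w) (dataset D2 w) - psi) <= s%:R * L} ->
  (\int[Pr]_w (quad_form G (psihat (dataset D1 w) (dataset D2 w) - psi))%:E <=
   (64 / D * s%:R * (3 * (delta * eps) ^+ 2 +
      96 * ((4 * B) ^+ 2 + (2 * M) ^+ 2) * (ln k%:R / n%:R)) + s%:R * (L * p))%:E)%E.
Proof.
move=> mpsi mI I0 I1 Ip L0 good crude.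
have [Q1 [Q2 [[mQ1 mQ2] [Q10 Q20] Q1i Q2i dev]]] := score_deviation.
pose q w := quad_form G (psihat (dataset D1 w) (dataset D2 w) - psi).
have q0 w : 0 <= q w.
  rewrite /q; set v := _ - psi; have [->|v0] := eqVneq v 0.
    by rewrite -[0 : 'cV_k](scale0r 0) quad_formZ expr0n mul0r.
  by apply: le_trans (G_ge v0); rewrite mulr_ge0 ?sqr_ge0 // ltW.
have mU : measurable_fun [set: Omega] (fun w => (dataset D1 w, dataset D2 w)).
  by apply: (@avoids_measurable_fun _ _ _ _ _ F (@mF) None);
    apply: measurable_fun_pair; [exact: D1_avoids|exact: D2_avoids].
have mv j : measurable_fun [set: Omega] (fun w => (psihat (dataset D1 w) (dataset D2 w) - psi) j 0).
  under eq_fun do rewrite !mxE.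
  by apply: measurable_funB => //; exact: (measurableT_comp (mpsi j) mU).
have mq : measurable_fun [set: Omega] (fun w => (q w)%:E).
  apply/measurable_EFinP; rewrite (_ : q = fun w => \sum_i \sum_j
      (psihat (dataset D1 w) (dataset D2 w) - psi) i 0 * G i j *
      (psihat (dataset D1 w) (dataset D2 w) - psi) j 0); last first.
    by apply/funext => w; rewrite /q quad_formE.
  apply: measurable_sum => i; apply: measurable_sum => j.
  by apply: measurable_funM => //; exact: measurable_funM.
pose a0 : R := 64 / D * s%:R * (3 * (delta * eps) ^+ 2).
pose a1 : R := 64 / D * s%:R * 3.
pose a2 : R := s%:R * L.
have D64 : 0 <= 64 / D by rewrite divr_ge0 // ltW.
have Ds : 0 <= 64 / D * s%:R by exact: mulr_ge0.
have a00 : 0 <= a0 by apply: mulr_ge0 => //; apply: mulr_ge0 => //; exact: sqr_ge0.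
have a10 : 0 <= a1 by exact: mulr_ge0.
have a20 : 0 <= a2 by rewrite mulr_ge0.
have mE (f : Omega -> R) : measurable_fun [set: Omega] f ->
  measurable_fun [set: Omega] (fun w => (f w)%:E) by move=> mf; exact/measurable_EFinP.
have aff (f : Omega -> R) (a b c : R) : measurable_fun [set: Omega] f -> (forall w, 0 <= f w) ->
    0 <= a -> 0 <= b -> (\int[Pr]_w (f w)%:E <= c%:E)%E ->
    (\int[Pr]_w (a + b * f w)%:E <= (a + b * c)%:E)%E.
  move=> mf f0 a0' b0 fc; rewrite ge0_integral_affine // EFinD EFinM leeD2l //.
  by rewrite lee_wpmul2l // lee_fin.
have i1 : (\int[Pr]_w (a0 + a1 * Q1 w)%:E <=
    (a0 + a1 * (32 * (4 * B) ^+ 2 * (ln k%:R / n%:R)))%:E)%E.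
  exact: aff.
have i2 : (\int[Pr]_w (0 + a1 * Q2 w)%:E <=
    (0 + a1 * (32 * (2 * M) ^+ 2 * (ln k%:R / n%:R)))%:E)%E.
  exact: aff.
have i3 : (\int[Pr]_w (0 + a2 * I w)%:E <= (0 + a2 * p)%:E)%E.
  exact: aff.
have m1 : measurable_fun [set: Omega] (fun w => (a0 + a1 * Q1 w)%:E).
  by apply: mE; apply: measurable_funD => //; exact: measurable_funM.
have m2 : measurable_fun [set: Omega] (fun w => (0 + a1 * Q2 w)%:E).
  by apply: mE; apply: measurable_funD => //; exact: measurable_funM.
have m3 : measurable_fun [set: Omega] (fun w => (0 + a2 * I w)%:E).
  by apply: mE; apply: measurable_funD => //; exact: measurable_funM.
have t1 w : 0 <= a1 * Q1 w by exact: mulr_ge0.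
have t2 w : 0 <= a1 * Q2 w by exact: mulr_ge0.
have t3 w : 0 <= a2 * I w by exact: mulr_ge0.
have p1 w : (0 <= (a0 + a1 * Q1 w)%:E)%E by rewrite lee_fin addr_ge0.
have p2 w : (0 <= (0 + a1 * Q2 w)%:E)%E by rewrite lee_fin addr_ge0.
have p3 w : (0 <= (0 + a2 * I w)%:E)%E by rewrite lee_fin addr_ge0.
apply: (@le_trans _ _ (\int[Pr]_w ((a0 + a1 * Q1 w)%:E + (0 + a1 * Q2 w)%:E +
    (0 + a2 * I w)%:E))%E).
  apply: ae_ge0_le_integral => //.
  - by move=> w _; rewrite lee_fin; exact: q0.
  - by move=> w _; rewrite !adde_ge0.
  - by apply: emeasurable_funD => //; exact: emeasurable_funD.
  - apply: filterS3 dev good crude => w dw gw cw _; rewrite -!EFinD lee_fin.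
    have e0 : 0 <= 3 * (delta * eps) ^+ 2 + 3 * Q1 w + 3 * Q2 w.
      have := Q10 w; have := Q20 w; have := sqr_ge0 (delta * eps); lra.
    have [near|far] := EM (gram_near w).
      apply: (le_trans (gw _ dw e0 near)).
      rewrite -subr_ge0.
      have -> : a0 + a1 * Q1 w + (0 + a1 * Q2 w) + (0 + a2 * I w) -
        64 / D * s%:R * (3 * (delta * eps) ^+ 2 + 3 * Q1 w + 3 * Q2 w) = a2 * I w.
        by rewrite /a0 /a1; ring.
      exact: t3.
    apply: (le_trans cw); apply: (@le_trans _ _ (a2 * I w)).
      by rewrite -/a2 ler_peMr // I1.
    by rewrite !add0r lerDr !addr_ge0.
rewrite ge0_integralD //; [|by move=> w _; rewrite adde_ge0|exact: emeasurable_funD].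
rewrite ge0_integralD //.
apply: (le_trans (leeD (leeD i1 i2) i3)); rewrite -!EFinD lee_fin le_eqVlt; apply/orP; left.
by apply/eqP; rewrite /a0 /a1 /a2; ring.
Qed.

End SampleSplitting.

Theorem theorem5 (R : realType) (B Ca D : R) :
  0 < B -> 0 < Ca -> 0 < D ->
  exists c0 : R, 0 < c0 /\
  forall (m : method) (c : R), 0 < c -> (m = BestSubset -> c <= c0) ->
  exists C : R, 0 < C /\
  forall (n k s d : nat) (d0 : measure_display) (Omega : measurableType d0)
    (Pr : probability Omega R) (P : probability (obs R d k) R)
    (D1 D2 : 'I_n -> Omega -> obs R d k) (Z0 : Omega -> obs R d k)
    (pi mu : treatment k -> d.-tuple R -> R)
    (pihat muhat : nuisance R d k n)
    (psi0 : R) (psi : 'cV[R]_k)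
    (psihat : n.-tuple (obs R d k) -> n.-tuple (obs R d k) -> 'cV[R]_k)
    (alpha delta epsilon : R),
  (0 < n)%N -> (1 < k)%N ->
  iid_samples Pr P D1 D2 Z0 ->
  is_propensity P pi ->
  {ae P, forall z : obs R d k, forall a : treatment k, 0 < pi a (covX z)} ->
  is_regression P mu ->
  nuisance_measurable pihat -> nuisance_measurable muhat ->
  (forall a : treatment k,
     (\int[P]_z (mu a (covX z))%:E)%E
       = (psi0 + \sum_(j < k) psi j 0 * (tnth a j)%:R)%:E) ->
  (norm0 psi <= s)%N ->
  psi_measurable psihat ->
  {ae Pr, forall w : Omega,
     selected m psi s
       (emp_risk psi0 muhat pihat (dataset D1 w) (dataset D2 w))
       (psihat (dataset D1 w) (dataset D2 w))} ->
  {ae Pr, forall w : Omega, forall a : treatment k,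
     pihat (dataset D1 w) a (covX (Z0 w)) != 0 /\
     `| trt_freq (dataset D1 w) a / pihat (dataset D1 w) a (covX (Z0 w)) |
       <= B} ->
  (forall v : 'cV[R]_k, v != 0 ->
     D * norm2 v ^+ 2 <= quad_form (second_moment P) v) ->
  alpha <= Ca * (ln k%:R / n%:R) ->
  ((1 - alpha)%:E <=
     Pr [set w : Omega |
       ereal_sup
         [set (Num.norm (quad_form (second_moment P
                     - n%:R^-1 *: ((design (dataset D2 w))^T
                                    *m design (dataset D2 w))) v))%:E
          | v in [set v : 'cV[R]_k |
                    norm2 v = 1 /\ norm1 v <= 2 * Num.sqrt s%:R]]%R
       <= (D / 2)%:E])%E ->
  {ae Pr, forall w : Omega,
     `| outY (Z0 w) | <= B /\
     forall a : treatment k, `| muhat (dataset D1 w) a (covX (Z0 w)) | <= B} ->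
  `| psi0 | <= B ->
  {ae Pr, forall w : Omega, forall a : treatment k,
     (Lnorm P 2%:E (fun z : obs R d k =>
         (pi a (covX z) / pihat (dataset D1 w) a (covX z) - 1)%:E)
       <= delta%:E)%E /\
     (Lnorm P 2%:E (fun z : obs R d k =>
         (mu a (covX z) - muhat (dataset D1 w) a (covX z))%:E)
       <= epsilon%:E)%E} ->
  s%:R ^+ 4 * ln k%:R <= c * n%:R ->
  ('E_Pr[fun w : Omega =>
       (trt_dot (trtA (Z0 w))
          (psihat (dataset D1 w) (dataset D2 w) - psi) ^+ 2)%R]
    <= (C * (s%:R * (ln k%:R / n%:R) + s%:R * (delta * epsilon) ^+ 2))%:E)%E.
Proof.
move=> B0 Ca0 D0.
(* kap makes the exponent D^2 n / (512 s^2) of Hoeffding's bound exceed the logarithm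
   of Cramer's bound *)
pose kap : R := Num.min 1 (D ^+ 2 / (32 * 32 * 32)).
have kap0 : 0 < kap by rewrite lt_min ltr01 divr_gt0 // exprn_gt0.
have kap1 : kap <= 1 by rewrite ge_min lexx.
have kapD : 32 * 32 * 32 * kap <= D ^+ 2.
  have -> : D ^+ 2 = 32 * 32 * 32 * (D ^+ 2 / (32 * 32 * 32)) by field.
  by rewrite ler_wpM2l // ge_min lexx orbT.
have ln2 : 0 < ln 2 :> R by have := @ln_ge_half R 2 isT; lra.
exists (ln 2 * kap ^+ 4); split; first by rewrite mulr_gt0 // exprn_gt0.
move=> m c c0 hc.
(* M bounds the score; K1, K2, K3 and K4 are the shares of the bias, of the two
   centered averages, of the bad event for the Lasso and for the best subset *)
pose M : R := 2 * B ^+ 2 + 4 * B.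
pose K1 : R := 64 / D * 3.
pose K2 : R := 64 / D * (96 * ((4 * B) ^+ 2 + (2 * M) ^+ 2)).
pose K3 : R := 16 * B ^+ 2 / D * Ca.
pose K4 : R := 4 * (8 * B ^+ 2 / D + 2 * (M + 2 * B) ^+ 2).
have K10 : 0 < K1 by rewrite mulr_gt0 // divr_gt0.
have K20 : 0 <= K2.
  by rewrite mulr_ge0 ?divr_ge0 ?(ltW D0) // mulr_ge0 // addr_ge0 ?sqr_ge0.
have K30 : 0 <= K3.
  by rewrite mulr_ge0 ?(ltW Ca0) // divr_ge0 ?(ltW D0) // mulr_ge0 // sqr_ge0.
have K40 : 0 <= K4.
  rewrite mulr_ge0 // addr_ge0 //; last by rewrite mulr_ge0 // sqr_ge0.
  by rewrite divr_ge0 ?(ltW D0) // mulr_ge0 // sqr_ge0.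
exists (K1 + K2 + K3 + K4); split; first by lra.
move=> n k s d d0 Omega Pr P D1 D2 Z0 pi mu pihat muhat psi0 psi psihat alpha delta eps
  n_gt0 k_gt1 iid propP pi_gt0 regP mpihat mmuhat msm psi_sparse mpsi sel ae_pi G_ge
  alpha_le event ae_Ymu psi0_le ae_close hs.
have ae_regular : {ae Pr, forall w, regular B muhat pihat (dataset D1 w) (Z0 w)}.
  apply: filterS2 ae_pi ae_Ymu => w h1 [h2 h3].
  by split=> // a; exact: (h1 a).2.
rewrite (fresh_copy psi iid mpsi).
have lnn : 0 <= ln k%:R / n%:R :> R.
  by rewrite divr_ge0 //; have := @ln_ge_half R k k_gt1; lra.
have asm := risk_assembly B0 D0 n_gt0 k_gt1 iid propP pi_gt0 regP mpihat mmuhat msm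
  G_ge psi0_le ae_regular ae_close mpsi.
have fin L p : L * p <= (K3 + K4) * (ln k%:R / n%:R) ->
  64 / D * s%:R * (3 * (delta * eps) ^+ 2 +
      96 * ((4 * B) ^+ 2 + (2 * M) ^+ 2) * (ln k%:R / n%:R)) + s%:R * (L * p) <=
  (K1 + K2 + K3 + K4) *
    (s%:R * (ln k%:R / n%:R) + s%:R * (delta * eps) ^+ 2).
  move=> Lp; have sLp := ler_wpM2l (ler0n R s) Lp.
  have t1 : 0 <= s%:R * (ln k%:R / n%:R) :> R by rewrite mulr_ge0.
  have t2 : 0 <= s%:R * (delta * eps) ^+ 2 by rewrite mulr_ge0 ?sqr_ge0.
  have := mulr_ge0 (ltW K10) t1.
  have := mulr_ge0 (addr_ge0 K20 (addr_ge0 K30 K40)) t2.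
  have -> : 64 / D * s%:R * (3 * (delta * eps) ^+ 2 +
      96 * ((4 * B) ^+ 2 + (2 * M) ^+ 2) * (ln k%:R / n%:R)) =
      K1 * (s%:R * (delta * eps) ^+ 2) + K2 * (s%:R * (ln k%:R / n%:R)).
    by rewrite /K1 /K2; ring.
  move: sLp; set u := ln k%:R / n%:R; set v := (delta * eps) ^+ 2.
  move=> h1 h2 h3; nra.
case: m hc sel => [_ sel|hc sel].
- pose I w : R := \1_(~` gram_event D s P D2) w.
  have mE := measurable_gram_event D s iid.
  apply: (le_trans (asm s I (16 * B ^+ 2 / D) (Ca * (ln k%:R / n%:R)) _ _ _ _ _ _ _)).
  + by apply: measurable_indic; exact: measurableC.
  + by move=> w; rewrite /I indicE.
  + move=> w far; rewrite /I indicE mem_set //= => e3.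
    by apply: far; exact: gram_event_near.
  + rewrite integral_indic ?setIT //; last exact: measurableC.
    rewrite /= probability_setC //.
    have ev : ((1 - alpha)%:E <= Pr (gram_event D s P D2))%E := event.
    have fE : Pr (gram_event D s P D2) \is a fin_num by exact: fin_num_measure.
    rewrite -(fineK fE) -EFinB lee_fin; rewrite -(fineK fE) lee_fin in ev.
    by move: ev alpha_le; lra.
  + by rewrite divr_ge0 ?(ltW D0) // mulr_ge0 // sqr_ge0.
  + apply: filterS sel => w sw eta2 e e0 near.
    exact: (lasso_risk_le D0 psi_sparse G_ge sw e e0 near).
  + apply: filterS sel => w sw.
    exact: (lasso_crude_bound B0 D0 iid propP pi_gt0 regP mpihat mmuhat msm
      psi_sparse G_ge psi0_le ae_regular sw).
  rewrite lee_fin; apply: fin.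
  have -> : 16 * B ^+ 2 / D * (Ca * (ln k%:R / n%:R)) = K3 * (ln k%:R / n%:R).
    by rewrite /K3; ring.
  by rewrite ler_wpM2r // lerDl.
- have cc0 : c <= ln 2 * kap ^+ 4 by exact: hc.
  have hs' : s%:R ^+ 4 * ln k%:R <= ln 2 * kap ^+ 4 * n%:R.
    by apply: (le_trans hs); rewrite ler_wpM2r.
  have [I [p [mI I0 I1 Ip pb]]] :=
    gram_near_excess D0 n_gt0 k_gt1 iid kap0 kap1 kapD hs'.
  pose X : R := (s * n)%:R ^+ (2 * (s + 2)).
  have X0 : 0 <= X by rewrite exprn_ge0.
  apply: (le_trans (asm s I (X * (8 * B ^+ 2 / D + 2 * (M + 2 * B) ^+ 2)) p mI I0 I1 Ip _ _ _)).
  + rewrite mulr_ge0 // addr_ge0 //; last by rewrite mulr_ge0 // sqr_ge0.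
    by rewrite divr_ge0 ?(ltW D0) // mulr_ge0 // sqr_ge0.
  + apply: filterS sel => w sw eta2 e e0 near.
    exact: (subset_risk_le D0 n_gt0 psi_sparse G_ge sw e e0 near).
  + have am := aipw_mean_le B0 n_gt0 iid propP pi_gt0 regP mpihat mmuhat msm psi0_le ae_regular.
    by apply: filterS2 sel am => w sw aw; exact: (subset_crude_bound B0 D0 n_gt0 iid propP pi_gt0
      regP mpihat mmuhat msm psi_sparse G_ge psi0_le ae_regular sw aw).
  rewrite lee_fin; apply: fin; rewrite mulrAC.
  set e := 8 * B ^+ 2 / D + 2 * (M + 2 * B) ^+ 2 in K40 *.
  have e0 : 0 <= e by move: K40; rewrite /K4 -/e; lra.
  have K3L : 0 <= K3 * (ln k%:R / n%:R) by exact: mulr_ge0.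
  apply: (le_trans (ler_wpM2r e0 pb)).
  have -> : 4 * (ln k%:R / n%:R) * e = K4 * (ln k%:R / n%:R) by rewrite /K4 -/e; ring.
  by rewrite mulrDl lerDr.
Qed.
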